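(* Let $\mathcal{T}_h$ be an arbitrary partition of $I=(0,T)$, let $u$ be the exact solution of the initial value problem $u''(t)=f(t,u(t),u'(t))$, $t\in[0,T]$, $u(0)=u_0$, $u'(0)=u_1$, and let $U\in S^{\mathbf r,2}(\mathcal T_h)$ be its $C^1$-CPG solution. Assume that $u\in H^2(I)$ satisfies $u|_{I_n}\in H^{s_{0,n}+1}(I_n)$ for $s_{0,n}\ge 1$, $1\le n\le N$. Then, for $k_n$ sufficiently small and $r_n\ge 3$, we have $$\|u-U\|^2_{H^1(I)}\le C\sum_{n=1}^N\Big(\frac{k_n}{2}\Big)^{2s_n}\frac{\Gamma(r_n-s_n+1)}{\Gamma(r_n+s_n-1)}\frac{1}{r_n(r_n-1)}\|u\|^2_{H^{s_n+1}(I_n)},$$ $$\|u-U\|^2_{H^2(I)}\le C\sum_{n=1}^N\Big(\frac{k_n}{2}\Big)^{2s_n-2}\frac{\Gamma(r_n-s_n+1)}{\Gamma(r_n+s_n-1)}\|u\|^2_{H^{s_n+1}(I_n)}$$ for any real $s_n$ with $1\le s_n\le\min\{r_n,s_{0,n}\}$, where the constant $C>0$ is independent of $k_n$, $r_n$ and $s_n$. In particular, if $\mathcal T_h$ is a quasi-uniform partition, i.e. there exists a constant $C_q\ge1$ such that $1\le k/k_n\le C_q$ for $1\le n\le N$, and if $u\in H^{s+1}(I)$ with $s\ge1$ and $r_n\equiv r$, then $$\|u-U\|_{H^1(I)}\le C\frac{k^{\min\{r,s\}}}{r^s}\|u\|_{H^{s+1}(I)},\qquad \|u-U\|_{H^2(I)}\le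 C\frac{k^{\min\{r,s\}-1}}{r^{s-1}}\|u\|_{H^{s+1}(I)},$$ where the constant $C>0$ is independent of $k$ and $r$.
   Context: Problem: $T>0$, $I=(0,T)$, $u_0,u_1\in\mathbb R$, and $f:\bar I\times\mathbb R\times\mathbb R\to\mathbb R$ is continuous for $t\in\bar I$ and satisfies the uniform Lipschitz condition $|f(t,u_1,v_1)-f(t,u_2,v_2)|\le L(|u_1-u_2|+|v_1-v_2|)$ for all $u_i,v_i\in\mathbb R$ and $t\in\bar I$, with $L>0$ independent of $t$. Discretization: a partition $\mathcal T_h=\{I_n\}_{n=1}^N$ of $I$ consists of subintervals $I_n=(t_{n-1},t_n)$, $0=t_0<t_1<\dots<t_N=T$; $k_n=t_n-t_{n-1}$, $k=\max_{1\le n\le N}k_n$. Each $I_n$ is assigned an integer degree $r_n\ge2$; $\mathbf r=\{r_n\}_{n=1}^N$. $P_m(I_n)$ is the space of polynomials of degree at most $m$ on $I_n$. Set $S^{\mathbf r,2}(\mathcal T_h)=\{v\in H^2(I): v|_{I_n}\in P_{r_n}(I_n),1\le n\le N\}$ and $S^{\mathbf r-2,0}(\mathcal T_h)=\{v\in L^2(I): v|_{I_n}\in P_{r_n-2}(I_n),1\le n\le N\}$. The $C^1$-CPG solution is $U\in S^{\mathbf r,2}(\mathcal T_h)$ with $U(0)=u_0$, $U'(0)=u_1$ and $\sum_{n=1}^N\int_{I_n}U''\varphi\,dt=\sum_{n=1}^N\int_{I_n}f(t,U,U')\varphi\,dt$ for all $\varphi\in S^{\mathbf r-2,0}(\mathcal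 T_h)$. Conventions: $H^s=W^{s,2}$, with fractional-order spaces $W^{s,p}$ defined by the usual $K$-method of interpolation; $\Gamma$ is the gamma function. ''For $k_n$ sufficiently small'' means: whenever $\max_n k_n\le k_0$ for some threshold $k_0>0$ not depending on the partition or on the degrees. $C$ denotes a generic positive constant independent of the discretization parameters (time steps and degrees); $C_q$ is regarded as fixed over the quasi-uniform partitions considered. *)

(* Defs.v *)
From HB Require Import structures.
From mathcomp Require Import all_boot all_order all_algebra.
From mathcomp Require Import all_classical all_reals all_analysis.
Import Order.TTheory GRing.Theory Num.Theory.
Import numFieldNormedType.Exports.

Set Implicit Arguments.
Unset Strict Implicit.
Unset Printing Implicit Defensive.

Local Open Scope classical_set_scope.
Local Open Scope ring_scope.

(* Functions on an interval are total functions R -> R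
   whose values outside the interval are irrelevant. *)

Definition Gamma (R : realType) (x : R) : R :=
  \int[lebesgue_measure]_(t in `]0, +oo[) (t `^ (x - 1) * expR (- t)).

Definition memL2 (R : realType) (a b : R) (g : R -> R) : Prop :=
  (g \_ `]a, b[) \in Lfun (@lebesgue_measure R) 2%:E.

Definition L2norm (R : realType) (a b : R) (g : R -> R) : \bar R :=
  'N[@lebesgue_measure R]_2%:E[EFin \o (g \_ `]a, b[)].

Definition test_function (R : realType) (a b : R) (phi : R -> R) : Prop :=
  [/\ forall (j : nat) (x : R), derivable (derive1n j phi) x 1,
      compact (closure [set x | phi x != 0]) &
      closure [set x | phi x != 0] `<=` `]a, b[].

Definition weak_derivative (R : realType) (a b : R) (j : nat) (u g : R -> R)
    : Prop :=
  [/\ locally_integrable (`]a, b[ : set R) u,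
      locally_integrable (`]a, b[ : set R) g &
      forall phi : R -> R, test_function a b phi ->
        \int[lebesgue_measure]_(x in `]a, b[) (u x * derive1n j phi x) =
        (-1) ^+ j * \int[lebesgue_measure]_(x in `]a, b[) (g x * phi x)].

(* Some j-th weak derivative, unique up to a null set (junk if none exists). *)
Definition wder (R : realType) (a b : R) (j : nat) (u : R -> R) : R -> R :=
  xget (cst 0) [set g | weak_derivative a b j u g].

Definition inHn (R : realType) (m : nat) (a b : R) (u : R -> R) : Prop :=
  forall j : nat, (j <= m)%N ->
    exists2 g : R -> R, weak_derivative a b j u g & memL2 a b g.

Definition Hn_norm (R : realType) (m : nat) (a b : R) (u : R -> R) : \bar R :=
  if `[< inHn m a b u >] then
    ((\sum_(j < m.+1) L2norm a b (wder a b j u) ^+ 2) `^ 2^-1)%E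
  else +oo%E.

Definition K_functional (R : realType) (m : nat) (a b t : R) (u : R -> R)
    : \bar R :=
  ereal_inf [set z : \bar R | exists v w : R -> R,
    (forall x, a < x < b -> u x = v x + w x) /\
    z = (Hn_norm m a b v + t%:E * Hn_norm m.+1 a b w)%E].

(* Norm of the interpolation space (H^m, H^{m+1})_{theta, 2}. *)
Definition K_norm (R : realType) (m : nat) (theta a b : R) (u : R -> R)
    : \bar R :=
  ((\int[lebesgue_measure]_(t in `]0%R, +oo[)
      (((t `^ (- theta))%:E * K_functional m a b t u) ^+ 2 * (t^-1)%:E))
    `^ 2^-1)%E.

Definition Hnorm (R : realType) (s a b : R) (u : R -> R) : \bar R :=
  let m := Num.truncn s in
  let theta := s - m%:R in
  if theta == 0 then Hn_norm m a b u else K_norm m theta a b u.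

Definition inH (R : realType) (s a b : R) (u : R -> R) : Prop :=
  (Hnorm s a b u < +oo)%E.

(* Derivative relative to D: one-sided at the endpoints of a closed
   interval. *)
Definition has_derivative_on (R : realType) (D : set R) (v v' : R -> R)
    : Prop :=
  forall x : R, D x ->
    (fun y => (v y - v x) / (y - x)) @ within D x^' --> v' x.

Definition exact_solution (R : realType) (T : R) (f : R -> R -> R -> R)
    (u0 u1 : R) (u : R -> R) : Prop :=
  exists u' : R -> R,
    [/\ has_derivative_on `[0, T] u u',
        has_derivative_on `[0, T] u' (fun t => f t (u t) (u' t)),
        u 0 = u0 & u' 0 = u1].

(* Partitions 0 = t_0 < ... < t_N = T.  The subintervals are numbered from 0:
   for n : 'I_N the n-th one is ]t n, t n.+1[. *)

Definition is_partition (R : realType) (T : R) (N : nat) (t : nat -> R)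
    : Prop :=
  [/\ t 0%N = 0, t N = T & forall n : nat, (n < N)%N -> t n < t n.+1].

Definition step (R : realType) (t : nat -> R) (n : nat) : R := t n.+1 - t n.

Definition maxstep (R : realType) (N : nat) (t : nat -> R) : R :=
  \big[Num.max/0]_(n < N) step t n.

Definition poly_on (R : realType) (m : nat) (a b : R) (v : R -> R) : Prop :=
  exists2 p : {poly R}, (size p <= m.+1)%N &
    forall x : R, a < x < b -> v x = p.[x].

(* S^{d,m}; for m = 0, inHn is membership in L^2. *)
Definition inS (R : realType) (m : nat) (T : R) (N : nat) (t : nat -> R)
    (d : 'I_N -> nat) (v : R -> R) : Prop :=
  inHn m 0 T v /\ forall n : 'I_N, poly_on (d n) (t n) (t n.+1) v.

(* An element of S^{r,2} is represented by its C^1 representative on [0, T],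
   whose classical derivative is U' and whose second weak derivative is
   wder 0 T 2 U. *)
Definition C1CPG_solution (R : realType) (T : R) (f : R -> R -> R -> R)
    (u0 u1 : R) (N : nat) (t : nat -> R) (r : 'I_N -> nat) (U : R -> R)
    : Prop :=
  inS 2 T t r U /\
  exists U' : R -> R,
    [/\ has_derivative_on `[0, T] U U', U 0 = u0, U' 0 = u1 &
        forall phi : R -> R, inS 0 T t (fun n => (r n - 2)%N) phi ->
          \sum_(n < N) \int[lebesgue_measure]_(x in `]t n, t n.+1[)
            (wder 0 T 2 U x * phi x) =
          \sum_(n < N) \int[lebesgue_measure]_(x in `]t n, t n.+1[)
            (f x (U x) (U' x) * phi x)].

(* Main.v *)
(* On a subinterval I_n of length k_n let e = u - U, F = u'' and let P be the
   L^2 projection onto P_{r_n-2}.  The Galerkin condition says U'' = P f(U, U'),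
   so e is the sum of eta, with eta'' = F - P F and eta = eta' = 0 at both ends
   (F - P F is orthogonal to affine functions), and of a piecewise polynomial xi
   with xi'' = P (F - f(U, U')).  Orthogonality of eta' to P_{r_n-3} gives
   |eta'|^2 <= (k_n/2)^2 |F - P F|^2 / ((r_n-1)(r_n-2)), and an energy estimate
   for xi with a discrete Gronwall inequality bounds the H^1 and H^2 errors by
   sums of |F - P F|^2 with constants depending on T and L only.
   For F with derivative D^j of order j, Bessel's inequality for the j-th
   derivatives of the Legendre polynomials, which are orthogonal in the space
   weighted by ((x-a)(b-x))^j, gives
   |F - P F|^2 <= (k_n/2)^(2j) (r-1-j)!/(r-1+j)! |D^j|^2.
   Non-integer orders follow since |F - P F| <= M0 |v|_{H^m} + M1 |w|_{H^{m+1}}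
   for every splitting u = v + w: the K-functional at tau = M1/M0 is at most a
   multiple of tau^theta times the interpolation norm.  The factorials become
   Gamma quotients by Gamma(y + theta) <= y^theta Gamma(y). *)

From HB Require Import structures.
Require Import Defs.
From mathcomp Require Import all_boot all_order all_algebra.
From mathcomp Require Import all_classical all_reals all_analysis.
From mathcomp Require Import measurable_realfun zify ring lra.
Import Order.TTheory GRing.Theory Num.Theory.
Import numFieldNormedType.Exports.
Local Open Scope classical_set_scope.
Local Open Scope ring_scope.

Set Implicit Arguments.
Unset Strict Implicit.
Unset Printing Implicit Defensive.

(** * Integrals over open intervals *)

(** The steps must satisfy (2 + 4 L^2) k_n <= 1/2: then the part of the energy of xi that returns
    through the Lipschitz bound is absorbed. The nodal error is carried by xi alone and passes to
    the next subinterval with a factor 1 + O(k_n) free of r_n. This rests on affine functions lying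
    in P_{r_n-2}, that is on r_n >= 3. Bessel's inequality reaches finitely many Legendre modes
    only; the tail is removed by density of polynomials, proved with Bernstein polynomials and
    Cauchy-Schwarz. Weak derivatives are known up to null sets. The du Bois-Reymond lemma turns them
    into pairs (G, g) where the increments of G are the integrals of g, and integration by parts is
    proved for such pairs from increments, without differentiating G. In the quasi-uniform estimate
    u is split on the whole interval: the root of the sum of the squared local projection errors
    obeys the triangle inequality, so the K-functional argument applies to it directly. A single
    subinterval is the case N = 1 of the same lemma. The usable order of smoothness is capped by the
    degree, whence the minimum of r and s in the power of k. *)

Definition intoo (R : realType) (a b : R) (f : R -> R) : R :=
  \int[lebesgue_measure]_(x in `]a, b[) f x.

Definition intgoo (R : realType) (a b : R) (f : R -> R) : Prop :=
  (@lebesgue_measure R).-integrable `]a, b[ (EFin \o f).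

Definition ccont (R : realType) (a b : R) (f : R -> R) : Prop :=
  {within `[a, b], continuous f}.

Definition L2oo (R : realType) (a b : R) (f : R -> R) : Prop :=
  measurable_fun (`]a, b[ : set R) f /\ intgoo a b (fun x => f x ^+ 2).

(** Absolute continuity in integral form. The density g matters only up to null sets, which fits
    weak derivatives, and no pointwise derivative of G is involved. *)
Definition prim (R : realType) (a b : R) (G g : R -> R) : Prop :=
  intgoo a b g /\
  forall x y, a <= x -> x <= y -> y <= b -> G y - G x = intoo x y g.

Section Toolkit.
Context {R : realType}.
Implicit Types (a b c x y : R) (f g : R -> R).
Local Notation mu := (@lebesgue_measure R).

Lemma moo a b : measurable (`]a, b[ : set R).
Proof. exact: measurable_itv. Qed.
Hint Resolve moo : core.

Lemma lebesgue_measure_oo a b : mu `]a, b[%classic = (if a < b then (b - a)%:E else 0%E).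
Proof.
have := lebesgue_measure_itv `]a, b[; rewrite /= lte_fin => ->.
by case: ifP.
Qed.

Lemma intgoo_meas a b f : intgoo a b f -> measurable_fun (`]a, b[ : set R) f.
Proof. by move=> /measurable_int /measurable_EFinP. Qed.

Lemma intgooS a b c d f : a <= c -> d <= b -> intgoo a b f -> intgoo c d f.
Proof.
move=> ac db; apply: integrableS => //.
by apply: subset_itv; rewrite bnd_simp.
Qed.

Lemma eq_intoo a b f g : (forall x, a < x < b -> f x = g x) ->
  intoo a b f = intoo a b g.
Proof.
by move=> fg; apply: eq_Rintegral => x; rewrite inE/= in_itv/= => /fg.
Qed.

Lemma eq_intgoo a b f g : (forall x, a < x < b -> f x = g x) ->
  intgoo a b f -> intgoo a b g.
Proof.
move=> fg; apply: eq_integrable => // x; rewrite inE/= in_itv/= => /fg.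
by move=> ->.
Qed.

Lemma intgooD a b f g : intgoo a b f -> intgoo a b g ->
  intgoo a b (fun x => f x + g x).
Proof. move=> If Ig; rewrite /intgoo.
rewrite (_ : EFin \o _ = (EFin \o f) \+ (EFin \o g))%E; last exact/funext.
exact: integrableD. Qed.

Lemma intgooN a b f : intgoo a b f -> intgoo a b (fun x => - f x).
Proof. by move=> If; exact: (integrableN If). Qed.

Lemma intgooB a b f g : intgoo a b f -> intgoo a b g ->
  intgoo a b (fun x => f x - g x).
Proof. by move=> If Ig; apply: intgooD => //; exact: intgooN. Qed.

Lemma intgooZ a b k f : intgoo a b f -> intgoo a b (fun x => k * f x).
Proof. move=> If; rewrite /intgoo.
rewrite (_ : EFin \o _ = (fun x => k%:E * (EFin \o f) x))%E; last exact/funext.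
exact: integrableZl. Qed.

Lemma intoo0 a b : intoo a b (fun=> 0) = 0.
Proof. by rewrite /intoo Rintegral_cst// mul0r. Qed.

Lemma intooD a b f g : intgoo a b f -> intgoo a b g ->
  intoo a b (fun x => f x + g x) = intoo a b f + intoo a b g.
Proof. by move=> If Ig; apply: RintegralD. Qed.

Lemma intooB a b f g : intgoo a b f -> intgoo a b g ->
  intoo a b (fun x => f x - g x) = intoo a b f - intoo a b g.
Proof. by move=> If Ig; apply: RintegralB. Qed.

Lemma intooZ a b k f : intgoo a b f ->
  intoo a b (fun x => k * f x) = k * intoo a b f.
Proof. by move=> If; apply: RintegralZl. Qed.

Lemma intooN a b f : intgoo a b f -> intoo a b (fun x => - f x) = - intoo a b f.
Proof.
move=> If; rewrite -mulN1r -intooZ//; apply: eq_intoo => x _.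
by rewrite mulN1r.
Qed.

Lemma intoo_ge0 a b f : (forall x, a < x < b -> 0 <= f x) -> 0 <= intoo a b f.
Proof. by move=> f0; apply: Rintegral_ge0 => x /=; rewrite in_itv/= => /f0. Qed.

Lemma le_intoo a b f g : intgoo a b f -> intgoo a b g ->
  (forall x, a < x < b -> f x <= g x) -> intoo a b f <= intoo a b g.
Proof.
by move=> If Ig fg; apply: le_Rintegral => // x /=; rewrite in_itv/= => /fg.
Qed.

Lemma le_normr_intoo a b f : intgoo a b f ->
  `|intoo a b f| <= intoo a b (fun x => `|f x|).
Proof. by move=> If; apply: le_normr_Rintegral. Qed.

Lemma intgoo_norm a b f : intgoo a b f -> intgoo a b (fun x => `|f x|).
Proof. by move=> If; apply: integrable_norm. Qed.

Lemma intoo_cst a b k : a <= b -> intoo a b (fun=> k) = k * (b - a).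
Proof.
move=> ab; rewrite /intoo Rintegral_cst//=; congr (_ * _).
rewrite lebesgue_measure_oo.
by case: ltgtP ab => //= -> _; rewrite subrr.
Qed.

Lemma intgoo_cst a b k : intgoo a b (fun=> k).
Proof.
apply/integrableP; split; first exact/measurable_EFinP.
rewrite (eq_integral (cst (`|k|)%:E))// integral_cst//.
rewrite [X in (_ * X)%E]lebesgue_measure_oo.
by case: ifP => _; rewrite ?mule0// -EFinM ltry.
Qed.

Lemma intoo_itvxx a f : intoo a a f = 0.
Proof. by rewrite /intoo set_itvoo0 ?Rintegral_set0. Qed.

Lemma intoo_split a b c f : a <= c -> c <= b -> intgoo a b f ->
  intoo a b f = intoo a c f + intoo c b f.
Proof.
move=> ac cb If; move: ac cb; rewrite le_eqVlt => /predU1P[<-|ac].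
  by rewrite intoo_itvxx add0r.
rewrite le_eqVlt => /predU1P[->|cb]; first by rewrite intoo_itvxx addr0.
have := @Rintegral_itvB _ f (BRight a) (BLeft b) c If.
rewrite !bnd_simp => /(_ (ltW ac)) /(_ cb) /eqP.
rewrite subr_eq /intoo => /eqP ->; rewrite addrC; congr (_ + _).
by rewrite -Rintegral_itv_bndo_bndc//; apply: intgooS If => //; exact: ltW.
Qed.

Lemma ccontS a b c d f : a <= c -> d <= b -> ccont a b f -> ccont c d f.
Proof.
move=> ac db; apply: continuous_subspaceW.
by apply: subset_itv; rewrite bnd_simp.
Qed.

Lemma continuous_ccont a b f : continuous f -> ccont a b f.
Proof. exact: continuous_subspaceT. Qed.

Lemma ccontD a b f g : ccont a b f -> ccont a b g ->
  ccont a b (fun x => f x + g x).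
Proof. by move=> cf cg x; apply: cvgD; [exact: cf|exact: cg]. Qed.

Lemma ccontN a b f : ccont a b f -> ccont a b (fun x => - f x).
Proof. by move=> cf x; apply: cvgN; exact: cf. Qed.

Lemma ccontB a b f g : ccont a b f -> ccont a b g ->
  ccont a b (fun x => f x - g x).
Proof. by move=> cf cg; apply: ccontD => //; exact: ccontN. Qed.

Lemma ccontM a b f g : ccont a b f -> ccont a b g ->
  ccont a b (fun x => f x * g x).
Proof. by move=> cf cg x; apply: cvgM; [exact: cf|exact: cg]. Qed.

Lemma ccont_cst a b k : ccont a b (fun=> k).
Proof. by move=> x; exact: cvg_cst. Qed.

Lemma eq_ccont a b f g : (forall x, a <= x <= b -> f x = g x) ->
  ccont a b f -> ccont a b g.
Proof.
move=> fg; apply: subspace_eq_continuous => x; rewrite inE/= in_itv/=.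
exact: fg.
Qed.

Lemma ccont_poly a b (p : {poly R}) : ccont a b (fun x => p.[x]).
Proof. exact/continuous_ccont/continuous_horner. Qed.

Lemma intgoo_ccont a b f : ccont a b f -> intgoo a b f.
Proof.
move=> cf; have := continuous_compact_integrable (@segment_compact R a b) cf.
by apply: integrableS => //; apply: subset_itv; rewrite bnd_simp.
Qed.

Lemma ccont_bounded a b f : a <= b -> ccont a b f ->
  exists2 M, 0 <= M & forall x, a <= x <= b -> `|f x| <= M.
Proof.
move=> ab cf.
have cnf : ccont a b (fun x => `|f x|).
  by move=> x; apply: cvg_norm; exact: cf.
have [c cab H] := EVT_max ab cnf; exists (`|f c|) => // x xab; exact: H.
Qed.

Lemma intgooMr a b f g : a <= b -> intgoo a b f -> ccont a b g ->
  intgoo a b (fun x => f x * g x).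
Proof.
move=> ab If cg; apply: (@eq_intgoo _ _ (fun x => g x * f x)).
  by move=> x _; rewrite mulrC.
have [M M0 HM] := ccont_bounded ab cg.
rewrite /intgoo (_ : EFin \o _ = (EFin \o g) \* (EFin \o f))%E; last exact/funext.
apply: integrableMr => //.
  by apply: intgoo_meas; exact: intgoo_ccont.
exists M; split; first exact: num_real.
move=> N MN x /=; rewrite in_itv/= => /andP[ax xb].
by rewrite (le_trans _ (ltW MN))// HM// !ltW.
Qed.

Lemma L2oo_meas a b f : L2oo a b f -> measurable_fun (`]a, b[ : set R) f.
Proof. by case. Qed.

Lemma L2ooS a b c d f : a <= c -> d <= b -> L2oo a b f -> L2oo c d f.
Proof.
move=> ac db [mf If]; split; last exact: intgooS If.
apply: measurable_funS mf => //.
by apply: subset_itv; rewrite bnd_simp.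
Qed.

Lemma eq_L2oo a b f g : (forall x, a < x < b -> f x = g x) ->
  L2oo a b f -> L2oo a b g.
Proof.
move=> fg [mf If]; split; last first.
  by apply: eq_intgoo If => x /fg ->.
apply: eq_measurable_fun mf => x; rewrite inE/= in_itv/= => /fg.
by [].
Qed.

Lemma L2oo_ccont a b f : ccont a b f -> L2oo a b f.
Proof.
move=> cf; split; first by apply: intgoo_meas; exact: intgoo_ccont.
by apply: intgoo_ccont; exact: (@ccontM a b f f).
Qed.

Lemma L2ooM a b f g : L2oo a b f -> L2oo a b g -> intgoo a b (fun x => f x * g x).
Proof.
move=> [mf If] [mg Ig].
have := intgooD If Ig.
apply: le_integrable => //.
  apply/measurable_EFinP; exact: measurable_funM.
move=> x _ /=; rewrite lee_fin normrM.
rewrite [leRHS]ger0_norm; last by rewrite addr_ge0// sqr_ge0.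
rewrite -(real_normK (num_real (f x))) -(real_normK (num_real (g x))).
have := sqr_ge0 (`|f x| - `|g x|); have := normr_ge0 (f x).
have := normr_ge0 (g x); nra.
Qed.

Lemma L2ooZ a b k f : L2oo a b f -> L2oo a b (fun x => k * f x).
Proof.
move=> [mf If]; split; first by apply: measurable_funM.
by apply: eq_intgoo (intgooZ (k ^+ 2) If) => x _; rewrite exprMn.
Qed.

Lemma L2ooD a b f g : L2oo a b f -> L2oo a b g -> L2oo a b (fun x => f x + g x).
Proof.
move=> Lf Lg; split.
  by apply: measurable_funD; [case: Lf|case: Lg].
have := intgooD (intgooD Lf.2 Lg.2)
  (intgooZ 2 (L2ooM Lf Lg)).
by apply: eq_intgoo => x _; ring.
Qed.

Lemma L2ooN a b f : L2oo a b f -> L2oo a b (fun x => - f x).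
Proof.
by move=> /(L2ooZ (-1)); apply: eq_L2oo => x _; rewrite mulN1r.
Qed.

Lemma L2ooB a b f g : L2oo a b f -> L2oo a b g -> L2oo a b (fun x => f x - g x).
Proof. by move=> Lf Lg; apply: L2ooD => //; exact: L2ooN. Qed.

Lemma L2oo_intgoo a b f : L2oo a b f -> intgoo a b f.
Proof.
move=> Lf.
have L1 : L2oo a b (fun=> 1) by exact/L2oo_ccont/ccont_cst.
by apply: eq_intgoo (L2ooM Lf L1) => x _; rewrite mulr1.
Qed.

Lemma intoo_sqr_ge0 a b f : 0 <= intoo a b (fun x => f x ^+ 2).
Proof. by apply: intoo_ge0 => x _; exact: sqr_ge0. Qed.

Lemma cauchy_schwarz_oo a b f g : L2oo a b f -> L2oo a b g ->
  intoo a b (fun x => f x * g x) ^+ 2 <=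
  intoo a b (fun x => f x ^+ 2) * intoo a b (fun x => g x ^+ 2).
Proof.
move=> Lf Lg.
set A := intoo _ _ (fun x => f x ^+ 2); set B := intoo _ _ (fun x => g x ^+ 2).
set C := intoo _ _ _.
(* The integral of (s f + t g)^2 as a quadratic form. The pair (B, -C) gives B (A B - C^2) >= 0;
   when B = 0, the pairs (-C, A) and (1, -C) force C = 0. *)
have key s t : 0 <= s ^+ 2 * A + 2 * s * t * C + t ^+ 2 * B.
  have := intoo_sqr_ge0 a b (fun x => s * f x + t * g x).
  rewrite (@eq_intoo _ _ _ (fun x => (s ^+ 2 * (f x ^+ 2) +
    2 * s * t * (f x * g x)) + t ^+ 2 * g x ^+ 2)); last by move=> x _; ring.
  have [Iff Igg Ifg] := And3 Lf.2 Lg.2 (L2ooM Lf Lg).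
  rewrite !intooD ?intooZ//; do ?[exact: intgooZ].
  by apply: intgooD; exact: intgooZ.
have A0 : 0 <= A by exact: intoo_sqr_ge0.
have B0 : 0 <= B by exact: intoo_sqr_ge0.
have := key B (- C); have := key 1 (- C); have := key (- C) A.
have [Bz|Bn0] := eqVneq B 0; last first.
  have {}B0 : 0 < B by rewrite lt0r Bn0.
  by move=> _ _ H; rewrite -subr_ge0 -(pmulr_rge0 _ B0); nra.
move=> _ _ _.
have [Az|An0] := eqVneq A 0; last first.
  have {}A0 : 0 < A by rewrite lt0r An0.
  rewrite Bz mulr0 -(pmulr_lle0 _ A0).
  by have := key (- C) A; rewrite Bz; nra.
by have := key 1 (- C); rewrite Az Bz; nra.
Qed.

Lemma intoo_sum a b (I : Type) (s : seq I) (P : pred I) (F : I -> R -> R) :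
  (forall i, intgoo a b (F i)) ->
  intgoo a b (fun x => \sum_(i <- s | P i) F i x) /\
  intoo a b (fun x => \sum_(i <- s | P i) F i x) =
  \sum_(i <- s | P i) intoo a b (F i).
Proof.
move=> IF; elim: s => [|i s [IH1 IH2]].
  split; first by apply: eq_intgoo (intgoo_cst a b 0) => x _; rewrite big_nil.
  rewrite big_nil -[RHS](intoo0 a b); apply: eq_intoo => x _.
  by rewrite big_nil.
rewrite big_cons; case: ifPn => Pi; last first.
  split; first by apply: eq_intgoo IH1 => x _; rewrite big_cons (negbTE Pi).
  by rewrite -IH2; apply: eq_intoo => x _; rewrite big_cons (negbTE Pi).
split.
  by apply: eq_intgoo (intgooD (IF i) IH1) => x _; rewrite big_cons Pi.
rewrite -IH2 -intooD//; apply: eq_intoo => x _.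
by rewrite big_cons Pi.
Qed.

Lemma intoo_FTC a b F f : a <= b -> ccont a b f -> ccont a b F ->
  (forall x, a < x < b -> is_derive x 1 F (f x)) ->
  intoo a b f = F b - F a.
Proof.
rewrite le_eqVlt => /predU1P[<- _ _ _|ab cf cF dF].
  by rewrite intoo_itvxx subrr.
have [_ Fa Fb] := (continuous_within_itvP F ab).1 cF.
have H := @continuous_FTC2 R f F a b ab cf.
have {H} := H _ _; move=> H; rewrite -/(intoo a b f).
have {}H : (\int[mu]_(x in `[a, b]) (f x)%:E = (F b)%:E - (F a)%:E)%E.
  apply: H.
- split => // x; rewrite in_itv/= => /dF H; exact: ex_derive.
- by move=> x; rewrite in_itv/= => /dF H; rewrite derive1E; exact: derive_val.
have If := intgoo_ccont cf.
rewrite /intoo Rintegral_itv_obnd_cbnd// Rintegral_itv_bndo_bndc ?/Rintegral ?H//.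
have := continuous_compact_integrable (@segment_compact R a b) cf.
by apply: integrableS => //; apply: subset_itv; rewrite bnd_simp.
Qed.

Lemma primS a b c d G g : a <= c -> d <= b -> prim a b G g -> prim c d G g.
Proof.
move=> ac db [Ig H]; split; first exact: intgooS Ig.
by move=> x y cx xy yd; apply: H => //; [exact: le_trans cx|exact: le_trans db].
Qed.

Lemma eq_prim a b G G' g g' : (forall x, a <= x <= b -> G x = G' x) ->
  (forall x, a < x < b -> g x = g' x) -> prim a b G g -> prim a b G' g'.
Proof.
move=> GG gg [Ig H]; split; first exact: eq_intgoo Ig.
move=> x y ax xy yb; rewrite -!GG ?ax ?yb ?(le_trans xy)// ?(le_trans ax)//.
rewrite H//; apply: eq_intoo => z /andP[xz zy]; apply: gg.
by rewrite (le_lt_trans ax)//= (lt_le_trans zy).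
Qed.

Lemma primD a b G g G' g' : prim a b G g -> prim a b G' g' ->
  prim a b (fun x => G x + G' x) (fun x => g x + g' x).
Proof.
move=> [Ig H] [Ig' H']; split; first exact: intgooD.
move=> x y ax xy yb; rewrite intooD; [|exact: intgooS Ig|exact: intgooS Ig'].
by rewrite -H// -H'//; ring.
Qed.

Lemma primZ a b k G g : prim a b G g ->
  prim a b (fun x => k * G x) (fun x => k * g x).
Proof.
move=> [Ig H]; split; first exact: intgooZ.
by move=> x y ax xy yb; rewrite intooZ; [rewrite -H//; ring|exact: intgooS Ig].
Qed.

Lemma primB a b G g G' g' : prim a b G g -> prim a b G' g' ->
  prim a b (fun x => G x - G' x) (fun x => g x - g' x).
Proof.
move=> H /(primZ (-1)) /(primD H).
by apply: eq_prim => x _; rewrite mulN1r.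
Qed.

Lemma prim_poly a b (p : {poly R}) :
  prim a b (fun x => p.[x]) (fun x => p^`().[x]).
Proof.
split; first exact/intgoo_ccont/ccont_poly.
move=> x y ax xy yb; apply/esym/intoo_FTC => //; try exact: ccont_poly.
Qed.

Lemma prim_intoo a b g : intgoo a b g -> prim a b (fun x => intoo a x g) g.
Proof.
move=> Ig; split => // x y ax xy yb.
by rewrite (@intoo_split a y x)//; [ring|exact: intgooS Ig].
Qed.

Lemma prim_ccont a b G g : prim a b G g -> ccont a b G.
Proof.
move=> [Ig H]; have [ab|ba] := ltP a b; last first.
  move: ba; rewrite le_eqVlt => /predU1P[->|ba].
    by rewrite /ccont set_itv1; exact: continuous_subspace1.
  by rewrite /ccont set_itv_ge; [exact: continuous_subspace0|
    rewrite bnd_simp -ltNge].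
have Ig' : mu.-integrable `[a, b] (EFin \o g).
  have /integrableP[/measurable_EFinP mg foo] := Ig.
  apply/integrableP; split.
    apply/measurable_EFinP.
    exact/measurable_fun_itv_obnd_cbndP/measurable_fun_itv_bndo_bndcP.
  rewrite integral_itv_bndoo//; apply: measurableT_comp => //.
  exact/measurable_EFinP.
have := @parameterized_integral_continuous R a b g (ltW ab) Ig'.
move=> /(@ccontD _ _ _ _ (@ccont_cst a b (G a))).
apply: eq_ccont => x /andP[ax xb].
have Iax : intgoo a x g by exact: intgooS Ig.
rewrite -[G x](subrK (G a)) H// addrC; congr (_ + _).
rewrite /parameterized_integral /intoo.
move: ax Iax; rewrite le_eqVlt => /predU1P[<- _|ax Iax].
  by rewrite set_itv1 Rintegral_set1 set_itvoo0 Rintegral_set0.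
rewrite Rintegral_itv_obnd_cbnd// Rintegral_itv_bndo_bndc//.
by apply: integrableS Ig' => //; apply: subset_itv; rewrite bnd_simp.
Qed.

Lemma has_derivative_onP (D : set R) v v' x : has_derivative_on D v v' -> D x ->
  forall e, 0 < e -> exists2 d, 0 < d &
    forall y, D y -> y != x -> `|y - x| < d ->
      `|v' x - (v y - v x) / (y - x)| < e.
Proof.
move=> /(_ x) H /H/cvgrPdist_lt + e e0 => /(_ e e0).
rewrite /within /= /within /= => -[d /= d0 Hd]; exists d => // y Dy yx yd.
by apply: Hd => //=; rewrite distrC.
Qed.

Lemma has_derivative_on_ccont a b v v' : has_derivative_on `[a, b] v v' ->
  ccont a b v.
Proof.
move=> dv; apply/subspace_continuousP => x xab.
apply/cvgrPdist_lt => e e0.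
have [d d0 Hd] := has_derivative_onP dv xab ltr01.
have M0 : 0 < `|v' x| + 1 by rewrite ltr_wpDl.
exists (Num.min d (e / (`|v' x| + 1))) => /=.
  by rewrite lt_min d0 divr_gt0.
move=> y /=; rewrite lt_min => /andP[]; rewrite distrC => yd ye yab.
have [->|yx] := eqVneq y x; first by rewrite subrr normr0.
have yx0 : 0 < `|y - x| by rewrite normr_gt0 subr_eq0.
have {}Hd := Hd y yab yx yd.
have : `|(v y - v x) / (y - x)| < `|v' x| + 1.
  rewrite -[X in `|X|](subrK (v' x)) addrC (le_lt_trans (ler_normD _ _))//.
  by rewrite ltrD2l distrC.
rewrite normrM normfV ltr_pdivrMr// distrC => /lt_trans; apply.
by rewrite mulrC -ltr_pdivlMr// distrC.
Qed.

Lemma has_derivative_on_is_derive a b v v' x : has_derivative_on `[a, b] v v' ->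
  a < x < b -> is_derive x 1 v (v' x).
Proof.
move=> dv /andP[ax xb].
have xab : `[a, b]%classic x by rewrite /= in_itv/= !ltW.
have H : h^-1 *: (v (h *: 1 + x) - v x) @[h --> 0^'] --> v' x.
  apply/cvgrPdist_lt => e e0; have [d d0 Hd] := has_derivative_onP dv xab e0.
  exists (Num.min d (Num.min (x - a) (b - x))) => /=.
    by rewrite !lt_min d0 !subr_gt0 ax.
  move=> h /=; rewrite sub0r normrN !lt_min => /and3P[hd ha hb] h0.
  have := Hd (h + x); rewrite addrK /= in_itv/= => /(_ _ _ hd).
  rewrite [h *: _]mulr1 [_ *: _]mulrC; apply.
  - by move: ha hb; rewrite !ltr_norml => /andP[? _] /andP[_ ?]; lra.
  - by rewrite -subr_eq0 addrK.
by apply: DeriveDef; [exact: cvgP H|exact: cvg_lim H].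
Qed.

Lemma has_derivative_on_prim a b v v' : has_derivative_on `[a, b] v v' ->
  ccont a b v' -> prim a b v v'.
Proof.
move=> dv cv'; split; first exact: intgoo_ccont.
move=> x y ax xy yb; apply/esym/intoo_FTC => //.
- exact: ccontS cv'.
- exact: ccontS (has_derivative_on_ccont dv).
- move=> z /andP[xz zy]; apply: (has_derivative_on_is_derive dv).
  by rewrite (le_lt_trans ax)//= (lt_le_trans zy).
Qed.

End Toolkit.

(** * Test functions and the du Bois-Reymond lemma *)

(* x |-> q(1/x) exp(-e/x) extended by 0 to x <= 0; differentiation maps this
   family to itself. *)
Definition expflat (R : realType) (e : R) (q : {poly R}) (x : R) : R :=
  if 0 < x then q.[x^-1] * expR (- (e * x^-1)) else 0.

(** The polynomials p and q vary freely so that the span is stable under differentiation; smoothness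
    of every order then follows from first-order differentiability of the generators. *)
Inductive bump_span (R : realType) : (R -> R) -> Prop :=
| bump_span1 e c d p q : 0 < e ->
    bump_span (fun x => expflat e p (x - c) * expflat e q (d - x))
| bump_spanD f g : bump_span f -> bump_span g -> bump_span (fun x => f x + g x)
| bump_spanZ k f : bump_span f -> bump_span (fun x => k * f x).

(* Tends to the indicator of ]c, d[ as e -> 0. *)
Definition bump (R : realType) (e c d x : R) : R :=
  expflat e 1 (x - c) * expflat e 1 (d - x).

Definition aeoo (R : realType) (a b : R) (f g : R -> R) : Prop :=
  {ae @lebesgue_measure R, forall x, a < x < b -> f x = g x}.

Section Bumps.
Context {R : realType}.
Implicit Types (a b c d e x y : R) (f g h : R -> R) (p q : {poly R}).
Local Notation mu := (@lebesgue_measure R).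

(** Induction on p for all e at once: one more factor y costs half of the exponent, because y exp(-e
    y / 2) <= 2 / e. *)
Lemma horner_expR_bounded p : forall e, 0 < e ->
  exists2 C, 0 <= C & forall y, 0 < y -> `|p.[y]| * expR (- (e * y)) <= C.
Proof.
elim/poly_ind: p => [|p k IH] e e0.
  by exists 0 => // y y0; rewrite horner0 normr0 mul0r.
have e20 : 0 < e / 2 by rewrite divr_gt0.
have [C C0 HC] := IH _ e20.
exists (C * (e / 2)^-1 + `|k|).
  by rewrite addr_ge0// mulr_ge0// invr_ge0 ltW.
move=> y y0; rewrite !hornerE.
have E1 : expR (- (e * y)) <= 1.
  by rewrite expR_le1 oppr_le0 mulr_ge0// ltW.
have E2 : y * expR (- (e / 2 * y)) <= (e / 2)^-1.
  rewrite expRN ler_pdivrMr ?expR_gt0// mulrC ler_pdivlMr// mulrC.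
  by apply: le_trans (expR_ge1Dx _); rewrite lerDr.
apply: le_trans (_ : (`|p.[y]| * y + `|k|) * expR (- (e * y)) <= _).
  rewrite ler_pM2r ?expR_gt0// (le_trans (ler_normD _ _))// normrM.
  by rewrite (gtr0_norm y0).
rewrite mulrDl lerD//; last by rewrite ler_piMr.
have -> : - (e * y) = - (e / 2 * y) + - (e / 2 * y) by field.
rewrite expRD mulrACA ler_pM ?HC// mulr_ge0 ?expR_ge0// ltW//.
Qed.

Lemma expflat_le0 e q x : x <= 0 -> expflat e q x = 0.
Proof. by move=> x0; rewrite /expflat ltNge x0. Qed.

Lemma is_derive_expflat e q x : 0 < e ->
  is_derive x 1 (expflat e q) (expflat e ('X^2 * (e *: q - q^`())) x).
Proof.
move=> e0; have [x0|x0|->] := ltgtP x 0.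
- rewrite [X in is_derive _ _ _ X]expflat_le0 ?(ltW x0)//.
  apply: (@near_eq_is_derive _ _ _ (cst 0)) => //.
  near=> y; rewrite expflat_le0//; apply: ltW.
  by near: y; exact: lt_nbhsl.
- apply: (@near_eq_is_derive _ _ _
    (fun y => q.[y^-1] * expR (- (e * y^-1)))) => //.
    near=> y; rewrite /expflat ifT//.
    by near: y; exact: lt_nbhsr.
  have xn0 : x != 0 by rewrite gt_eqF.
  have dV : is_derive x 1 (fun y : R => y^-1) (- x ^- 2 *: 1).
    exact: is_deriveV.
  have dq : is_derive x 1 (fun y => q.[y^-1]) (q^`().[x^-1] * (- x ^- 2 *: 1)).
    exact: (@is_derive1_comp _ (horner q) (fun y : R => y^-1)).
  have de : is_derive x 1 (fun y => - (e * y^-1)) (- (e *: (- x ^- 2 *: 1))).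
    by apply: is_deriveN; exact: is_deriveZ.
  have dE : is_derive x 1 (fun y => expR (- (e * y^-1)))
      (expR (- (e * x^-1)) * (- (e *: (- x ^- 2 *: 1)))).
    exact: (@is_derive1_comp _ expR (fun y => - (e * y^-1))).
  apply: is_derive_eq; rewrite /expflat x0 !hornerE /GRing.scale/=.
  by field.
- rewrite [X in is_derive _ _ _ X]expflat_le0//.
  (* For X^2 q the bound reads h^-2 |q(1/h)| exp(-e/h) <= C for h > 0, so the difference quotient at
     0 is at most C h in absolute value. *)
  have [C C0 HC] := horner_expR_bounded ('X^2 * q) e0.
  have H : h^-1 *: (expflat e q (h *: 1 + 0) - expflat e q 0) @[h --> 0^'] --> (0:R).
    apply/cvgrPdist_lt => r r0; exists (r / (C + 1)) => /=.
      by rewrite divr_gt0// ltr_wpDl.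
    move=> h /=; rewrite sub0r normrN => hr h0.
    rewrite sub0r normrN [h *: _]mulr1 addr0 (expflat_le0 e q (lexx 0)) subr0.
    rewrite /expflat; case: (ltP 0 h) => h0'; last by rewrite scaler0 normr0.
    have := HC h^-1; rewrite invr_gt0 => /(_ h0') {}HC.
    move: hr; rewrite gtr0_norm// ltr_pdivlMr ?ltr_wpDl// => /(le_lt_trans _); apply.
    rewrite /GRing.scale/= normrM normrM [X in _ * (_ * X)]gtr0_norm ?expR_gt0//.
    rewrite gtr0_norm ?invr_gt0// -(ler_pM2l (_ : 0 < h^-1)) ?invr_gt0//.
    rewrite [leRHS]mulrA mulVf ?gt_eqF// mul1r (@le_trans _ _ C)// ?lerDl//.
    apply: le_trans HC; rewrite hornerM hornerXn normrM normrX.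
    by rewrite (gtr0_norm (_ : 0 < h^-1)) ?invr_gt0// expr2 !mulrA.
  by apply: DeriveDef; [exact: cvgP H|exact: cvg_lim H].
Unshelve. all: by end_near. Qed.

Lemma bump_span_derive f : bump_span f ->
  (forall x, derivable f x 1) /\ bump_span (derive1 f).
Proof.
elim=> [e c d p q e0|{}f g _ [df sf] _ [dg sg]|k {}f _ [df sf]].
- pose D r := 'X^2 * (e *: r - r^`()).
  have H x : is_derive x 1 (fun x => expflat e p (x - c) * expflat e q (d - x))
     (expflat e (D p) (x - c) * expflat e q (d - x) +
     (-1) * (expflat e p (x - c) * expflat e (D q) (d - x))).
    have d1 : is_derive x 1 (fun x => expflat e p (x - c)) (expflat e (D p) (x - c) * (1 - 0)).
      apply: (@is_derive1_comp _ (expflat e p) (fun x => x - c)).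
      exact: is_derive_expflat.
    have d2 : is_derive x 1 (fun x => expflat e q (d - x)) (expflat e (D q) (d - x) * (0 - 1)).
      apply: (@is_derive1_comp _ (expflat e q) (fun x => d - x)).
      exact: is_derive_expflat.
    apply: is_derive_eq; rewrite /GRing.scale/=; ring.
  split=> [x|]; first exact: ex_derive.
  rewrite (_ : derive1 _ = fun x =>
     (expflat e (D p) (x - c) * expflat e q (d - x) +
     (-1) * (expflat e p (x - c) * expflat e (D q) (d - x)))).
    by apply: bump_spanD; [exact: bump_span1|apply: bump_spanZ; exact: bump_span1].
  by apply/funext => x; rewrite derive1E derive_val.
- split=> [x|]; first exact: derivableD.
  rewrite (_ : derive1 _ = fun x => derive1 f x + derive1 g x).
    exact: bump_spanD.
  by apply/funext => x; rewrite !derive1E deriveD.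
- split=> [x|]; first exact: derivableZ.
  rewrite (_ : derive1 _ = fun x => k * derive1 f x); first exact: bump_spanZ.
  by apply/funext => x; rewrite !derive1E deriveZ.
Qed.

Lemma bump_span_derive1n f j : bump_span f -> bump_span (derive1n j f).
Proof. by move=> sf; elim: j => // j /bump_span_derive[_]. Qed.

Lemma bump_span_smooth f : bump_span f ->
  forall j x, derivable (derive1n j f) x 1.
Proof. by move=> sf j x; have [] := bump_span_derive (bump_span_derive1n j sf). Qed.

Lemma bump_span_bump e c d : 0 < e -> bump_span (bump e c d).
Proof. exact: bump_span1. Qed.

Lemma bump_outside e c d x : ~~ (c < x < d) -> bump e c d x = 0.
Proof.
rewrite negb_and -!leNgt /bump => /orP[|] H.
  by rewrite expflat_le0 ?mul0r// subr_le0.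
by rewrite [X in _ * X]expflat_le0 ?mulr0// subr_le0.
Qed.

Lemma bump_inside e c d x : c < x < d ->
  bump e c d x = expR (- (e * ((x - c)^-1 + (d - x)^-1))).
Proof.
move=> /andP[cx xd]; rewrite /bump /expflat !subr_gt0 cx xd.
rewrite -polyC1 !hornerC !mul1r -expRD.
by congr expR; ring.
Qed.

Lemma bump_ge0 e c d x : 0 <= bump e c d x.
Proof.
by case: (boolP (c < x < d)) => [/bump_inside|/bump_outside] ->//; exact: expR_ge0.
Qed.

Lemma bump_le1 e c d x : 0 < e -> bump e c d x <= 1.
Proof.
move=> e0; case: (boolP (c < x < d)) => [H|/bump_outside ->//].
rewrite bump_inside// expR_le1 oppr_le0 mulr_ge0 ?ltW//.
by case/andP: H => cx xd; rewrite addr_gt0// invr_gt0 subr_gt0.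
Qed.

Lemma supported_test a b c d f : a < c -> d < b ->
  (forall j x, derivable (derive1n j f) x 1) ->
  (forall x, ~~ (c <= x <= d) -> f x = 0) -> test_function a b f.
Proof.
move=> ac db sf f0.
have sub : closure [set x | f x != 0] `<=` `[c, d].
  rewrite [X in _ `<=` X](closure_id _).1; last exact: itv_closed.
  apply: closure_subset => x /=; rewrite in_itv/=; apply: contraNT => /f0 ->.
  by rewrite eqxx.
split=> //.
- exact: (subclosed_compact (@closed_closure R^o _) (@segment_compact R c d) sub).
- by apply: (subset_trans sub); apply: subset_itv; rewrite bnd_simp.
Qed.

Lemma bump_test a b c d e : 0 < e -> a < c -> d < b ->
  test_function a b (bump e c d).
Proof.
move=> e0 ac db; apply: (supported_test ac db).
  exact/bump_span_smooth/bump_span_bump.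
move=> x H; apply: bump_outside; apply: contra H => /andP[cx xd].
by rewrite !ltW.
Qed.

Lemma cvg_bump c d x : c < x < d ->
  bump (n.+1%:R^-1 : R) c d x @[n --> \oo] --> (1 : R).
Proof.
move=> H; pose K := (x - c)^-1 + (d - x)^-1.
have -> : (fun n : nat => bump (n.+1%:R^-1 : R) c d x) =
  (fun n => expR (- (n.+1%:R^-1 * K))).
  by apply/funext => n; rewrite bump_inside.
rewrite -[X in _ --> X]expR0; apply: continuous_cvg; first exact: continuous_expR.
rewrite -[X in _ --> X]oppr0 -(mul0r K); apply: cvgN; apply: cvgMl.
exact: cvg_harmonic.
Qed.

Lemma mem_oo a b x : (x \in (`]a, b[%classic : set R)) = (a < x < b).
Proof. by rewrite mem_setE in_itv. Qed.

Lemma intoo_support a b c d f : a <= c -> d <= b ->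
  (forall x, ~~ (c < x < d) -> f x = 0) -> intoo a b f = intoo c d f.
Proof.
move=> ac db f0; rewrite /intoo [LHS]Rintegral_mkcond [RHS]Rintegral_mkcond.
apply: eq_Rintegral => x _; rewrite !patchE.
rewrite [x \in _]mem_oo [X in _ = if X then _ else _]mem_oo.
case: (boolP (c < x < d)) => [|/f0 -> //]; last by case: ifP.
by move=> /andP[cx xd]; rewrite (le_lt_trans ac)//= (lt_le_trans xd).
Qed.

Lemma cvg_intoo_bump c d g : intgoo c d g ->
  intoo c d (fun x => g x * bump (n.+1%:R^-1) c d x) @[n --> \oo] --> intoo c d g.
Proof.
move=> Ig.
have mg := intgoo_meas Ig.
have mb e : 0 < e -> measurable_fun `]c, d[%classic (bump e c d).
  move=> e0; apply: measurable_funTS; apply: continuous_measurable_fun => x.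
  apply: differentiable_continuous; apply/derivable1_diffP.
  by have [H _] := bump_span_derive (bump_span_bump c d e0).
pose f_ n x := (g x * bump (n.+1%:R^-1) c d x)%:E.
have [] := @dominated_convergence _ _ R mu `]c, d[%classic (moo c d) f_ (EFin \o g)
  (fun x => `|g x|%:E).
- by move=> n; apply/measurable_EFinP; apply: measurable_funM => //; exact: mb.
- exact/measurable_EFinP.
- apply: aeW => x /=; rewrite in_itv/= => H; apply: cvg_EFin; first exact: nearW.
  rewrite -[X in _ --> X]mulr1; apply: cvgMr; exact: cvg_bump.
- exact: intgoo_norm.
- apply: aeW => x n _ /=; rewrite lee_fin normrM ler_piMr//.
  by rewrite ger0_norm ?bump_ge0// bump_le1.
move=> _ _ H.
have Hfin : (\int[mu]_(x in `]c, d[) (g x)%:E)%E \is a fin_num.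
  exact: integrable_fin_num.
by apply: fine_cvg; rewrite fineK.
Qed.

Lemma intoo_bump0 c d g : intgoo c d g ->
  (forall e, 0 < e -> intoo c d (fun x => g x * bump e c d x) = 0) ->
  intoo c d g = 0.
Proof.
move=> Ig H; have /cvg_lim <- // := cvg_intoo_bump Ig.
rewrite (_ : (fun n => _) = fun=> 0); first by rewrite lim_cst.
by apply/funext => n; rewrite H.
Qed.

(** Lebesgue differentiation: the primitive of g extended by 0 is identically 0, and its derivative
    is almost everywhere that extension. *)
Lemma ae_zero_closed c d g : c < d -> intgoo c d g ->
  (forall x, c <= x <= d -> intoo c x g = 0) -> aeoo c d g (fun=> 0).
Proof.
move=> cd Ig H; pose f := g \_ `]c, d[.
have If : mu.-integrable setT (EFin \o f).
  by rewrite -restrict_EFin; apply/integrable_restrict => //; rewrite setTI.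
have F0 x : \int[mu]_(t in `]-oo, x]) f t = 0.
  rewrite /f -Rintegral_mkcondr.
  have [xc|cx] := leP x c.
    rewrite (_ : _ `&` _ = set0) ?Rintegral_set0//.
    apply/seteqP; split => // t /=; rewrite !in_itv/= => -[tx /andP[ct _]].
    by move: (lt_le_trans ct (le_trans tx xc)); rewrite ltxx.
  have [xd|dx] := ltP x d.
    rewrite (_ : _ `&` _ = `]c, x]%classic).
      have := H x; rewrite (ltW cx) (ltW xd) => /(_ isT) <-.
      by rewrite /intoo Rintegral_itv_bndo_bndc//; apply: intgooS Ig => //; exact: ltW.
    apply/seteqP; split => t /=; rewrite !in_itv/=.
      by move=> [-> /andP[->]].
    by move=> /andP[-> tx]; rewrite tx (le_lt_trans tx).
  rewrite (_ : _ `&` _ = `]c, d[%classic).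
    by have := H d; rewrite lexx (ltW cd) => /(_ isT).
  apply/seteqP; split => t /=; rewrite !in_itv/=; first by case.
  by move=> /andP[-> td]; rewrite td (le_trans (ltW td)).
have H1 y : mu.-integrable `]-oo, y] (EFin \o f) by exact: integrableS If.
have := FTC1Ny H1 (open_integrable_locally openT If).
apply: filterS; first exact: (ae_filter_ringOfSetsType mu).
move=> x [_]; rewrite (_ : (fun x => _) = cst 0); last exact/funext.
by rewrite derive1_cst /f patchE => + xcd; rewrite ifT// inE/= in_itv.
Qed.

Lemma locally_integrable_intgoo a b c d g :
  locally_integrable (`]a, b[ : set R) g -> a < c -> d < b -> intgoo c d g.
Proof.
move=> [mg _ goo] ac db.
have sub : `[c, d] `<=` `]a, b[ by apply: subset_itv; rewrite bnd_simp.
have : mu.-integrable `[c, d] (EFin \o g).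
  apply/integrableP; split.
    by apply/measurable_EFinP; apply: measurable_funS sub mg.
  exact: (goo _ sub (@segment_compact R c d)).
by apply: integrableS => //; apply: subset_itv; rewrite bnd_simp.
Qed.

(** As e tends to 0 the bumps tend to indicators, so g has integral 0 over every inner interval and
    vanishes almost everywhere there. The hypotheses stay away from a and b because g may be only
    locally integrable. *)
Lemma bump_ortho_ae a b g :
  (forall c d, a < c -> d < b -> intgoo c d g) ->
  (forall e c d, 0 < e -> a < c -> c <= d -> d < b ->
    intoo a b (fun x => g x * bump e c d x) = 0) ->
  aeoo a b g (fun=> 0).
Proof.
move=> Ig H.
have H0 c d : a < c -> c <= d -> d < b -> intoo c d g = 0.
  move=> ac cd db; apply: intoo_bump0; first exact: Ig.
  move=> e e0; rewrite -(H e c d)//; apply/esym/intoo_support; try exact: ltW.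
  by move=> x Hx; rewrite bump_outside ?mulr0.
have [ab|ba] := ltP a b; last first.
  apply: aeW => x /andP[ax xb]; move: (lt_trans ax xb).
  by rewrite ltNge ba.
(* Countably many inner intervals exhaust ]a, b[, so one null set serves for all of them. The
   denominator n + 3 keeps twice the margin below b - a, hence every inner interval is nonempty. *)
pose dl (n : nat) := (b - a) / n.+3%:R.
have dl0 n : 0 < dl n by rewrite divr_gt0 ?subr_gt0.
have dl3 n : dl n *+ 2 < b - a.
  rewrite /dl -mulr_natr mulrAC ltr_pdivrMr ?ltr0n// ltr_pM2l ?subr_gt0//.
  by rewrite ltr_nat.
have Hn n : aeoo (a + dl n) (b - dl n) g (fun=> 0).
  have := dl0 n; have := dl3 n; rewrite mulr2n => d3 d0.
  apply: ae_zero_closed; first lra.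
    by apply: Ig; lra.
  by move=> x /andP[cx xd]; apply: H0; lra.
have := ae_foralln Hn; apply: filterS => x Hx /andP[ax xb].
pose m := Num.min (x - a) (b - x).
have m0 : 0 < m by rewrite lt_min !subr_gt0 ax.
have dm : dl (Num.truncn ((b - a) / m)) < m.
  rewrite /dl ltr_pdivrMr ?ltr0n// mulrC -ltr_pdivrMr//.
  apply: lt_trans (truncnS_gt _) _; by rewrite ltr_nat.
apply: (Hx (Num.truncn ((b - a) / m))).
have := dm; rewrite lt_min => /andP[? ?]; apply/andP; split; lra.
Qed.

Lemma bump_span_continuous f : bump_span f -> continuous f.
Proof.
move=> sf x; apply: differentiable_continuous; apply/derivable1_diffP.
by have [+ _] := bump_span_derive sf; exact.
Qed.

(** The vanishing integral brings the primitive back to 0 to the right of d, so it is compactly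
    supported. *)
Lemma bump_span_primitive a b c d w : a < c -> c < d -> d < b ->
  bump_span w -> (forall x, ~~ (c < x < d) -> w x = 0) -> intoo c d w = 0 ->
  exists2 phi, test_function a b phi & derive1 phi = w.
Proof.
move=> ac cd db sw w0 Iw.
have cw := bump_span_continuous sw.
have Iwcd : intgoo c d w by exact/intgoo_ccont/continuous_ccont.
have IwT : mu.-integrable setT (EFin \o w).
  rewrite (_ : EFin \o w = (EFin \o w) \_ `]c, d[).
    by apply/integrable_restrict => //; rewrite setTI.
  apply/funext => x; rewrite patchE; case: ifPn => //.
  by rewrite [_ \in _]mem_oo => /w0 /= ->.
have Iwy y : mu.-integrable `]-oo, y] (EFin \o w) by exact: integrableS IwT.
pose phi y := \int[mu]_(t in `]-oo, y]) w t.
have dphi x : derivable phi x 1 /\ phi^`()%classic x = w x.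
  by apply: (@continuous_FTC1 R w -oo%O x (x + 1)) => //; by [rewrite ltrDl ltr01|exact: cw|exact: ltNyr].
have dphiE : derive1 phi = w by apply/funext => x; have [] := dphi x.
exists phi => //; apply: (supported_test ac db).
  case=> [|j] x; first by have [] := dphi x.
  rewrite derive1Sn dphiE; exact: bump_span_smooth.
move=> x; rewrite negb_and -!ltNge => /orP[xc|dx]; rewrite /phi.
  rewrite (@eq_Rintegral _ _ _ _ _ (fun=> 0)) ?Rintegral_cst ?mul0r//.
  move=> t; rewrite inE/= in_itv/= => tx; apply: w0.
  by rewrite negb_and -leNgt (le_trans tx)// ltW.
rewrite -Iw /intoo [LHS]Rintegral_mkcond [RHS]Rintegral_mkcond.
apply: eq_Rintegral => t _; rewrite !patchE.
rewrite [X in _ = if X then _ else _]mem_oo.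
case: (boolP (c < t < d)) => [/andP[ct td]|/w0 ->]; last by case: ifP.
by rewrite ifT// inE/= in_itv/= ltW// (lt_trans td).
Qed.

Lemma test_function_derive a b phi : test_function a b phi ->
  test_function a b (derive1 phi).
Proof.
move=> [sphi cphi pab].
have sub : closure [set x | derive1 phi x != 0] `<=` closure [set x | phi x != 0].
  rewrite [X in _ `<=` X](closure_id _).1; last exact: closed_closure.
  apply: closure_subset => x /=; apply: contraNP => Hx.
  have : \forall y \near x, phi y = 0.
    have : nbhs x (~` closure [set x | phi x != 0]).
      by apply: open_nbhs_nbhs; split => //; exact/closed_openC/closed_closure.
    apply: filterS => y Hy; apply/eqP/negPn/negP => py.
    by apply: Hy; exact: subset_closure.
  move=> H; apply/eqP; rewrite derive1E (near_eq_derive _ H) -derive1E.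
  by rewrite derive1_cst.
split; first by move=> j x; rewrite -derive1Sn; exact: sphi.
  exact: (subclosed_compact (@closed_closure R^o _) cphi sub).
exact: subset_trans sub pab.
Qed.

(** A bump psi0 of nonzero mass m is fixed. Every bump psi, corrected by a multiple of psi0 to have
    integral 0, is the derivative of a test function; hence h - k is orthogonal to psi, where k is
    the integral of h psi0 divided by m. *)
Lemma du_bois_reymond a b h : intgoo a b h ->
  (forall phi, test_function a b phi ->
    intoo a b (fun x => h x * derive1 phi x) = 0) ->
  exists k, aeoo a b h (fun=> k).
Proof.
move=> Ih H; have [ab|ba] := ltP a b; last first.
  exists 0; apply: aeW => x /andP[ax xb]; move: (lt_trans ax xb).
  by rewrite ltNge ba.
pose c0 := a + (b - a) / 3; pose d0 := b - (b - a) / 3.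
have [ac0 cd0 db0] : [/\ a < c0, c0 < d0 & d0 < b].
  by rewrite /c0 /d0; clear -ab; split; lra.
have Icont f : continuous f -> intgoo a b f.
  by move=> cf; exact/intgoo_ccont/continuous_ccont.
(* If all the bumps on ]c0, d0[ had mass 0, their limit would make the length of ]c0, d0[ equal to
   0. *)
have [e0 e00 m0] : exists2 e, 0 < e & intoo a b (bump e c0 d0) != 0.
  apply: contrapT => /forall2NP He.
  have : intoo c0 d0 (fun=> 1) = 0.
    apply: intoo_bump0; first exact: intgoo_cst.
    move=> e e00; have [//|/negP/negPn/eqP <-] := He e.
    rewrite (@intoo_support a b c0 d0); try exact: ltW.
      by apply: eq_intoo => x _; rewrite mul1r.
    by move=> x; exact: bump_outside.
  by rewrite intoo_cst ?ltW// mul1r => /eqP; rewrite subr_eq0 gt_eqF.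
pose psi0 := bump e0 c0 d0; pose m := intoo a b psi0.
pose k := intoo a b (fun x => h x * psi0 x) / m.
have Ihb (e c d : R) : 0 < e -> intgoo a b (fun x => h x * bump e c d x).
  move=> ?; apply: (intgooMr (ltW ab) Ih); apply: continuous_ccont.
  exact/bump_span_continuous/bump_span_bump.
have Ib (e c d : R) : 0 < e -> intgoo a b (bump e c d).
  by move=> ?; exact/Icont/bump_span_continuous/bump_span_bump.
exists k.
suff : aeoo a b (fun x => h x - k) (fun=> 0).
  apply: filterS; first exact: (ae_filter_ringOfSetsType mu).
  by move=> x Hx xab; apply/eqP; rewrite -subr_eq0; apply/eqP/Hx.
apply: bump_ortho_ae => [c d ac db|e c d e00' ac cd db].
  by apply: intgooB; [exact: (intgooS (ltW ac) (ltW db) Ih)|exact: intgoo_cst].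
pose psi := bump e c d; pose q := intoo a b psi / m.
pose w x := psi x + (- q) * psi0 x.
have sw : bump_span w.
  by apply: bump_spanD; [|apply: bump_spanZ]; exact: bump_span_bump.
pose c1 := Num.min c c0; pose d1 := Num.max d d0.
have ac1 : a < c1 by rewrite lt_min ac.
have db1 : d1 < b by rewrite gt_max db.
have cd1 : c1 < d1.
  rewrite (@le_lt_trans _ _ c0) ?ge_min ?lexx ?orbT//.
  by rewrite (lt_le_trans cd0)// le_max lexx orbT.
have w0 x : ~~ (c1 < x < d1) -> w x = 0.
  move=> Hx; rewrite /w /psi /psi0 !bump_outside ?mulr0 ?addr0//; apply: contra Hx.
    by rewrite lt_max gt_min => /andP[-> ->]; rewrite !orbT.
  by rewrite lt_max gt_min => /andP[-> ->].
have Iw : intoo a b w = 0.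
  have Ip0 := Ib _ c0 d0 e00; have Ip := Ib _ c d e00'.
  rewrite intooD ?intooZ//; last exact: intgooZ.
  by rewrite /q -/m -/psi; field.
have [phi tphi dphi] : exists2 phi, test_function a b phi & derive1 phi = w.
  apply: (bump_span_primitive ac1 cd1 db1 sw w0).
  by rewrite -(intoo_support (ltW ac1) (ltW db1) w0).
have := H _ tphi; rewrite dphi.
rewrite (@eq_intoo _ _ _ _ (fun x => h x * psi x + (- q) * (h x * psi0 x))); last first.
  by move=> x _; rewrite /w; ring.
have Ip0 := Ihb _ c0 d0 e00; have Ip := Ihb _ c d e00'.
rewrite intooD ?intooZ//; last exact: intgooZ.
move=> H0.
rewrite (@eq_intoo _ _ _ _ (fun x => h x * psi x - k * psi x)); last first.
  by move=> x _; rewrite mulrBl.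
have Iq := Ib _ c d e00'.
rewrite intooB ?intooZ//; last exact: intgooZ.
rewrite -H0 mulNr /q /k; congr (_ - _).
by rewrite mulrAC [RHS]mulrAC; congr (_ / _); exact: mulrC.
Qed.

End Bumps.

(** * Integration by parts *)

Section Parts.
Context {R : realType}.
Implicit Types (a b c d e x y : R) (f g h u v : R -> R).

(** Over n + 1 equal pieces the bounds telescope to K (b - a) (A b - A a) / (n + 1), which tends to
    0. *)
Lemma increments_quadratic_cst a b (P A : R -> R) K : a <= b ->
  (forall x y, a <= x -> x <= y -> y <= b ->
     `|P y - P x| <= K * (y - x) * (A y - A x)) -> P b = P a.
Proof.
move=> ab H.
pose t n i : R := a + (b - a) * (i%:R / n.+1%:R).
have Hn n : `|P b - P a| <= (K * (b - a) * (A b - A a)) * n.+1%:R^-1.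
  have n0 : 0 < n.+1%:R :> R by rewrite ltr0n.
  have t0 : t n 0%N = a by rewrite /t mul0r mulr0 addr0.
  have tn : t n n.+1 = b by rewrite /t divff ?gt_eqF// mulr1 addrC subrK.
  have tS i : t n i.+1 - t n i = (b - a) / n.+1%:R.
    by rewrite /t opprD addrACA subrr add0r -mulrBr -mulrBl -natrB// subSnn mul1r.
  have tmono i : t n i <= t n i.+1.
    by rewrite -subr_ge0 tS divr_ge0 ?subr_ge0// ltW.
  have ti i : (i <= n.+1)%N -> a <= t n i <= b.
    move=> iN; rewrite /t lerDl mulr_ge0 ?subr_ge0//=.
    rewrite -lerBrDl ler_piMr ?subr_ge0// ler_pdivrMr// mul1r ler_nat//.
  have -> : P b - P a = \sum_(0 <= i < n.+1) (P (t n i.+1) - P (t n i)).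
    by rewrite telescope_sumr// t0 tn.
  have -> : K * (b - a) * (A b - A a) / n.+1%:R =
      \sum_(0 <= i < n.+1) K * ((b - a) / n.+1%:R) * (A (t n i.+1) - A (t n i)).
    by rewrite -mulr_sumr telescope_sumr// t0 tn; ring.
  rewrite (le_trans (ler_norm_sum _ _ _))// !big_nat; apply: ler_sum => i /andP[_ iN].
  rewrite -(tS i); apply: H => //.
    by have /andP[] := ti _ (ltnW iN).
  by have /andP[] := ti _ iN.
apply/eqP; rewrite -subr_eq0 -normr_le0; apply/ler_addgt0Pl => e e0.
rewrite addr0; pose C := K * (b - a) * (A b - A a).
apply: le_trans (Hn (Num.truncn (C / e))) _.
rewrite -/C ler_pdivrMr ?ltr0n// mulrC -ler_pdivrMr// ltW// truncnS_gt//.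
Qed.

(** The product rule when G is merely absolutely continuous. The function P = G q minus the claimed
    primitive has increments of second order, namely at most a length times an increment of the
    integral of |g|, so it is constant. *)
Lemma prim_mul a b G g q q' : prim a b G g -> prim a b q q' -> ccont a b q' ->
  prim a b (fun x => G x * q x) (fun x => g x * q x + G x * q' x).
Proof.
move=> pG pq cq'; have [ab|ba] := leP a b; last first.
  split.
    rewrite /intgoo set_itv_ge ?bnd_simp -?leNgt ?(ltW ba)//.
    exact: integrable_set0.
  move=> x y ax xy yb; exfalso.
  by move: ba; rewrite ltNge (le_trans ax)// (le_trans xy).
have cG := prim_ccont pG; have cq := prim_ccont pq.
have [Ig HG] := pG; have [Iq Hq] := pq.
have I1 : intgoo a b (fun x => g x * q x) by exact: intgooMr.
have I2 : intgoo a b (fun x => G x * q' x) by exact/intgoo_ccont/ccontM.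
have I12 := intgooD I1 I2.
have [M M0 HM] := ccont_bounded ab cq'.
have Ing := intgoo_norm Ig.
pose A x := intoo a x (fun t => `|g t|).
have HA x y : a <= x -> x <= y -> y <= b -> A y - A x = intoo x y (fun t => `|g t|).
  by have [_] := prim_intoo Ing; exact.
have lip x y : a <= x -> x <= y -> y <= b -> `|q y - q x| <= M * (y - x).
  move=> ax xy yb; rewrite Hq//; have Ixy := intgooS ax yb Iq.
  apply: le_trans (le_normr_intoo Ixy) _; rewrite -(intoo_cst M xy).
  apply: le_intoo; [exact: intgoo_norm|exact: intgoo_cst|].
  move=> z /andP[xz zy]; apply: HM.
  by rewrite (le_trans ax (ltW xz)) (le_trans (ltW zy) yb).
have lipG x y : a <= x -> x <= y -> y <= b -> `|G y - G x| <= A y - A x.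
  by move=> ax xy yb; rewrite HG// HA//; exact: (le_normr_intoo (intgooS ax yb Ig)).
split=> // x0 y0 ax0 xy0 yb0.
pose P x := G x * q x - intoo a x (fun t => g t * q t + G t * q' t).
suff : P y0 = P x0.
  rewrite /P => H; have [_ H1] := prim_intoo I12.
  by rewrite -(H1 x0 y0)//; move/eqP: H; rewrite subr_eq => /eqP ->; ring.
apply: (@increments_quadratic_cst _ _ _ A (2 * M)) => // x y x0x xy yy0.
have ax := le_trans ax0 x0x; have yb := le_trans yy0 yb0.
have [_ H1] := prim_intoo I12.
have J1 := intgooS ax yb I1; have J2 := intgooS ax yb I2.
have Jg := intgooS ax yb Ig; have Jq := intgooS ax yb Iq.
(* From G y q y - G x q x = q x (G y - G x) + G y (q y - q x). In the first integral q varies by at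
   most M (y - x), in the second G varies by at most A y - A x; each contributes one M to the factor
   2 M. *)
have -> : P y - P x = intoo x y (fun t => q x * g t - g t * q t) +
                      intoo x y (fun t => G y * q' t - G t * q' t).
  rewrite /P !intooB ?intooZ//; try exact: intgooZ.
  have := H1 x y ax xy yb; rewrite [RHS]intooD// => H1'.
  by rewrite -HG// -Hq//; lra.
have -> : 2 * M * (y - x) * (A y - A x) =
   M * (y - x) * (A y - A x) + (A y - A x) * M * (y - x) by ring.
apply: le_trans (ler_normD _ _) _; apply: lerD.
  have J3 := intgooB (intgooZ (q x) Jg) J1.
  apply: le_trans (le_normr_intoo J3) _; rewrite HA// -intooZ//; last exact: intgooS Ing.
  apply: le_intoo; [exact: intgoo_norm|apply: intgooZ; exact: intgooS Ing|].
  move=> t /andP[xt ty]; rewrite mulrC -mulrBr normrM mulrC.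
  apply: ler_wpM2r => //; rewrite distrC (le_trans (lip x t _ _ _))//; try exact: ltW.
    by rewrite (le_trans (ltW ty)).
  by apply: ler_wpM2l => //; rewrite lerB// ltW.
have J3 := intgooB (intgooZ (G y) Jq) J2.
apply: le_trans (le_normr_intoo J3) _; rewrite -intoo_cst//.
apply: le_intoo; [exact: intgoo_norm|exact: intgoo_cst|].
move=> t /andP[xt ty]; rewrite -mulrBl normrM; apply: ler_pM => //.
  apply: le_trans (lipG t y _ _ _) _ => //; try exact: ltW.
    by rewrite (le_trans ax)// ltW.
  rewrite lerB// -subr_ge0 HA//; try exact: ltW; last by rewrite (le_trans (ltW ty)).
  by apply: intoo_ge0.
by apply: HM; rewrite (le_trans ax (ltW xt)) (le_trans (ltW ty) yb).
Qed.

Lemma intoo_parts a b G g q q' : a <= b -> prim a b G g -> prim a b q q' ->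
  ccont a b q' ->
  intoo a b (fun x => G x * q' x) =
  G b * q b - G a * q a - intoo a b (fun x => g x * q x).
Proof.
move=> ab pG pq cq'; have [_ H] := prim_mul pG pq cq'.
rewrite H// intooD; first by ring.
  by apply: intgooMr => //; [case: pG|exact: prim_ccont pq].
by apply/intgoo_ccont/ccontM => //; exact: prim_ccont pG.
Qed.

Lemma test_function_derive1n a b phi j : test_function a b phi ->
  test_function a b (derive1n j phi).
Proof. by move=> H; elim: j => // j; exact: test_function_derive. Qed.

Lemma test_function_outside a b phi x : test_function a b phi ->
  ~~ (a < x < b) -> phi x = 0.
Proof.
move=> [_ _ sub]; apply: contraNeq => px.
have : closure [set x | phi x != 0] x by exact: subset_closure.
by move=> /sub; rewrite /= in_itv.
Qed.

Lemma test_function_continuous a b phi : test_function a b phi -> continuous phi.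
Proof.
move=> [H _ _] x; apply: differentiable_continuous; apply/derivable1_diffP.
exact: (H 0%N).
Qed.

Lemma test_function_widen a b c d phi : a <= c -> d <= b ->
  test_function c d phi -> test_function a b phi.
Proof.
move=> ac db [s cp sub]; split => //; apply: (subset_trans sub).
by apply: subset_itv; rewrite bnd_simp.
Qed.

Lemma test_function_prim a b c d phi : test_function a b phi ->
  prim c d phi (derive1 phi).
Proof.
move=> tphi; have ct := test_function_continuous (test_function_derive tphi).
split; first exact/intgoo_ccont/continuous_ccont.
move=> x y _ xy _; apply/esym/intoo_FTC => //; try exact: continuous_ccont.
  exact/continuous_ccont/(test_function_continuous tphi).
move=> z _; have [/(_ 0%N z)/= H _ _] := tphi.
by apply: DeriveDef => //; rewrite derive1E.
Qed.

Lemma intoo_parts_test a b G g phi : prim a b G g -> test_function a b phi ->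
  intoo a b (fun x => G x * derive1 phi x) = - intoo a b (fun x => g x * phi x).
Proof.
move=> pG tphi; have [ab|ba] := leP a b; last first.
  rewrite /intoo !set_itv_ge ?bnd_simp -?leNgt ?(ltW ba)//.
  by rewrite !Rintegral_set0 oppr0.
rewrite (intoo_parts ab pG (test_function_prim a b tphi)); last first.
  apply: continuous_ccont.
  exact: (test_function_continuous (test_function_derive tphi)).
rewrite (test_function_outside (x := b) tphi) ?ltxx ?andbF//.
by rewrite (test_function_outside (x := a) tphi) ?ltxx// !mulr0 subrr sub0r.
Qed.

End Parts.

(** * Weak derivatives *)

Section Weak.
Context {R : realType}.
Implicit Types (a b c d e x y : R) (f g h u v : R -> R) (D : nat -> R -> R).
Local Notation mu := (@lebesgue_measure R).

Lemma aeoo_refl a b f : aeoo a b f f.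
Proof. exact: aeW. Qed.

Lemma aeoo_sym a b f g : aeoo a b f g -> aeoo a b g f.
Proof.
apply: filterS; first exact: (ae_filter_ringOfSetsType mu).
by move=> x H /H.
Qed.

Lemma aeooW a b f g : (forall x, a < x < b -> f x = g x) -> aeoo a b f g.
Proof. by move=> H; apply: aeW => x; exact: H. Qed.

Lemma aeooS a b c d f g : a <= c -> d <= b -> aeoo a b f g -> aeoo c d f g.
Proof.
move=> ac db; apply: filterS; first exact: (ae_filter_ringOfSetsType mu).
by move=> x H /andP[cx xd]; apply: H; rewrite (le_lt_trans ac)//= (lt_le_trans xd).
Qed.

Lemma aeoo_comp2 a b (F : R -> R -> R -> R) f g f' g' :
  aeoo a b f f' -> aeoo a b g g' ->
  aeoo a b (fun x => F x (f x) (g x)) (fun x => F x (f' x) (g' x)).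
Proof.
apply: filterS2; first exact: (ae_filter_ringOfSetsType mu).
by move=> x H H' xab; rewrite H// H'.
Qed.

Lemma aeoo_trans a b f g h : aeoo a b f g -> aeoo a b g h -> aeoo a b f h.
Proof.
apply: filterS2; first exact: (ae_filter_ringOfSetsType mu).
by move=> x H H' xab; rewrite H// H'.
Qed.

Lemma aeoo_intoo a b f g : measurable_fun (`]a, b[ : set R) f ->
  measurable_fun (`]a, b[ : set R) g -> aeoo a b f g ->
  intoo a b f = intoo a b g.
Proof.
move=> mf mg fg; congr fine; apply: ae_eq_integral => //.
- exact/measurable_EFinP.
- exact/measurable_EFinP.
- move: fg; apply: filterS; first exact: (ae_filter_ringOfSetsType mu).
  by move=> x H; rewrite /= in_itv/= => /H ->.
Qed.

Lemma aeoo_intgoo a b f g : measurable_fun (`]a, b[ : set R) g ->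
  aeoo a b f g -> intgoo a b f -> intgoo a b g.
Proof.
move=> mg fg If; have mf := intgoo_meas If.
move/integrableP: If => [mf' foo]; apply/integrableP; split.
  exact/measurable_EFinP.
rewrite (le_lt_trans _ foo)// le_eqVlt; apply/orP; left; apply/eqP.
apply: ae_eq_integral => //.
- by apply/measurable_EFinP; apply: measurableT_comp.
- by apply/measurable_EFinP; apply: measurableT_comp.
- move: fg; apply: filterS; first exact: (ae_filter_ringOfSetsType mu).
  by move=> x H; rewrite /= in_itv/= => /H ->.
Qed.

Lemma aeoo_L2oo a b f g : measurable_fun (`]a, b[ : set R) g ->
  aeoo a b f g -> L2oo a b f -> L2oo a b g.
Proof.
move=> mg fg [mf If]; split => //.
apply: aeoo_intgoo If; first exact: measurable_funM.
exact: (aeoo_comp2 (fun _ s t => s ^+ 2) fg fg).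
Qed.

Lemma aeoo_intoo_sqr a b f g : measurable_fun (`]a, b[ : set R) f ->
  measurable_fun (`]a, b[ : set R) g -> aeoo a b f g ->
  intoo a b (fun x => f x ^+ 2) = intoo a b (fun x => g x ^+ 2).
Proof.
move=> mf mg fg; apply: aeoo_intoo; try exact: measurable_funM.
exact: (aeoo_comp2 (fun _ s t => s ^+ 2) fg fg).
Qed.

Lemma weak_derivative_unique a b j u g1 g2 : weak_derivative a b j u g1 ->
  weak_derivative a b j u g2 -> aeoo a b g1 g2.
Proof.
move=> [_ lg1 H1] [_ lg2 H2].
have I1 c d (ac : a < c) (db : d < b) := locally_integrable_intgoo lg1 ac db.
have I2 c d (ac : a < c) (db : d < b) := locally_integrable_intgoo lg2 ac db.
suff : aeoo a b (fun x => g1 x - g2 x) (fun=> 0).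
  apply: filterS; first exact: (ae_filter_ringOfSetsType mu).
  by move=> x Hx xab; apply/eqP; rewrite -subr_eq0; apply/eqP/Hx.
apply: bump_ortho_ae => [c d ac db|e c d e0 ac cd db].
  by apply: intgooB; [exact: I1|exact: I2].
have tphi := bump_test e0 ac db.
have := H1 _ tphi; rewrite (H2 _ tphi) => /eqP.
rewrite -subr_eq0 -mulrBr mulf_eq0 signr_eq0/= subr_eq0 => /eqP H.
have supp (g : R -> R) : intoo a b (fun x => g x * bump e c d x) =
    intoo c d (fun x => g x * bump e c d x).
  apply: intoo_support; [exact: ltW|exact: ltW|].
  by move=> x Hx; rewrite bump_outside ?mulr0.
have cb : ccont c d (bump e c d).
  exact/continuous_ccont/bump_span_continuous/bump_span_bump.
rewrite supp (@eq_intoo _ _ _ _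
  (fun x => g1 x * bump e c d x - g2 x * bump e c d x)); last first.
  by move=> x _; rewrite mulrBl.
rewrite intooB; [|apply: intgooMr => //; exact: I1|apply: intgooMr => //; exact: I2].
by rewrite -!supp /intoo H subrr.
Qed.

Lemma locally_integrable_sub a b c d g : a <= c -> d <= b ->
  locally_integrable (`]a, b[ : set R) g -> locally_integrable (`]c, d[ : set R) g.
Proof.
move=> ac db [mg _ goo].
have sub : `]c, d[ `<=` `]a, b[ by apply: subset_itv; rewrite bnd_simp.
split; [exact: measurable_funS mg|exact: interval_open|].
by move=> K Kcd; apply: goo; exact: subset_trans sub.
Qed.

Lemma weak_derivative_restrict a b c d j u g : a <= c -> d <= b ->
  weak_derivative a b j u g -> weak_derivative c d j u g.
Proof.
move=> ac db [lu lg H]; split; try exact: (locally_integrable_sub ac db).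
move=> phi tphi; have := H _ (test_function_widen ac db tphi).
have supp (f psi : R -> R) : test_function c d psi ->
    intoo a b (fun x => f x * psi x) = intoo c d (fun x => f x * psi x).
  move=> tpsi; apply: intoo_support => // x Hx.
  by rewrite (test_function_outside tpsi) ?mulr0.
rewrite -![Rintegral _ _ _]/(intoo _ _ _) !supp//.
exact: test_function_derive1n.
Qed.

Lemma intgoo_locally_integrable a b f : intgoo a b f ->
  locally_integrable (`]a, b[ : set R) f.
Proof. by move=> If; apply: open_integrable_locally => //; exact: interval_open. Qed.

Lemma eq_weak_derivative a b j u u' g g' : (forall x, a < x < b -> u x = u' x) ->
  (forall x, a < x < b -> g x = g' x) ->
  weak_derivative a b j u g -> weak_derivative a b j u' g'.
Proof.
move=> uu gg.
have loc (f f' : R -> R) : (forall x, a < x < b -> f x = f' x) ->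
    locally_integrable (`]a, b[ : set R) f -> locally_integrable (`]a, b[ : set R) f'.
  move=> ff [mf oab foo]; split => //.
    by apply: eq_measurable_fun mf => x; rewrite [_ \in _]mem_oo => /ff.
  move=> K Kab cK; rewrite (_ : integral _ _ _ = \int[mu]_(x in K) `|f x|%:E)%E ?foo//.
  by apply: eq_integral => x; rewrite inE => /Kab /=; rewrite in_itv/= => /ff ->.
move=> [lu lg H]; split; [exact: loc lu|exact: loc lg|move=> phi tphi].
have := H phi tphi; rewrite -![Rintegral _ _ _]/(intoo _ _ _).
rewrite (@eq_intoo _ _ _ _ (fun x => u' x * derive1n j phi x)); last first.
  by move=> x /uu ->.
rewrite (@eq_intoo _ _ _ (fun x => g x * phi x) (fun x => g' x * phi x))//.
by move=> x /gg ->.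
Qed.

Lemma prim_weak_derivative a b j D : intgoo a b (D 0%N) -> intgoo a b (D j) ->
  (forall i, (i < j)%N -> prim a b (D i) (D i.+1)) ->
  weak_derivative a b j (D 0%N) (D j).
Proof.
move=> I0 Ij pD; split; try exact: intgoo_locally_integrable.
move=> phi tphi; rewrite -![Rintegral _ _ _]/(intoo _ _ _).
suff H i : (i <= j)%N -> intoo a b (fun x => D 0%N x * derive1n j phi x) =
    (-1) ^+ i * intoo a b (fun x => D i x * derive1n (j - i) phi x).
  by rewrite (H j)// subnn.
elim: i => [|i IH] ij; first by rewrite expr0 mul1r subn0.
have := intoo_parts_test (pD i ij) (test_function_derive1n (j - i.+1) tphi).
rewrite -derive1nS subnSK// => E.
by rewrite (IH (ltnW ij)) E mulrN -mulN1r mulrA -exprS.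
Qed.

(** The difference of g and the primitive of g' is orthogonal to all derivatives of test functions,
    hence constant by du Bois-Reymond. *)
Lemma weak_derivative_step a b v j g g' : a < b ->
  weak_derivative a b j v g -> weak_derivative a b j.+1 v g' ->
  intgoo a b g -> intgoo a b g' ->
  exists k, aeoo a b g (fun x => k + intoo a x g').
Proof.
move=> ab [_ _ H] [_ _ H'] Ig Ig'.
have pG := prim_intoo Ig'.
have IG : intgoo a b (fun x => intoo a x g') := intgoo_ccont (prim_ccont pG). 
have [] := @du_bois_reymond R a b (fun x => g x - intoo a x g').
- exact: intgooB.
- move=> phi tphi.
  have cphi : ccont a b (derive1 phi).
    apply: continuous_ccont.
    exact: (test_function_continuous (test_function_derive tphi)).
  rewrite (@eq_intoo _ _ _ _
    (fun x => g x * derive1 phi x - intoo a x g' * derive1 phi x)); last first.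
    by move=> x _; rewrite mulrBl.
  rewrite intooB; try by apply: intgooMr => //; exact: ltW.
  rewrite (intoo_parts_test pG tphi) opprK.
  have := H _ (test_function_derive tphi); have := H' _ tphi.
  rewrite -derive1Sn -![Rintegral _ _ _]/(intoo _ _ _) => -> /eqP.
  rewrite exprS -mulrA mulN1r -subr_eq0 -opprD oppr_eq0 -mulrDr mulf_eq0.
  by rewrite signr_eq0/= addrC => /eqP.
- move=> k Hk; exists k; move: Hk.
  apply: filterS; first exact: (ae_filter_ringOfSetsType mu).
  by move=> x H1 /H1 <-; rewrite subrK.
Qed.

Lemma L2oo_memL2 a b g : memL2 a b g <-> L2oo a b g.
Proof.
rewrite /memL2; split.
  move=> H; have := Lfun2_integrable_sqr H.
  move: H; rewrite inE => /andP[]; rewrite inE/= => mg _ Ig; split.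
    exact/(measurable_restrictT g (moo a b)).
  have : mu.-integrable `]a, b[ (EFin \o (fun x => (g \_ `]a, b[) x ^+ 2)).
    exact: integrableS Ig.
  apply: eq_integrable => // x; rewrite inE/= => xab.
  by rewrite patchE mem_set.
move=> [mg Ig]; rewrite inE; apply/andP; split; rewrite inE/=.
  exact/(measurable_restrictT g (moo a b)).
rewrite /finite_norm unlock poweR_lty//.
move: Ig => /integrableP[_]; apply: le_lt_trans.
rewrite [leRHS]integral_mkcond le_eqVlt; apply/orP; left; apply/eqP.
apply: eq_integral => x _ /=; rewrite !patchE.
case: ifPn => _; rewrite ?normr0 ?powR0// powR_mulrn//.
by rewrite real_normK ?num_real// ger0_norm ?sqr_ge0.
Qed.

Lemma L2norm_sqrt a b g : L2oo a b g ->
  L2norm a b g = (Num.sqrt (intoo a b (fun x => g x ^+ 2)))%:E.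
Proof.
move=> [mg Ig]; rewrite /L2norm unlock.
have -> : (\int[mu]_x (`|(EFin \o g \_ `]a, b[) x| `^ 2))%E =
    (intoo a b (fun x => g x ^+ 2))%:E.
  rewrite /intoo /Rintegral fineK; last exact: integrable_fin_num.
  rewrite [RHS]integral_mkcond; apply: eq_integral => x _ /=; rewrite !patchE.
  case: ifPn => _; rewrite ?normr0 ?powR0// powR_mulrn//.
  by rewrite real_normK ?num_real.
by rewrite -powR12_sqrt ?intoo_sqr_ge0.
Qed.

(** [wder] picks an arbitrary weak derivative; square integrability is carried over to it from the
    one given by [inHn], by uniqueness up to null sets. *)
Lemma inHn_wder a b m u j : inHn m a b u -> (j <= m)%N ->
  weak_derivative a b j u (wder a b j u) /\ L2oo a b (wder a b j u).
Proof.
move=> H jm; have [g wg /L2oo_memL2 Lg] := H j jm.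
have ww : weak_derivative a b j u (wder a b j u).
  by rewrite /wder; case: xgetP => [y _ //|/(_ g)].
split=> //; apply: aeoo_L2oo Lg; last exact: weak_derivative_unique wg ww.
by case: ww => _ [].
Qed.

Lemma weak_derivative0_ae a b u g : weak_derivative a b 0 u g -> aeoo a b u g.
Proof.
move=> wg; have [lu lg H] := wg; apply: weak_derivative_unique wg.
by split=> // phi tphi; rewrite mul1r.
Qed.

(* The absolutely continuous representatives of the weak derivatives. *)
Lemma inHn_chain a b m u : a < b -> inHn m a b u ->
  exists D, [/\ aeoo a b u (D 0%N),
    forall i, (i < m)%N -> prim a b (D i) (D i.+1),
    forall i, (i <= m)%N -> L2oo a b (D i) &
    forall i, (i <= m)%N -> aeoo a b (wder a b i u) (D i)].
Proof.
move=> ab H; pose w i := wder a b i u.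
have Hw i : (i <= m)%N -> weak_derivative a b i u (w i) /\ L2oo a b (w i).
  exact: inHn_wder.
have Iw i : (i <= m)%N -> intgoo a b (w i).
  by move=> im; apply: L2oo_intgoo; exact: (Hw i im).2.
have HK i : exists k, (i < m)%N -> aeoo a b (w i) (fun x => k + intoo a x (w i.+1)).
  have [im|] := boolP (i < m)%N; last by exists 0.
  have [k Hk] := weak_derivative_step ab (Hw i (ltnW im)).1 (Hw _ im).1
    (Iw _ (ltnW im)) (Iw _ im).
  by exists k.
have [k Hk] := choice HK.
(* Below order m the representative is a primitive of the next weak derivative. The top order has no
   next one, so the chosen weak derivative itself is kept. *)
pose D i x := if (i < m)%N then k i + intoo a x (w i.+1) else w i x.
have DE i : (i < m)%N -> D i = fun x => k i + intoo a x (w i.+1).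
  by move=> im; apply/funext => x; rewrite /D im.
have wD i : (i <= m)%N -> aeoo a b (w i) (D i).
  rewrite leq_eqVlt => /predU1P[->|im].
    by apply: aeooW => x _; rewrite /D ltnn.
  by rewrite DE//; exact: Hk.
have pD' i : (i < m)%N -> prim a b (D i) (w i.+1).
  move=> im; rewrite DE//; have [I2 H2] := prim_intoo (Iw _ im).
  by split=> // x y ax xy yb; rewrite -(H2 x y)// opprD addrACA subrr add0r.
have mD i : (i <= m)%N -> measurable_fun (`]a, b[ : set R) (D i).
  rewrite leq_eqVlt => /predU1P[->|im].
    rewrite (_ : D m = w m); first exact: (Hw m (leqnn m)).2.1.
    by apply/funext => x; rewrite /D ltnn.
  exact: (intgoo_meas (intgoo_ccont (prim_ccont (pD' i im)))).
have LD i : (i <= m)%N -> L2oo a b (D i).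
  by move=> im; exact: (aeoo_L2oo (mD i im) (wD i im) (Hw i im).2).
exists D; split=> //.
- apply: aeoo_trans (wD 0%N isT); exact: weak_derivative0_ae (Hw 0%N isT).1.
- move=> i im; have [Ii Hi] := pD' i im; split; first exact/L2oo_intgoo/LD.
  move=> x y ax xy yb; rewrite Hi//; apply: aeoo_intoo.
  + exact: (intgoo_meas (intgooS ax yb (Iw _ im))).
  + exact: (intgoo_meas (intgooS ax yb (L2oo_intgoo (LD _ im)))).
  + exact: aeooS (wD _ im).
Qed.

Lemma Hn_norm_sqrt a b m u D : inHn m a b u ->
  (forall i, (i <= m)%N -> L2oo a b (D i)) ->
  (forall i, (i <= m)%N -> aeoo a b (wder a b i u) (D i)) ->
  Hn_norm m a b u =
  (Num.sqrt (\sum_(i < m.+1) intoo a b (fun x => D i x ^+ 2)))%:E.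
Proof.
move=> H LD wD; rewrite /Hn_norm asboolT//.
have -> : (\sum_(j < m.+1) L2norm a b (wder a b j u) ^+ 2)%E =
    (\sum_(i < m.+1) intoo a b (fun x => D i x ^+ 2))%:E.
  rewrite -sumEFin; apply: eq_bigr => i _.
  have im : (i <= m)%N by rewrite -ltnS.
  have [_ Lw] := inHn_wder H im.
  rewrite L2norm_sqrt// -EFin_expe sqr_sqrtr ?intoo_sqr_ge0//.
  by rewrite (aeoo_intoo_sqr _ _ (wD i im))//; [case: Lw|case: (LD i im)].
rewrite /= powR12_sqrt//; apply: sumr_ge0 => i _; exact: intoo_sqr_ge0.
Qed.

Lemma prim_inHn a b m u D : (forall x, a < x < b -> u x = D 0%N x) ->
  (forall i, (i <= m)%N -> L2oo a b (D i)) ->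
  (forall i, (i < m)%N -> prim a b (D i) (D i.+1)) ->
  inHn m a b u /\ forall i, (i <= m)%N -> aeoo a b (wder a b i u) (D i).
Proof.
move=> uD LD pD.
have wD j : (j <= m)%N -> weak_derivative a b j u (D j).
  move=> jm; apply: (@eq_weak_derivative _ _ _ (D 0%N) _ (D j)) => //.
    by move=> x /uD ->.
  apply: prim_weak_derivative; try exact/L2oo_intgoo/LD.
  by move=> i ij; apply: pD; rewrite (leq_trans ij).
have H : inHn m a b u.
  by move=> j jm; exists (D j); [exact: wD|exact/L2oo_memL2/LD].
split=> // i im; apply: weak_derivative_unique (wD i im).
by have [] := inHn_wder H im.
Qed.

End Weak.

(** * Legendre projections *)

Definition bubble (R : realType) (a b : R) : {poly R} :=
  ('X - a%:P) * (b%:P - 'X).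

(* Legendre polynomials on [a, b] up to normalization (Rodrigues' formula). *)
Definition legendre (R : realType) (a b : R) (i : nat) : {poly R} :=
  (bubble a b ^+ i)^`(i).

Definition pairing (R : realType) (a b : R) (h : R -> R) (q : {poly R}) : R :=
  intoo a b (fun x => h x * q.[x]).

Definition leg_coef (R : realType) (a b : R) (h : R -> R) (i : nat) : R :=
  pairing a b h (legendre a b i) /
  intoo a b (fun x => (legendre a b i).[x] ^+ 2).

Definition proj (R : realType) (a b : R) (p : nat) (h : R -> R) : {poly R} :=
  \sum_(i < p.+1) leg_coef a b h i *: legendre a b i.

HB.lock Definition proj_err (R : realType) (a b : R) (p : nat) (h : R -> R) : R :=
  intoo a b (fun x => (h x - (proj a b p h).[x]) ^+ 2).

(** This is i (i + 1) - j (j + 1), the Sturm-Liouville eigenvalue of the j-th derivative of the i-th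
    Legendre polynomial; j = 0 gives the Legendre eigenvalue i (i + 1). *)
Definition leg_eig (R : realType) (i j : nat) : R :=
  (i%:R - j%:R) * (i%:R + j%:R + 1).

Lemma quadratic_power_ode (R : realType) (W : {poly R}) i n : W^`()^`() = - 2%:R -> W * (W ^+ i)^`(n.+2) =
  (i%:R - n.+1%:R) * (W^`() * (W ^+ i)^`(n.+1)) -
  (n.+1%:R * (2 * i%:R - n%:R)) * (W ^+ i)^`(n).
Proof.
move=> deriv2_bubble.
have E0 : W * (W ^+ i)^`() = i%:R * (W^`() * W ^+ i).
  case: i => [|i]; first by rewrite expr0 -polyC1 derivC mulr0 mul0r.
  by rewrite deriv_exp /= exprS -mulr_natl; ring.
have dn (k : {poly R}) q : k^`() = 0 -> (k * q)^`() = k * q^`().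
  by move=> k0; rewrite derivM k0 mul0r add0r.
have d0 (k : nat) : (k%:R : {poly R})^`() = 0 by rewrite -polyC_natr derivC.
elim: n => [|n IH].
  have /(congr1 (@deriv _)) := E0.
  rewrite (derivM W) (dn i%:R) ?d0// (derivM W^`()) deriv2_bubble.
  rewrite [(W ^+ i)^`(2)]derivnS !derivn1 derivn0 => H.
  rewrite -[W * _](addKr (W^`() * (W ^+ i)^`())) H; ring.
have /(congr1 (@deriv _)) := IH.
rewrite derivB (dn (i%:R - n.+1%:R)) ?derivB ?d0 ?subrr//.
rewrite (dn (n.+1%:R * (2 * i%:R - n%:R))); last first.
  by rewrite !derivM derivB !d0 derivM !d0; ring.
rewrite !derivM deriv2_bubble -!derivnS.
move=> H; rewrite -[W * _](addKr (W^`() * (W ^+ i)^`(n.+2))) H.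
rewrite -!natr1; ring.
Qed.

(** In the preceding identity at order i + j the coefficient of W' is -(j + 1), which cancels the
    term coming from the derivative of the weight W^(j+1). *)
Lemma quadratic_power_sl (R : realType) (W : {poly R}) i j :
  W^`()^`() = - 2%:R ->
  (W ^+ j.+1 * (W ^+ i)^`(i)^`(j.+1))^`() =
  - (leg_eig R i j)%:P * (W ^+ j * (W ^+ i)^`(i)^`(j)).
Proof.
move=> W2; have := quadratic_power_ode i (i + j) W2.
have DE k : (W ^+ i)^`(i + k) = (W ^+ i)^`(i)^`(k).
  by rewrite /derivn addnC iterD.
rewrite -!addnS !DE => H.
rewrite derivM deriv_exp -derivnS /= -mulr_natl [W ^+ j.+1]exprSr.
rewrite -[X in _ + X]mulrA H /leg_eig !addnS -!natr1 natrD.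
rewrite !(polyCM, polyCD, polyCN, polyC_natr) polyC1; ring.
Qed.

Section Legendre.
Context {R : realType}.
Variables a b : R.
Hypothesis ab : a < b.
Implicit Types (q : {poly R}) (p : nat) (h f g : R -> R).
Local Notation W := (bubble a b).
Local Notation L := (legendre a b).
Local Notation lam := (leg_eig R).

Lemma deriv_bubble : W^`() = (a + b)%:P - 2%:R * 'X.
Proof.
rewrite derivM derivXsubC derivB derivC derivX polyCD; ring.
Qed.

Lemma deriv2_bubble : W^`()^`() = - 2%:R.
Proof. by rewrite deriv_bubble derivB derivC mulr_natl derivMn derivX sub0r. Qed.

Lemma legendre_sl i j : (W ^+ j.+1 * (L i)^`(j.+1))^`() =
  - (lam i j)%:P * (W ^+ j * (L i)^`(j)).
Proof. exact: quadratic_power_sl deriv2_bubble. Qed.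

Lemma size_bubble : size W = 3%N.
Proof.
rewrite /bubble -[b%:P - 'X]opprB mulrN size_polyN size_mul ?polyXsubC_eq0//.
by rewrite !size_XsubC.
Qed.

Lemma bubble_neq0 : W != 0.
Proof. by rewrite -size_poly_eq0 size_bubble. Qed.

Lemma size_bubbleX i : size (W ^+ i) = (2 * i).+1.
Proof.
have := size_exp W i; rewrite size_bubble /=.
have : (0 < size (W ^+ i))%N by rewrite lt0n size_poly_eq0 expf_neq0// bubble_neq0.
by case: (size _) => //= n _ ->.
Qed.

Lemma size_legendre i : (size (L i) <= i.+1)%N.
Proof.
apply/leq_sizeP => j ij; rewrite coef_derivn nth_default ?mul0rn//.
by rewrite size_bubbleX mul2n -addnn -addnS leq_add2l.
Qed.

Lemma coef_legendre_neq0 i : (L i)`_i != 0.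
Proof.
rewrite coef_derivn mulrn_eq0 negb_or -lt0n ffact_gt0 leq_addr/=.
have : lead_coef (W ^+ i) != 0 by rewrite lead_coef_eq0 expf_neq0// bubble_neq0.
by rewrite lead_coefE size_bubbleX mul2n -addnn.
Qed.

Lemma legendre_span p q : (size q <= p)%N ->
  exists c : nat -> R, q = \sum_(i < p) c i *: L i.
Proof.
elim: p q => [|p IH] q sq.
  exists (fun=> 0); rewrite big_ord0; apply/eqP; rewrite -size_poly_eq0.
  by rewrite -leqn0.
pose k := q`_p / (L p)`_p.
have [|c Hc] := IH (q - k *: L p).
  apply/leq_sizeP => j; rewrite leq_eqVlt => /predU1P[<-|pj].
    by rewrite coefB coefZ /k divfK ?subrr// coef_legendre_neq0.
  rewrite coefB coefZ (nth_default _ (leq_trans sq pj)).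
  by rewrite (nth_default _ (leq_trans (size_legendre p) pj)) mulr0 subr0.
exists (fun i => if (i < p)%N then c i else k).
rewrite big_ord_recr /= ltnn -[LHS](subrK (k *: L p)) Hc; congr (_ + _).
by apply: eq_bigr => i _; rewrite ltn_ord.
Qed.

Lemma intgoo_pairing h q : intgoo a b h -> intgoo a b (fun x => h x * q.[x]).
Proof. by move=> Ih; apply: intgooMr (ltW ab) Ih _; exact: ccont_poly. Qed.

Lemma pairing_sum n h (c : 'I_n -> R) (q : 'I_n -> {poly R}) : intgoo a b h ->
  pairing a b h (\sum_i c i *: q i) = \sum_i c i * pairing a b h (q i).
Proof.
move=> Ih; have [_] := @intoo_sum R a b _ (index_enum 'I_n) xpredT
  (fun i x => c i * (h x * (q i).[x]))
  (fun i => intgooZ (c i) (intgoo_pairing (q i) Ih)).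
move=> H; rewrite /pairing (eq_bigr (fun i => intoo a b (fun x => c i * (h x * (q i).[x])))).
  rewrite -H; apply: eq_intoo => x _; rewrite horner_sum mulr_sumr.
  by apply: eq_bigr => i _; rewrite hornerZ; ring.
by move=> i _; rewrite intooZ//; exact: intgoo_pairing.
Qed.

(** Integration by parts in the Sturm-Liouville identity; the boundary terms vanish because W does
    at a and b. *)
Lemma pairing_step f g i j : prim a b f g ->
  lam i j * pairing a b f (W ^+ j * (L i)^`(j)) =
  pairing a b g (W ^+ j.+1 * (L i)^`(j.+1)).
Proof.
move=> pf; have If : intgoo a b f := intgoo_ccont (prim_ccont pf).
rewrite /pairing -intooZ; last exact: intgoo_pairing.
rewrite (@eq_intoo _ _ _ _
  (fun x => - (f x * (W ^+ j.+1 * (L i)^`(j.+1))^`().[x]))); last first.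
  by move=> x _; rewrite legendre_sl mulNr hornerN (hornerM _%:P) hornerC; ring.
rewrite intooN; last exact: intgoo_pairing.
rewrite (intoo_parts (ltW ab) pf (prim_poly _ _ _)); last exact: ccont_poly.
have Wb : W.[b] = 0 by rewrite !hornerE subrr mulr0.
have Wa : W.[a] = 0 by rewrite !hornerE subrr mul0r.
by rewrite !hornerM !horner_exp Wa Wb !expr0n/= !mul0r !mulr0 subrr sub0r opprK.
Qed.

(** For s <= i this is (i + s)! / (i - s)!, the ratio of the squared norm of the s-th derivative of
    [legendre a b i], weighted by W^s, to the squared norm of [legendre a b i]. *)
Definition leg_eigprod i s := \prod_(j < s) lam i j.

Lemma pairing_chain (D : nat -> R -> R) s i :
  (forall j, (j < s)%N -> prim a b (D j) (D j.+1)) ->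
  pairing a b (D s) (W ^+ s * (L i)^`(s)) =
  leg_eigprod i s * pairing a b (D 0%N) (L i).
Proof.
elim: s => [|s IH] pD.
  by rewrite /leg_eigprod big_ord0 expr0 !mul1r.
rewrite -(pairing_step _ _ (pD s (ltnSn s))) IH; last first.
  by move=> j js; apply: pD; rewrite ltnS ltnW.
by rewrite /leg_eigprod big_ord_recr /= mulrA; congr (_ * _); rewrite mulrC.
Qed.

Lemma poly_chain q : forall j, prim a b (fun x => q^`(j).[x]) (fun x => q^`(j.+1).[x]).
Proof. by move=> j; rewrite derivnS; exact: prim_poly. Qed.

Lemma pairing_polyC (q1 q2 : {poly R}) :
  pairing a b (horner q1) q2 = pairing a b (horner q2) q1.
Proof. by apply: eq_intoo => x _; rewrite mulrC. Qed.

(** Self-adjointness: both eigenvalues, multiplied by the pairing, equal the integral of W (L i)' (L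
    k)', which is symmetric in i and k; and distinct indices have distinct eigenvalues. *)
Lemma legendre_orth i k : i != k -> pairing a b (horner (L i)) (L k) = 0.
Proof.
move=> ik; have H (m n : nat) : lam n 0 * pairing a b (horner (L m)) (L n) =
    intoo a b (fun x => (L m)^`().[x] * (W * (L n)^`()).[x]).
  have := pairing_step n 0 (prim_poly a b (L m)).
  by rewrite expr0 mul1r derivn0 expr1 derivn1.
have : lam k 0 * pairing a b (horner (L i)) (L k) =
       lam i 0 * pairing a b (horner (L i)) (L k).
  rewrite H pairing_polyC H; apply: eq_intoo => x _; rewrite !hornerM; ring.
move=> /eqP; rewrite -subr_eq0 -mulrBl mulf_eq0 => /orP[|/eqP //].
rewrite /leg_eig !subr0 !addr0.
have -> : (k%:R * (k%:R + 1) - i%:R * (i%:R + 1) : R) =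
   (k%:R - i%:R) * (k%:R + i%:R + 1) by ring.
rewrite mulf_eq0 subr_eq0 eqr_nat eq_sym (negbTE ik)/= -natrD natr1 pnatr_eq0.
by [].
Qed.

(** Should the denominator of [leg_coef] be 0, the pairing is 0 as well by Cauchy-Schwarz, so the
    default value of the division does no harm. *)
Lemma leg_coefE h i : L2oo a b h ->
  leg_coef a b h i * intoo a b (fun x => (L i).[x] ^+ 2) = pairing a b h (L i).
Proof.
move=> Lh; have LL : L2oo a b (horner (L i)) by exact/L2oo_ccont/ccont_poly.
rewrite /leg_coef; set g := intoo _ _ _.
have [g0|gn0] := eqVneq g 0; last by rewrite divfK.
have := cauchy_schwarz_oo Lh LL; rewrite -/g g0 !mulr0.
rewrite real_exprn_even_le0 ?num_real//= => /eqP.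
by rewrite /pairing => ->.
Qed.

Lemma pairing_leg_sum n (c : nat -> R) k :
  pairing a b (horner (\sum_(i < n) c i *: L i)) (L k) =
  (if (k < n)%N then c k else 0) * intoo a b (fun x => (L k).[x] ^+ 2).
Proof.
rewrite pairing_polyC pairing_sum; last exact/intgoo_ccont/ccont_poly.
case: ifPn => [kn|]; last first.
  rewrite -leqNgt mul0r => nk; rewrite big1// => i _.
  rewrite pairing_polyC legendre_orth ?mulr0//.
  by rewrite neq_ltn (leq_trans (ltn_ord i) nk).
rewrite (bigD1 (Ordinal kn))//= big1 ?addr0.
  by congr (_ * _); apply: eq_intoo => x _; rewrite expr2.
move=> i ik; rewrite pairing_polyC legendre_orth ?mulr0//.
Qed.

Lemma size_proj p h : (size (proj a b p h) <= p.+1)%N.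
Proof.
rewrite (leq_trans (size_sum _ _ _))//; apply/bigmax_leqP => i _.
by rewrite (leq_trans (size_scale_leq _ _))// (leq_trans (size_legendre i)).
Qed.

Lemma proj_orth p h q : L2oo a b h -> (size q <= p.+1)%N ->
  pairing a b (fun x => h x - (proj a b p h).[x]) q = 0.
Proof.
move=> Lh /legendre_span[c ->]; have Ih := L2oo_intgoo Lh.
have IP : intgoo a b (horner (proj a b p h)) by exact/intgoo_ccont/ccont_poly.
rewrite pairing_sum; last exact: intgooB.
rewrite big1// => i _.
rewrite {1}/pairing (@eq_intoo _ _ _ _ (fun x => h x * (L i).[x] -
   (proj a b p h).[x] * (L i).[x])); last by move=> x _; rewrite mulrBl.
rewrite intooB; try exact: intgoo_pairing.
have := pairing_leg_sum p.+1 (leg_coef a b h) i; rewrite ltn_ord leg_coefE//.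
by rewrite -/(proj a b p h) /pairing => ->; rewrite subrr mulr0.
Qed.

Lemma proj_pythagoras p h q : L2oo a b h -> (size q <= p.+1)%N ->
  intoo a b (fun x => (h x - q.[x]) ^+ 2) =
  proj_err a b p h + intoo a b (fun x => (proj a b p h - q).[x] ^+ 2).
Proof.
move=> Lh sq; rewrite proj_err.unlock; set P := proj a b p h.
have LP r : L2oo a b (horner r) by exact/L2oo_ccont/ccont_poly.
have Lhr : L2oo a b (fun x => h x - P.[x]) by exact: L2ooB.
rewrite (@eq_intoo _ _ _ _ (fun x => (h x - P.[x]) ^+ 2 +
   ((P - q).[x] ^+ 2 + 2 * ((h x - P.[x]) * (P - q).[x])))); last first.
  by move=> x _; rewrite hornerD hornerN; ring.
have I1 := Lhr.2; have I2 := (LP (P - q)).2; have I3 := L2ooM Lhr (LP (P - q)).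
rewrite intooD//; last by apply: intgooD => //; exact: intgooZ.
rewrite intooD//; last exact: intgooZ.
rewrite intooZ// -/(pairing a b (fun x => h x - P.[x]) (P - q)) proj_orth ?mulr0 ?addr0//.
rewrite (leq_trans (size_polyD _ _))// geq_max size_polyN sq size_proj//.
Qed.

Lemma proj_err_le p h q : L2oo a b h -> (size q <= p.+1)%N ->
  proj_err a b p h <= intoo a b (fun x => (h x - q.[x]) ^+ 2).
Proof. by move=> Lh /(proj_pythagoras Lh) ->; rewrite lerDl intoo_sqr_ge0. Qed.

Lemma proj_err_ge0 p h : 0 <= proj_err a b p h.
Proof. by rewrite proj_err.unlock; exact: intoo_sqr_ge0. Qed.

Lemma proj_err_le_norm p h : L2oo a b h ->
  proj_err a b p h <= intoo a b (fun x => h x ^+ 2).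
Proof.
move=> Lh; apply: le_trans (proj_err_le (q := 0) Lh _) _.
  by rewrite size_poly0.
by rewrite le_eqVlt; apply/orP; left; apply/eqP/eq_intoo => x _; rewrite horner0 subr0.
Qed.

Lemma intoo_leg_sum n (c : nat -> R) :
  intoo a b (fun x => (\sum_(i < n) c i *: L i).[x] ^+ 2) =
  \sum_(i < n) c i ^+ 2 * intoo a b (fun x => (L i).[x] ^+ 2).
Proof.
set S := \sum_(i < n) _.
have -> : intoo a b (fun x => S.[x] ^+ 2) = pairing a b (horner S) S.
  by apply: eq_intoo => x _; rewrite expr2.
rewrite {2}/S pairing_sum; last exact/intgoo_ccont/ccont_poly.
apply: eq_bigr => i _; rewrite /S pairing_leg_sum ltn_ord; ring.
Qed.

Lemma sum_ord_cut (V : zmodType) p M (F : nat -> V) : (p <= M)%N ->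
  \sum_(i < M.+1) (if (p < i)%N then F i else 0) = \sum_(p.+1 <= i < M.+1) F i.
Proof.
move=> pM; rewrite -(big_mkord xpredT (fun i => if (p < i)%N then F i else 0)).
rewrite (@big_cat_nat _ _ _ p.+1 0 M.+1)//= [X in X + _]big_nat_cond.
rewrite [X in X + _]big1 ?add0r; last first.
  by move=> i /andP[/andP[_ ip] _]; rewrite ltnNge -ltnS ip.
by rewrite !big_nat; apply: eq_bigr => i /andP[-> _].
Qed.

(* Parseval up to degree M. *)
Lemma proj_err_split p M h : L2oo a b h -> (p <= M)%N ->
  proj_err a b p h = proj_err a b M h +
    \sum_(p.+1 <= i < M.+1) leg_coef a b h i ^+ 2 *
      intoo a b (fun x => (L i).[x] ^+ 2).
Proof.
move=> Lh pM; rewrite {1}proj_err.unlock (@proj_pythagoras M) //; last first.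
  by rewrite (leq_trans (size_proj p h)).
congr (_ + _).
pose c i := if (p < i)%N then leg_coef a b h i else 0.
have -> : proj a b M h - proj a b p h = \sum_(i < M.+1) c i *: L i.
  rewrite /proj -!(big_mkord xpredT (fun i => leg_coef a b h i *: L i)).
  rewrite (@big_cat_nat _ _ _ p.+1 0 M.+1)//= addrAC subrr add0r.
  rewrite -(sum_ord_cut _ pM); apply: eq_bigr => i _.
  by rewrite /c; case: ifP; rewrite ?scale0r.
rewrite intoo_leg_sum -(sum_ord_cut _ pM); apply: eq_bigr => i _.
by rewrite /c; case: ifP; rewrite ?expr0n ?mul0r.
Qed.

Lemma bubble_bound x : a <= x <= b -> 0 <= W.[x] <= ((b - a) / 2) ^+ 2.
Proof.
move=> /andP[ax xb]; rewrite !hornerE; apply/andP; split.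
  by rewrite mulr_ge0// subr_ge0.
have H : ((b - a) / 2) ^+ 2 - (x - a) * (b - x) = ((a + b) / 2 - x) ^+ 2 by field.
by rewrite -subr_ge0 H sqr_ge0.
Qed.

(* Bessel's inequality for D s in the space weighted by W^s. *)
Lemma weighted_bessel (D : nat -> R -> R) s n (c : nat -> R) :
  (forall j, (j < s)%N -> prim a b (D j) (D j.+1)) -> L2oo a b (D s) ->
  L2oo a b (D 0%N) ->
  (forall i, (i < n)%N -> c i = 0 \/ c i = leg_coef a b (D 0%N) i) ->
  \sum_(i < n) leg_eigprod i s *
     (c i ^+ 2 * intoo a b (fun x => (L i).[x] ^+ 2)) <=
  ((b - a) / 2) ^+ (2 * s) * intoo a b (fun x => D s x ^+ 2).
Proof.
move=> pD Ls L0 Hc.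
pose S := \sum_(i < n) c i *: L i.
have LP r : L2oo a b (horner r) by exact/L2oo_ccont/ccont_poly.
have Is := L2oo_intgoo Ls.
have SE : W ^+ s * S^`(s) = \sum_(i < n) c i *: (W ^+ s * (L i)^`(s)).
  rewrite /S raddf_sum mulr_sumr.
  by apply: eq_bigr => i _; rewrite /= derivnZ scalerAr.
(* The partial sum S gives the same value here as [D s] does in [PD]: for S by orthogonality, for
   [D s] because each c i is either 0 or the coefficient of [D 0]. Allowing c i = 0 lets the low
   modes be dropped later. *)
have PS : pairing a b (horner S^`(s)) (W ^+ s * S^`(s)) =
    \sum_(i < n) leg_eigprod i s *
     (c i ^+ 2 * intoo a b (fun x => (L i).[x] ^+ 2)).
  rewrite SE pairing_sum; last exact: L2oo_intgoo.
  apply: eq_bigr => i _.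
  rewrite (pairing_chain (D := fun j x => S^`(j).[x])); last by move=> j _; exact: poly_chain.
  by rewrite derivn0 /S pairing_leg_sum ltn_ord; ring.
have PD : pairing a b (D s) (W ^+ s * S^`(s)) =
    \sum_(i < n) leg_eigprod i s *
     (c i ^+ 2 * intoo a b (fun x => (L i).[x] ^+ 2)).
  rewrite SE pairing_sum//; apply: eq_bigr => i _.
  rewrite pairing_chain// -leg_coefE//.
  by case: (Hc i (ltn_ord i)) => ->; ring.
have Iw : intgoo a b (fun x => D s x ^+ 2 * (W ^+ s).[x]) by exact: intgoo_pairing Ls.2.
have I1 := intgoo_pairing (W ^+ s * S^`(s)) Is.
have I2 := intgoo_pairing (W ^+ s * S^`(s)) (L2oo_intgoo (LP S^`(s))).
have Wx x : a < x < b -> 0 <= (W ^+ s).[x] <= ((b - a) / 2) ^+ (2 * s).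
  move=> /andP[ax xb]; have /andP[W0 W1] := @bubble_bound x (introT andP (conj (ltW ax) (ltW xb))).
  by rewrite horner_exp exprn_ge0//= exprM lerXn2r// nnegrE// sqr_ge0.
(* Expanded with [PS] and [PD], this weighted square is the weighted norm of [D s] minus the Bessel
   sum. *)
have : 0 <= intoo a b (fun x => (W ^+ s).[x] * (D s x - S^`(s).[x]) ^+ 2).
  by apply: intoo_ge0 => x /Wx /andP[W0 _]; rewrite mulr_ge0// sqr_ge0.
rewrite (@eq_intoo _ _ _ _ (fun x => D s x ^+ 2 * (W ^+ s).[x] +
   ((S^`(s)).[x] * (W ^+ s * S^`(s)).[x] - 2 * (D s x * (W ^+ s * S^`(s)).[x])))); last first.
  by move=> x _; rewrite hornerM; ring.
rewrite intooD//; last by apply: intgooB => //; exact: intgooZ.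
rewrite intooB//; last exact: intgooZ.
rewrite intooZ// -/(pairing a b (D s) _) -/(pairing a b (horner _) _) PS PD.
set Sg := \sum_(i < n) _ => H.
apply: (@le_trans _ _ (intoo a b (fun x => D s x ^+ 2 * (W ^+ s).[x]))); first lra.
rewrite -intooZ; last exact: Ls.2.
apply: le_intoo => //; first exact/intgooZ/Ls.2.
by move=> x /Wx /andP[_ W1]; rewrite mulrC ler_wpM2r// sqr_ge0.
Qed.

Lemma leg_eigprod_mono i k s : (s <= i)%N -> (i <= k)%N ->
  0 < leg_eigprod i s <= leg_eigprod k s.
Proof.
move=> si ik; rewrite /leg_eigprod.
have pos j : (j < s)%N -> 0 < lam i j.
  move=> js; rewrite /leg_eig mulr_gt0 ?subr_gt0 ?ltr_nat ?(leq_trans js)//.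
apply/andP; split; first by apply: prodr_gt0 => j _; exact: pos.
apply: ler_prod => j _; rewrite ltW ?pos//= /leg_eig ler_pM//.
- by rewrite subr_ge0 ler_nat ltnW// (leq_trans (ltn_ord j)).
- by rewrite lerB// ler_nat.
- by rewrite !lerD// ler_nat.
Qed.

Lemma leg_eigprod_gt0 i s : (s <= i)%N -> 0 < leg_eigprod i s.
Proof. by move=> si; have /andP[] := leg_eigprod_mono si (leqnn i). Qed.

(** The left side collects the modes p < i <= M, on which [leg_eigprod i s] is at least
    [leg_eigprod p.+1 s], so the weighted Bessel sum dominates it. *)
Lemma proj_err_bessel p M s (D : nat -> R -> R) : (s <= p.+1)%N -> (p <= M)%N ->
  (forall j, (j < s)%N -> prim a b (D j) (D j.+1)) -> L2oo a b (D s) ->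
  L2oo a b (D 0%N) ->
  leg_eigprod p.+1 s * (proj_err a b p (D 0%N) - proj_err a b M (D 0%N)) <=
  ((b - a) / 2) ^+ (2 * s) * intoo a b (fun x => D s x ^+ 2).
Proof.
move=> sp pM pD Ls L0; rewrite (proj_err_split L0 pM) addrC addKr.
pose c i := if (p < i)%N then leg_coef a b (D 0%N) i else 0.
have := @weighted_bessel D s M.+1 c pD Ls L0.
have Hc i : (i < M.+1)%N -> c i = 0 \/ c i = leg_coef a b (D 0%N) i.
  by move=> _; rewrite /c; case: ifP; [right|left].
move=> /(_ Hc); apply: le_trans.
rewrite mulr_sumr -(sum_ord_cut _ pM); apply: ler_sum => i _.
rewrite /c; case: ifP => [pi|_]; last by rewrite expr0n mul0r mulr0.
apply: ler_wpM2r; first by rewrite mulr_ge0 ?sqr_ge0 ?intoo_sqr_ge0.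
by have /andP[] := leg_eigprod_mono sp pi.
Qed.

End Legendre.

(** * Bernstein approximation *)

(* Bernstein operator: expectation of g at the number of successes in n
   independent trials of probability Y, as a polynomial in Y. *)
Fixpoint bern (R : nzRingType) (Y : {poly R}) (n : nat) (g : nat -> R) : {poly R} :=
  if n is m.+1 then Y * bern Y m (fun k => g k.+1) + (1 - Y) * bern Y m g
  else (g 0%N)%:P.

Section Bernstein.
Context {R : realType}.
Implicit Types (Y : {poly R}) (g : nat -> R) (x y : R).

Lemma bernS Y n g x : (bern Y n.+1 g).[x] =
  Y.[x] * (bern Y n (fun k => g k.+1)).[x] + (1 - Y.[x]) * (bern Y n g).[x].
Proof. by rewrite /= hornerD !hornerM hornerD hornerN -polyC1 hornerC. Qed.

Lemma bern_le Y n g g' x : 0 <= Y.[x] <= 1 ->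
  (forall k, (k <= n)%N -> g k <= g' k) -> (bern Y n g).[x] <= (bern Y n g').[x].
Proof.
move=> /andP[Y0 Y1]; elim: n g g' => [|n IH] g g' H.
  by rewrite /= !hornerC H.
rewrite !bernS; apply: lerD; apply: ler_wpM2l; rewrite ?subr_ge0//.
  by apply: IH => k kn; apply: H.
by apply: IH => k kn; apply: H; rewrite ltnW.
Qed.

Lemma bern_lin Y n (c d e : R) g g' x :
  (bern Y n (fun k => c + d * g k + e * g' k)).[x] =
  c + d * (bern Y n g).[x] + e * (bern Y n g').[x].
Proof.
elim: n g g' => [|n IH] g g'; first by rewrite /= !hornerC.
by rewrite !bernS !IH; ring.
Qed.

(** Jensen's inequality: the expectation of (g - m)^2, with m the mean of g, is nonnegative. *)
Lemma bern_sqr_le Y n g x : 0 <= Y.[x] <= 1 ->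
  (bern Y n g).[x] ^+ 2 <= (bern Y n (fun k => g k ^+ 2)).[x].
Proof.
move=> Yx; set m := (bern Y n g).[x].
have := @bern_le Y n (fun=> 0) (fun k => (g k - m) ^+ 2) x Yx.
move=> /(_ (fun k _ => sqr_ge0 _)).
have -> : (fun k => (g k - m) ^+ 2) = (fun k => m ^+ 2 + (- 2 * m) * g k + 1 * g k ^+ 2).
  by apply/funext => k; ring.
rewrite bern_lin -/m.
have -> : (bern Y n (fun=> 0)).[x] = 0.
  have := bern_lin Y n 0 0 0 (fun=> 0) (fun=> 0) x.
  rewrite (_ : (fun k : nat => 0 + 0 * 0 + 0 * 0 : R) = fun=> 0); last first.
    by apply/funext => k; ring.
  by move=> ->; ring.
nra.
Qed.

(** The centre c is arbitrary for the sake of the induction: after one success it is replaced by c -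
    1. *)
Lemma bern_variance Y n x (c : R) :
  (bern Y n (fun k => (k%:R - c) ^+ 2)).[x] =
  (n%:R * Y.[x] - c) ^+ 2 + n%:R * (Y.[x] * (1 - Y.[x])).
Proof.
elim: n c => [|n IH] c; first by rewrite /= hornerC; ring.
rewrite bernS IH.
have -> : (fun k : nat => (k.+1%:R - c) ^+ 2) = (fun k => (k%:R - (c - 1)) ^+ 2).
  by apply/funext => k; rewrite -natr1; congr (_ ^+ 2); ring.
by rewrite IH -natr1; ring.
Qed.

End Bernstein.

(** * Density of polynomials and the decay of projection errors *)

Section Approximation.
Context {R : realType}.
Variables a b : R.
Hypothesis ab : a < b.
Implicit Types (p : nat) (q : {poly R}) (h f g : R -> R).

Lemma prim_hoelder f g x y : prim a b f g -> L2oo a b g ->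
  a <= x <= b -> a <= y <= b ->
  (f x - f y) ^+ 2 <= intoo a b (fun t => g t ^+ 2) * `|x - y|.
Proof.
move=> pf Lg; wlog xy : x y / x <= y.
  move=> H xab yab; have [xy|yx] := leP x y; first exact: H.
  by rewrite -sqrrN opprB distrC; apply: H => //; exact: ltW.
move=> /andP[ax _] /andP[_ yb].
rewrite -sqrrN opprB (proj2 pf)//.
have Lxy := L2ooS ax yb Lg.
have L1 : L2oo x y (fun=> 1) by exact/L2oo_ccont/ccont_cst.
rewrite (@eq_intoo _ _ _ _ (fun t => g t * 1)); last by move=> t _; rewrite mulr1.
apply: le_trans (cauchy_schwarz_oo Lxy L1) _.
rewrite (_ : intoo x y (fun=> 1 ^+ 2) = `|x - y|); last first.
  by rewrite intoo_cst// expr1n mul1r ler0_norm ?subr_le0// opprB.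
apply: ler_wpM2r => //.
have Ig2 := Lg.2.
rewrite (intoo_split ax (le_trans xy yb) Ig2).
rewrite (intoo_split xy yb (intgooS ax (lexx b) Ig2)).
by rewrite addrCA lerDl addr_ge0// intoo_sqr_ge0.
Qed.

(* f is Hoelder-1/2 continuous, so its Bernstein polynomials converge
   uniformly. *)
Lemma prim_poly_approx f g e : prim a b f g -> L2oo a b g -> 0 < e ->
  exists q, forall x, a < x < b -> (f x - q.[x]) ^+ 2 <= e.
Proof.
move=> pf Lg e0; pose K := intoo a b (fun t => g t ^+ 2).
have K0 : 0 <= K by exact: intoo_sqr_ge0.
have l0 : 0 < b - a by rewrite subr_gt0.
(* The final bound is K d, hence at most e. The number n of trials, chosen next, makes (b - a)^2 / n
   at most d^2, which brings the variance term below d / 2. *)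
pose d := e / (2 * (K + 1)).
have K1 : 0 < K + 1 by rewrite ltr_wpDl.
have d0 : 0 < d by rewrite divr_gt0// mulr_gt0.
have dK : d * (2 * (K + 1)) = e by rewrite /d divfK// gt_eqF// mulr_gt0.
clearbody d.
pose n := (Num.truncn ((b - a) ^+ 2 / d ^+ 2)).+1.
have n0 : 0 < n%:R :> R by rewrite ltr0n.
have nd : (b - a) ^+ 2 <= n%:R * d ^+ 2.
  by rewrite -ler_pdivrMr ?exprn_gt0// ltW// truncnS_gt.
clearbody n.
pose Y : {poly R} := (b - a)^-1 *: ('X - a%:P).
pose t (k : nat) := a + (b - a) * (k%:R / n%:R).
exists (bern Y n (fun k => f (t k))) => x /andP[ax xb].
have YE : Y.[x] = (x - a) / (b - a) by rewrite hornerZ !hornerE mulrC.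
have Y01 : 0 <= Y.[x] <= 1.
  rewrite YE; apply/andP; split; first by rewrite divr_ge0 ?subr_ge0// ltW.
  by rewrite ler_pdivrMr// mul1r lerB// ltW.
have -> : f x - (bern Y n (fun k => f (t k))).[x] =
    (bern Y n (fun k => f x - f (t k))).[x].
  have := bern_lin Y n (f x) (-1) 0 (fun k => f (t k)) (fun=> 0) x.
  rewrite [X in _ = _ + X]mul0r [RHS]addr0 mulN1r => <-; congr (_.[x]); congr bern.
  by apply/funext => k; ring.
apply: le_trans (bern_sqr_le _ _ Y01) _.
have tab k : (k <= n)%N -> a <= t k <= b.
  move=> kn; rewrite /t lerDl mulr_ge0 ?(ltW l0)//=.
  by rewrite -lerBrDl ler_piMr ?(ltW l0)// ler_pdivrMr// mul1r ler_nat.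
pose c := n%:R * Y.[x].
have xt k : x - t k = (b - a) / n%:R * (c - k%:R).
  rewrite /t /c YE; field; rewrite !gt_eqF//.
(* The Hoelder bound is K |x - t k|, and z <= d / 2 + z^2 / (2 d) replaces the distance by a square,
   whose expectation is the variance. The term 0 * 0 only gives the majorant the shape required by
   [bern_lin]. *)
apply: (@le_trans _ _ (bern Y n (fun k => K * d / 2 +
     (K / (2 * d)) * ((b - a) / n%:R) ^+ 2 * (k%:R - c) ^+ 2 + 0 * 0)).[x]).
  apply: bern_le => // k kn; rewrite mulr0 addr0.
  have xab : a <= x <= b by rewrite !ltW.
  apply: le_trans (prim_hoelder pf Lg xab (tab k kn)) _.
  rewrite -/K.
  have -> : K * d / 2 + K / (2 * d) * ((b - a) / n%:R) ^+ 2 * (k%:R - c) ^+ 2 =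
      K * (d / 2 + `|x - t k| ^+ 2 / (2 * d)).
    rewrite real_normK ?num_real// xt; field; rewrite !gt_eqF//.
  apply: ler_wpM2l => //; set z := `|x - t k|.
  have -> : d / 2 + z ^+ 2 / (2 * d) = z + (z - d) ^+ 2 / (2 * d).
    by field; rewrite gt_eqF.
  by rewrite lerDl divr_ge0 ?sqr_ge0// mulr_ge0// ltW.
rewrite bern_lin mul0r addr0 bern_variance -/c subrr expr0n add0r.
have Y4 : Y.[x] * (1 - Y.[x]) <= 1 by case/andP: Y01 => *; nra.
have Y40 : 0 <= Y.[x] * (1 - Y.[x]) by case/andP: Y01 => *; rewrite mulr_ge0// subr_ge0.
have -> : K * d / 2 + K / (2 * d) * ((b - a) / n%:R) ^+ 2 * (n%:R * (Y.[x] * (1 - Y.[x]))) =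
  K * (d / 2 + (b - a) ^+ 2 * (Y.[x] * (1 - Y.[x])) / (2 * d * n%:R)).
  by field; rewrite !gt_eqF.
apply: (@le_trans _ _ (K * d)).
  apply: ler_wpM2l => //.
  have : (b - a) ^+ 2 * (Y.[x] * (1 - Y.[x])) / (2 * d * n%:R) <= d / 2; last lra.
  rewrite ler_pdivrMr ?mulr_gt0//.
  have -> : d / 2 * (2 * d * n%:R) = n%:R * d ^+ 2 by field.
  by apply: le_trans nd; rewrite ler_piMr// sqr_ge0.
by rewrite -dK; nra.
Qed.

Lemma proj_err_cvg f g e : prim a b f g -> L2oo a b g -> 0 < e ->
  exists M0, forall M, (M0 <= M)%N -> proj_err a b M f <= e.
Proof.
move=> pf Lg e0; have l0 : 0 < b - a by rewrite subr_gt0.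
have [q Hq] := prim_poly_approx pf Lg (divr_gt0 e0 l0).
have Lf : L2oo a b f by exact: (L2oo_ccont (prim_ccont pf)).
exists (size q) => M sM; apply: le_trans (proj_err_le ab Lf _) _; first exact: leq_trans sM _.
rewrite -[leRHS](@divfK _ (b - a)) ?gt_eqF// -(intoo_cst _ (ltW ab)).
apply: le_intoo => //; last exact: intgoo_cst.
by apply: (L2ooB Lf _).2; exact/L2oo_ccont/ccont_poly.
Qed.

(** The error at degree M left over by the finite Bessel inequality is made arbitrarily small. This
    convergence uses that [D 0] is a primitive of an L2 function, so s = 0 is treated apart, by
    contractivity of the projection. *)
Lemma proj_err_bound p s (D : nat -> R -> R) : (s <= p.+1)%N ->
  (forall j, (j < s)%N -> prim a b (D j) (D j.+1)) ->
  (forall j, (j <= s)%N -> L2oo a b (D j)) ->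
  leg_eigprod p.+1 s * proj_err a b p (D 0%N) <=
  ((b - a) / 2) ^+ (2 * s) * intoo a b (fun x => D s x ^+ 2).
Proof.
case: s => [|s] sp pD LD.
  rewrite muln0 expr0 mul1r /leg_eigprod big_ord0 mul1r.
  exact: (proj_err_le_norm ab p (LD 0%N isT)).
have E0 := @leg_eigprod_gt0 R _ _ sp.
apply/ler_addgt0Pl => e e0.
have [M0 HM] := proj_err_cvg (pD 0%N isT) (LD 1%N isT) (divr_gt0 e0 E0).
have := @proj_err_bessel R a b ab p (maxn M0 p) s.+1 D sp (leq_maxr _ _) pD
  (LD _ (leqnn _)) (LD 0%N isT).
have := HM _ (leq_maxl M0 p); rewrite ler_pdivlMr// mulrC mulrBr; lra.
Qed.

End Approximation.

(** * The error on one subinterval *)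

(** Substituting the bound on Z gives (1 - c k) Y <= y + 4 L2 N, and 1 / (1 - c k) <= 1 + 2 c k
    because c k <= 1/2. *)
Lemma energy_arith (R : realType) (k L2 N Y Z y : R) (c := 2 + 4 * L2) :
  0 <= k -> 0 <= L2 -> c * k <= 2^-1 -> 0 <= N -> 0 <= y -> 0 <= Y ->
  Y <= y + 2 * k * Y + Z -> Z <= 4 * L2 * (N + k * Y) ->
  Y <= (1 + 2 * c * k) * (y + 4 * L2 * N).
Proof.
move=> k0 L20 ck N0 y0 Y0 YZ ZY.
have Hc : (1 - c * k) * Y <= y + 4 * L2 * N by rewrite /c; lra.
have c0 : 0 <= c * k by rewrite mulr_ge0// /c addr_ge0// mulr_ge0.
have A0 : 0 <= y + 4 * L2 * N by rewrite addr_ge0// !mulr_ge0.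
move: Hc A0; set A := y + _; rewrite -mulrA; clearbody A.
move: ck c0; set d := c * k; clearbody d => ck c0 Hc A0; clear - ck c0 Hc A0 Y0.
have H1 : (1 + 2 * d) * ((1 - d) * Y) <= (1 + 2 * d) * A.
  by apply: ler_wpM2l => //; lra.
have H2 : 0 <= d * (1 - 2 * d) * Y by rewrite !mulr_ge0//; lra.
lra.
Qed.

Section LocalError.
Context {R : realType}.
Variables a b : R.
Hypothesis ab : a < b.
Implicit Types (q P : {poly R}) (f g h : R -> R).

Lemma poly_antiderivative q : exists2 Q, Q^`() = q & (size Q <= (size q).+1)%N.
Proof.
exists (\poly_(i < (size q).+1) (q`_i.-1 / i%:R)); last exact: size_poly.
apply/polyP => i; rewrite coef_deriv coef_poly ltnS /=.
case: ltnP => iq; last by rewrite mul0rn nth_default.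
by rewrite -[LHS]mulr_natr divfK// pnatr_eq0.
Qed.

Lemma intoo_sqrD f g : L2oo a b f -> L2oo a b g ->
  intoo a b (fun x => (f x + g x) ^+ 2) <=
  2 * (intoo a b (fun x => f x ^+ 2) + intoo a b (fun x => g x ^+ 2)).
Proof.
move=> Lf Lg; have [I1 I2] := (Lf.2, Lg.2).
rewrite -intooD// -intooZ; last exact: intgooD.
apply: le_intoo; [exact: (L2ooD Lf Lg).2|exact/intgooZ/intgooD|].
by move=> x _; have := sqr_ge0 (f x - g x); nra.
Qed.

Lemma proj_ortho0 p h :
  (forall i, (i <= p)%N -> pairing a b h (legendre a b i) = 0) ->
  proj a b p h = 0.
Proof.
move=> H; rewrite /proj big1// => i _.
by rewrite /leg_coef H ?mul0r ?scale0r// -ltnS.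
Qed.

(* If g is orthogonal to all polynomials of degree p+1 then its primitive is
   orthogonal to all polynomials of degree p, and so gains a factor k/p. *)
Lemma ortho_primitive_bound p G g : L2oo a b g -> prim a b G g ->
  G a = 0 -> G b = 0 ->
  (forall q, (size q <= p.+2)%N -> pairing a b g q = 0) ->
  leg_eigprod p.+1 1 * intoo a b (fun x => G x ^+ 2) <=
  ((b - a) / 2) ^+ 2 * intoo a b (fun x => g x ^+ 2).
Proof.
move=> Lg pG Ga Gb H.
have LG : L2oo a b G := L2oo_ccont (prim_ccont pG).
pose D (j : nat) := if j is 0%N then G else g.
have := @proj_err_bound R a b ab p 1 D isT.
move=> /(_ _ _)/wrap[]; first by case.
  by case=> [|[]].
rewrite /= muln1 => Hb; apply: le_trans Hb.
(* The projection of G is 0: against [legendre a b i], integrate by parts with an antiderivative of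
   degree i + 1 <= p + 1, to which g is orthogonal. *)
rewrite proj_err.unlock proj_ortho0; last first.
  move=> i ip; have [Q QE sQ] := poly_antiderivative (legendre a b i).
  rewrite /pairing -QE (intoo_parts (ltW ab) pG (prim_poly _ _ _)); last exact: ccont_poly.
  rewrite Ga Gb !mul0r subrr sub0r [X in - X](_ : _ = pairing a b g Q)// H ?oppr0//.
  by rewrite (leq_trans sQ)// ltnS (leq_trans (size_legendre _ _ _)).
by rewrite le_eqVlt; apply/orP; left; apply/eqP; congr (_ * _);
  apply: eq_intoo => x _; rewrite horner0 subr0.
Qed.

Lemma prim_poincare G g : L2oo a b g -> prim a b G g -> G a = 0 ->
  intoo a b (fun x => G x ^+ 2) <= (b - a) ^+ 2 * intoo a b (fun x => g x ^+ 2).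
Proof.
move=> Lg pG Ga; set A := intoo a b (fun x => g x ^+ 2).
have -> : (b - a) ^+ 2 * A = A * (b - a) * (b - a) by ring.
rewrite -(intoo_cst _ (ltW ab)); apply: le_intoo.
- exact: (L2oo_ccont (prim_ccont pG)).2.
- exact: intgoo_cst.
- move=> x /andP[ax xb].
  have := prim_hoelder pG Lg (x := x) (y := a).
  rewrite !(ltW ax) !lexx !(ltW xb) (ltW ab) => /(_ isT isT).
  rewrite Ga subr0 => /le_trans; apply; rewrite -/A.
  apply: ler_wpM2l; first exact: intoo_sqr_ge0.
  by rewrite gtr0_norm ?subr_gt0// lerB// ltW.
Qed.

Variables (L : R) (r : nat).
Hypotheses (L0 : 0 < L) (r3 : (3 <= r)%N).
Variables (u u' F G : R -> R) (q : {poly R}).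
Hypotheses (pu : prim a b u u') (pu' : prim a b u' F) (cF : ccont a b F)
  (cG : ccont a b G) (sq : (size q <= r.+1)%N).
Hypothesis galerkin : forall phi : {poly R}, (size phi <= r.-1)%N ->
  pairing a b (fun x => q^`()^`().[x] - G x) phi = 0.
Hypothesis lip : forall x, a < x < b ->
  `|F x - G x| <= L * (`|u x - q.[x]| + `|u' x - q^`().[x]|).

(** Y is the maximum of xi^2 + xi'^2 over [a, b], and N bounds the sum of the squared norms of eta
    and eta'. A pointwise maximum serves twice: it controls the nodal values handed to the next
    subinterval, and it bounds the squared norms of xi and xi' by k Y, whose factor k permits
    absorption. *)
Lemma local_error (e := fun x => u x - q.[x]) (e' := fun x => u' x - q^`().[x])
  (k := b - a) (c := 2 + 4 * L ^+ 2) (H := proj_err a b (r - 2) F)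
  (N := 2 * (k / 2) ^+ 2 / ((r%:R - 1) * (r%:R - 2)) * H) :
  k <= 1 -> c * k <= 2^-1 ->
  exists Y, [/\ 0 <= Y,
    Y <= (1 + 2 * c * k) * (e a ^+ 2 + e' a ^+ 2 + 4 * L ^+ 2 * N),
    e b ^+ 2 + e' b ^+ 2 <= Y,
    intoo a b (fun x => e x ^+ 2) + intoo a b (fun x => e' x ^+ 2) <=
      2 * N + 2 * k * Y &
    intoo a b (fun x => (F x - q^`()^`().[x]) ^+ 2) <=
      2 * H + 8 * L ^+ 2 * (N + k * Y)].
Proof.
move=> k1 ck; pose P := proj a b (r - 2) F.
have k0 : 0 < k by rewrite subr_gt0.
have r2E : (r - 2).+1 = r.-1 by case: (r) r3 => [|[|n]] //; rewrite subn2.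
have LF : L2oo a b F by exact: L2oo_ccont.
have LG : L2oo a b G by exact: L2oo_ccont.
have LP (p : {poly R}) : L2oo a b (horner p) by exact/L2oo_ccont/ccont_poly.
pose h x := F x - P.[x].
have ch : ccont a b h by exact/ccontB/ccont_poly.
have Lh : L2oo a b h by exact: L2oo_ccont.
have h_orth (p : {poly R}) : (size p <= r.-1)%N -> pairing a b h p = 0.
  by move=> sp; apply: proj_orth => //; rewrite r2E.
pose eta' x := intoo a x h; pose eta x := intoo a x eta'.
have peta' : prim a b eta' h by exact/prim_intoo/L2oo_intgoo.
have ceta' := prim_ccont peta'.
have peta : prim a b eta eta' by exact/prim_intoo/intgoo_ccont.
have ceta := prim_ccont peta.
have [Leta Leta'] := (L2oo_ccont ceta, L2oo_ccont ceta').
have eta'a : eta' a = 0 by exact: intoo_itvxx.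
have etaa : eta a = 0 by exact: intoo_itvxx.
have eta'b : eta' b = 0.
  have := h_orth 1; rewrite size_poly1 => /(_ _)/wrap[]; first by case: (r) r3 => [|[|]].
  by rewrite /pairing => <-; apply: eq_intoo => x _; rewrite -polyC1 hornerC mulr1.
(* The first moment of h vanishes since X has degree 1 <= r - 2. *)
have etab : eta b = 0.
  have := intoo_parts (ltW ab) peta' (prim_poly a b 'X) (@ccont_poly R a b _).
  rewrite eta'b eta'a !mul0r subrr sub0r.
  have -> : intoo a b (fun x => h x * 'X.[x]) = 0.
    apply: h_orth; rewrite size_polyX; by case: (r) r3 => [|[|[|]]].
  rewrite oppr0 => <-; apply: eq_intoo => x _.
  by rewrite derivX -polyC1 hornerC mulr1.
pose xi x := e x - eta x; pose xi' x := e' x - eta' x.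
pose z := P - q^`()^`().
have pxi : prim a b xi xi' by apply: primB => //; exact/primB/prim_poly.
have pxi' : prim a b xi' (horner z).
  apply: eq_prim (primB (primB pu' (prim_poly a b q^`())) peta') => // x _.
  by rewrite /h /z hornerD hornerN; ring.
have [cxi cxi'] := (prim_ccont pxi, prim_ccont pxi').
have [Lxi Lxi'] := (L2oo_ccont cxi, L2oo_ccont cxi').
pose Z := intoo a b (fun x => z.[x] ^+ 2).
pose S := intoo a b (fun x => (F x - G x) ^+ 2).
have sz : (size z <= r.-1)%N.
  rewrite (leq_trans (size_polyD _ _))// geq_max size_polyN; apply/andP; split.
    by rewrite -r2E size_proj.
  apply/leq_sizeP => j rj; rewrite !coef_deriv nth_default ?mul0rn//.
  by rewrite (leq_trans sq)//; move: rj r3; case: (r) => [|[|n]].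
(* Subtracting from F - G both h and q'' - G leaves z. Both are orthogonal to z, so the square of z
   integrates to the pairing of F - G with z: z is a projection of F - G. *)
have ZS : Z <= S.
  have Z1 : Z = intoo a b (fun x => (F x - G x) * z.[x]).
    have E1 := h_orth z sz; have E2 := galerkin sz.
    have I1 := L2ooM (L2ooB LF LG) (LP z).
    have I2 := L2ooM (L2ooB (LP q^`()^`()) LG) (LP z).
    have I3 := L2ooM Lh (LP z).
    rewrite -[RHS]subr0 -E1 -[RHS]subr0 -[X in _ - _ - X]E2 /pairing.
    rewrite -intooB// -intooB//; last exact: intgooB.
    by apply: eq_intoo => x _; rewrite /h {1 2}/z hornerD hornerN; ring.
  have := intoo_sqr_ge0 a b (fun x => (F x - G x) - z.[x]).
  rewrite (@eq_intoo _ _ _ _ (fun x => (F x - G x) ^+ 2 +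
     (z.[x] ^+ 2 - 2 * ((F x - G x) * z.[x])))); last by move=> x _; ring.
  have I1 := (L2ooB LF LG).2; have I2 := (LP z).2.
  have I3 := L2ooM (L2ooB LF LG) (LP z).
  rewrite intooD//; last by apply: intgooB => //; exact: intgooZ.
  rewrite intooB//; last exact: intgooZ.
  by rewrite intooZ// -Z1 -/Z -/S; lra.
pose E0 := intoo a b (fun x => eta x ^+ 2); pose E1 := intoo a b (fun x => eta' x ^+ 2).
pose X0 := intoo a b (fun x => xi x ^+ 2); pose X1 := intoo a b (fun x => xi' x ^+ 2).
have Le : intoo a b (fun x => e x ^+ 2) <= 2 * (E0 + X0).
  apply: le_trans (intoo_sqrD Leta Lxi); rewrite le_eqVlt; apply/orP; left.
  by apply/eqP/eq_intoo => x _; rewrite /xi addrC subrK.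
have Le' : intoo a b (fun x => e' x ^+ 2) <= 2 * (E1 + X1).
  apply: le_trans (intoo_sqrD Leta' Lxi'); rewrite le_eqVlt; apply/orP; left.
  by apply/eqP/eq_intoo => x _; rewrite /xi' addrC subrK.
have L2e : L2oo a b e.
  by apply: L2oo_ccont; apply: ccontB; [exact: prim_ccont pu|exact: ccont_poly].
have L2e' : L2oo a b e'.
  by apply: L2oo_ccont; apply: ccontB; [exact: prim_ccont pu'|exact: ccont_poly].
(* The factor 4 is 2 from squaring |e| + |e'|, times 2 from e = eta + xi and e' = eta' + xi'. *)
have Sle : S <= 4 * L ^+ 2 * (E0 + E1 + X0 + X1).
  apply: (@le_trans _ _ (2 * L ^+ 2 * (intoo a b (fun x => e x ^+ 2) +
      intoo a b (fun x => e' x ^+ 2)))); last by have := sqr_ge0 L; nra.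
  have [Ie Ie'] := (L2e.2, L2e'.2).
  rewrite -intooD// -intooZ; last exact: intgooD.
  apply: le_intoo; [exact: (L2ooB LF LG).2|exact/intgooZ/intgooD|].
  move=> x xab; have := lip xab; rewrite -/(e x) -/(e' x) => Hx.
  rewrite -(real_normK (num_real (F x - G x))).
  rewrite -(real_normK (num_real (e x))) -(real_normK (num_real (e' x))).
  apply: (@le_trans _ _ ((L * (`|e x| + `|e' x|)) ^+ 2)).
    by rewrite lerXn2r// nnegrE// mulr_ge0 ?addr_ge0// ltW.
  rewrite exprMn [2 * L ^+ 2]mulrC -[leRHS]mulrA; apply: ler_wpM2l; first exact: sqr_ge0.
  by have := sqr_ge0 (`|e x| - `|e' x|); nra.
have H0 : 0 <= H by exact: proj_err_ge0.
have HE : H = intoo a b (fun x => h x ^+ 2) by rewrite /H proj_err.unlock.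
have r1 : 1 <= r%:R - 2 :> R.
  have : 3 <= r%:R :> R by rewrite (ler_nat R 3 r).
  lra.
have rr0 : 0 < (r%:R - 1) * (r%:R - 2) :> R by nra.
(* Here h is orthogonal to degree r - 2, so p = r - 3, and the eigenvalue is (r - 2) (r - 1). *)
have E1H : E1 <= (k / 2) ^+ 2 / ((r%:R - 1) * (r%:R - 2)) * H.
  rewrite HE mulrAC ler_pdivlMr// mulrC.
  have r3E : r = (r - 3).+3 by rewrite -addn3 subnK.
  have := @ortho_primitive_bound (r - 3) eta' h Lh peta' eta'a eta'b.
  move=> /(_ _)/wrap[]; first by move=> p sp; apply: h_orth; rewrite r3E.
  rewrite /leg_eigprod big_ord_recl big_ord0 mulr1 /leg_eig.
  apply: le_trans; rewrite le_eqVlt; apply/orP; left; apply/eqP; congr (_ * _).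
  by rewrite [in LHS]r3E -!natr1 /=; ring.
(* Poincare's inequality with k <= 1; this costs the factor 2 in N. *)
have E01 : E0 <= E1.
  apply: le_trans (prim_poincare Leta' peta etaa) _; rewrite -/E1 -/k.
  rewrite ler_piMl ?intoo_sqr_ge0//.
  by rewrite expr_le1// ltW.
have EN : E0 + E1 <= N by rewrite /N; lra.
have cy : ccont a b (fun x => xi x * xi x + xi' x * xi' x).
  by apply: ccontD; exact: ccontM.
have [m mab Hm] := EVT_max (ltW ab) cy.
pose Y := xi m * xi m + xi' m * xi' m.
have Y0 : 0 <= Y by rewrite /Y; nra.
have HY x : a <= x <= b -> xi x ^+ 2 + xi' x ^+ 2 <= Y.
  by move=> xab; rewrite !expr2; apply: Hm; rewrite in_itv.
have XY : X0 + X1 <= k * Y.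
  have [I1 I2] := (Lxi.2, Lxi'.2).
  rewrite /X0 /X1 -intooD// mulrC -(intoo_cst _ (ltW ab)).
  apply: le_intoo; [exact: intgooD|exact: intgoo_cst|].
  by move=> x /andP[ax xb]; apply: HY; rewrite !ltW.
have xia : xi a = e a by rewrite /xi etaa subr0.
have xi'a : xi' a = e' a by rewrite /xi' eta'a subr0.
have Z0 : 0 <= Z by exact: intoo_sqr_ge0.
(* Energy identity from a to the maximum point: the derivative of xi^2 + xi'^2 is 2 xi xi' + 2 xi'
   z, at most 2 Y + z^2. *)
have YZ : Y <= e a ^+ 2 + e' a ^+ 2 + 2 * k * Y + Z.
  have [/andP[am mb]] : a <= m <= b by move: mab; rewrite in_itv.
  have p1 := prim_mul pxi pxi cxi'.
  have p2 := prim_mul pxi' pxi' (@ccont_poly R a b z).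
  have [I12 /(_ a m (lexx a) am mb)] := primD p1 p2.
  rewrite -/Y => HYm; rewrite -[leLHS](subrK (xi a * xi a + xi' a * xi' a)) HYm.
  rewrite xia xi'a -!expr2; set J := intoo a m _.
  suff : J <= 2 * k * Y + Z by lra.
  rewrite /J.
  have [J1 J2] := (L2ooS (lexx a) mb (LP z), intgooS (lexx a) mb I12).
  apply: (@le_trans _ _ (intoo a m (fun x => 2 * Y + z.[x] ^+ 2))).
    apply: le_intoo => //; first by apply: intgooD; [exact: intgoo_cst|exact: J1.2].
    move=> x /andP[ax xm].
    have := HY x; rewrite (ltW ax) (le_trans (ltW xm) mb) => /(_ isT).
    have := sqr_ge0 (xi x - xi' x); have := sqr_ge0 (xi' x - z.[x]).
    by have := sqr_ge0 (xi x); nra.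
  rewrite intooD; [|exact: intgoo_cst|exact: J1.2].
  rewrite intoo_cst// /Z (intoo_split am mb (LP z).2).
  have := intoo_sqr_ge0 m b (horner z).
  have : 2 * Y * (m - a) <= 2 * k * Y; last lra.
  by rewrite mulrAC; apply: ler_wpM2r => //; rewrite ler_pM2l// lerB.
have L20 : 0 <= L ^+ 2 by exact: sqr_ge0.
have ZY : Z <= 4 * L ^+ 2 * (N + k * Y).
  apply: le_trans ZS (le_trans Sle _); apply: ler_wpM2l; first by rewrite mulr_ge0.
  lra.
have N0 : 0 <= N by apply: le_trans EN; rewrite addr_ge0 ?intoo_sqr_ge0.
exists Y; split=> //.
- apply: (energy_arith (ltW k0) _ ck N0 _ Y0 YZ ZY) => //.
  by rewrite addr_ge0 ?sqr_ge0.
- have := HY b; rewrite lexx (ltW ab) => /(_ isT).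
  by rewrite /xi /xi' etab eta'b !subr0.
- lra.
- apply: (@le_trans _ _ (2 * (H + Z))); last by lra.
  rewrite HE; apply: le_trans (intoo_sqrD Lh (LP z)); rewrite le_eqVlt; apply/orP; left.
  by apply/eqP/eq_intoo => x _; rewrite /h /z hornerD hornerN; congr (_ ^+ 2); ring.
Qed.

End LocalError.

(** * Interpolation spaces *)

Section Interpolation.
Context {R : realType}.
Local Notation mu := (@lebesgue_measure R).
Import HBNNSimple.

(** The simple function c 1_A lies below g, so the bound comes straight from the supremum defining
    the integral. It can thus be applied to the K-functional as a function of t, whose measurability
    is not established. *)
Lemma ge0_integral_ge_const d (T : measurableType d)
  (nu : {measure set T -> \bar R}) (A D : set T) (g : T -> \bar R) (c : R) :
  measurable A -> measurable D -> A `<=` D -> 0 <= c ->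
  (forall x, D x -> (0 <= g x)%E) -> (forall x, A x -> (c%:E <= g x)%E) ->
  (c%:E * nu A <= \int[nu]_(x in D) g x)%E.
Proof.
move=> mA mD AD c0 g0 gc; rewrite ge0_integralE//.
pose h := scale_nnsfun (indic_nnsfun R mA) c0.
have hE x : h x = c * \1_A x by [].
apply: ereal_sup_ge; exists (sintegral nu h).
  exists h => // x; rewrite hE patchE indicE.
  case: (boolP (x \in A)) => [|_].
    by rewrite inE => Ax; rewrite mulr1 mem_set ?gc//; exact: AD.
  rewrite mulr0; case: ifPn => //; rewrite inE; exact: g0.
have <- : (\int[nu]_x (h x)%:E)%E = sintegral nu h.
  by rewrite integral_nnsfun// patch_setT.
rewrite (eq_integral (fun x => c%:E * (\1_A x)%:E)%E)//.
rewrite ge0_integralZl//; last first.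
  by apply/measurable_EFinP; exact: measurable_indic.
by rewrite integral_indic// setIT.
Qed.

Lemma Hn_norm_ge0 m (a b : R) v : (0 <= Hn_norm m a b v)%E.
Proof. by rewrite /Hn_norm; case: ifP => // _; exact: poweR_ge0. Qed.

Lemma K_functional_ge m (a b t tau E M0 : R) u : 0 < M0 -> 0 <= E -> 0 < tau -> tau <= t ->
  (forall v w, (forall x, a < x < b -> u x = v x + w x) ->
     (E%:E <= M0%:E * (Hn_norm m a b v + tau%:E * Hn_norm m.+1 a b w))%E) ->
  ((E / M0)%:E <= K_functional m a b t u)%E.
Proof.
move=> M00 E0 tau0 taut H; apply: le_ereal_inf_tmp => z [v [w [uvw ->]]].
apply: (@le_trans _ _ (Hn_norm m a b v + tau%:E * Hn_norm m.+1 a b w)%E).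
  by rewrite EFinM lee_pdivrMr// muleC; exact: H.
rewrite leeD2l// lee_wpmul2r ?lee_fin// Hn_norm_ge0//.
Qed.

(* K_functional is nondecreasing in t: integrate over [M1/M0, 2 M1/M0]. *)
Lemma K_norm_ge m (theta a b E M0 M1 : R) u : 0 < theta < 1 ->
  0 < M0 -> 0 < M1 -> 0 <= E ->
  (forall v w, (forall x, a < x < b -> u x = v x + w x) ->
     (E%:E <= M0%:E * Hn_norm m a b v + M1%:E * Hn_norm m.+1 a b w)%E) ->
  ((E ^+ 2)%:E <= (8 * M0 ^+ 2 * (M1 / M0) `^ (2 * theta))%:E *
     K_norm m theta a b u ^+ 2)%E.
Proof.
move=> /andP[th0 th1] M00 M10 E0 H; pose tau := M1 / M0.
have tau0 : 0 < tau by rewrite divr_gt0.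
(* Lower bound of the integrand on [tau, 2 tau]: the decreasing powers of t are taken at the right
   end, the K-functional is bounded below by E / M0. *)
pose c := ((2 * tau) `^ (- theta) * (E / M0)) ^+ 2 * (2 * tau)^-1.
have EM0 : 0 <= E / M0 by rewrite divr_ge0// ltW.
have c0 : 0 <= c by rewrite mulr_ge0 ?sqr_ge0// invr_ge0 mulr_ge0// ltW.
have Kt t : tau <= t -> ((E / M0)%:E <= K_functional m a b t u)%E.
  move=> taut; apply: (@K_functional_ge m a b t tau E M0) => // v w uvw.
  rewrite muleDr ?ge0_adde_def ?inE ?mule_ge0 ?lee_fin ?Hn_norm_ge0 ?(ltW tau0)//.
  by rewrite muleA -EFinM /tau mulrCA divff ?gt_eqF// mulr1; exact: H.
have tauE : M1 / M0 = tau by [].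
clearbody tau.
have : (c%:E * mu (`[tau, (2 * tau)%R]%classic : set R) <= K_norm m theta a b u ^+ 2)%E.
  rewrite /K_norm poweR12_sqrt; last first.
    apply: integral_ge0 => t /=; rewrite in_itv/= andbT => t0.
    by rewrite mule_ge0 ?lee_fin ?invr_ge0 ?(ltW t0)// sqre_ge0.
  rewrite sqr_sqrte; last first.
    apply: integral_ge0 => t /=; rewrite in_itv/= andbT => t0.
    by rewrite mule_ge0 ?lee_fin ?invr_ge0 ?(ltW t0)// sqre_ge0.
  apply: ge0_integral_ge_const => //.
  - by move=> t /=; rewrite !in_itv/= andbT => /andP[/(lt_le_trans tau0)].
  - move=> t /=; rewrite in_itv/= andbT => t0.
    by rewrite mule_ge0 ?lee_fin ?invr_ge0 ?(ltW t0)// sqre_ge0.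
  - move=> t /=; rewrite in_itv/= => /andP[tt t2].
    have t0 := lt_le_trans tau0 tt.
    have h1 : (((2 * tau) `^ (- theta) * (E / M0))%:E <= (t `^ (- theta))%:E * K_functional m a b t u)%E.
      rewrite EFinM; apply: lee_pmul.
      + by rewrite lee_fin powR_ge0.
      + by rewrite lee_fin.
      + rewrite lee_fin !powRN lef_pV2 ?posrE ?powR_gt0 ?mulr_gt0//.
        apply: ge0_ler_powR; rewrite ?nnegrE ?(ltW th0) ?(ltW t0)//.
        by rewrite mulr_ge0 ?(ltW tau0).
      + exact: Kt.
    have h0 : 0 <= (2 * tau) `^ (- theta) * (E / M0) by apply: mulr_ge0 => //; exact: powR_ge0.
    rewrite /c EFinM; apply: lee_pmul.
    + by rewrite lee_fin sqr_ge0.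
    + by rewrite lee_fin invr_ge0 mulr_ge0// ltW.
    + by rewrite EFin_expe !expe2; apply: lee_pmul; rewrite ?lee_fin.
    + by rewrite lee_fin lef_pV2 ?posrE ?mulr_gt0.
have -> : mu (`[tau, (2 * tau)%R]%classic : set R) = tau%:E.
  have := lebesgue_measure_itv `[tau, 2 * tau]; rewrite /= lte_fin => ->.
  rewrite ifT; first by congr _%:E; lra.
  lra.
rewrite -EFinM => HK.
(* The interval has length tau while the weight gives 1 / (2 tau), which costs 2; moving the power
   from 2 tau to tau costs 2^(2 theta) <= 4. *)
set C := 8 * M0 ^+ 2 * _.
have C0 : 0 <= C.
  by apply: mulr_ge0; [apply: mulr_ge0 => //; exact: sqr_ge0|exact: powR_ge0].
have : (C%:E * (c * tau)%:E <= C%:E * K_norm m theta a b u ^+ 2)%E.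
  by apply: lee_wpmul2l => //; rewrite lee_fin.
apply: le_trans; rewrite -EFinM lee_fin /C /c tauE.
have P0 : 0 < tau `^ (2 * theta) by rewrite powR_gt0.
have -> : ((2 * tau) `^ (- theta) * (E / M0)) ^+ 2 =
   (2 `^ (2 * theta))^-1 * (tau `^ (2 * theta))^-1 * (E / M0) ^+ 2.
  rewrite [LHS]exprMn; congr (_ * _); rewrite powRN exprVn -invfM; congr (_^-1).
  by rewrite -powRM ?(ltW tau0)// [2 * theta]mulrC powRrM powR_mulrn ?powR_ge0.
have H2 : 4^-1 <= (2 `^ (2 * theta) : R)^-1.
  rewrite lef_pV2 ?posrE ?powR_gt0//.
  rewrite (_ : 4 = 2 `^ 2 :> R); last by rewrite powR_mulrn//; ring.
  by apply: ler_powR; lra.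
have -> : 8 * M0 ^+ 2 * tau `^ (2 * theta) * ((2 `^ (2 * theta))^-1 *
    (tau `^ (2 * theta))^-1 * (E / M0) ^+ 2 * (2 * tau)^-1 * tau) =
    4 * (2 `^ (2 * theta))^-1 * E ^+ 2.
  field; rewrite !gt_eqF//= ?powR_gt0//.
by rewrite ler_peMl ?sqr_ge0//; lra.
Qed.

End Interpolation.

(** * Piecewise projection errors *)

Section PiecewiseApproximation.
Context {R : realType}.
Implicit Types (a b c x y : R) (u v w f g h : R -> R) (D : nat -> R -> R).

Lemma inHn_L2oo m a b u : inHn m a b u -> L2oo a b u.
Proof.
move=> /inHn_wder/(_ (leq0n m))[wu Lw].
have [[mu_ _ _] _ _] := wu.
apply: aeoo_L2oo Lw; last exact/aeoo_sym/weak_derivative0_ae.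
by [].
Qed.

Lemma weak_derivative_lin a b j c u v g h : a <= b ->
  intgoo a b u -> intgoo a b v -> intgoo a b g -> intgoo a b h ->
  weak_derivative a b j u g -> weak_derivative a b j v h ->
  weak_derivative a b j (fun x => u x + c * v x) (fun x => g x + c * h x).
Proof.
move=> ab iu iv ig ih [_ _ Hu] [_ _ Hv].
have iL f f' : intgoo a b f -> intgoo a b f' -> intgoo a b (fun x => f x + c * f' x).
  by move=> i1 i2; apply: intgooD => //; exact: intgooZ.
split; [exact/intgoo_locally_integrable/iL|exact/intgoo_locally_integrable/iL|].
move=> phi tphi.
have cphi i : ccont a b (derive1n i phi).
  exact/continuous_ccont/(@test_function_continuous _ a b)/test_function_derive1n.
have lin f f' q : intgoo a b f -> intgoo a b f' -> ccont a b q ->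
    intoo a b (fun x => (f x + c * f' x) * q x) =
    intoo a b (fun x => f x * q x) + c * intoo a b (fun x => f' x * q x).
  move=> i1 i2 cq.
  have i1q := intgooMr ab i1 cq; have i2q := intgooMr ab i2 cq.
  rewrite -intooZ// -intooD//; last exact: intgooZ.
  by apply: eq_intoo => x _; rewrite mulrDl mulrA.
have := lin _ _ _ iu iv (cphi j); rewrite /intoo => ->.
have := lin _ _ _ ig ih (cphi 0%N); rewrite /intoo/= => ->.
by rewrite Hu// Hv// mulrDr mulrCA.
Qed.

Lemma inHn_lin m a b c u v : a <= b -> inHn m a b u -> inHn m a b v ->
  inHn m a b (fun x => u x + c * v x) /\
  forall i, (i <= m)%N -> aeoo a b (wder a b i (fun x => u x + c * v x))
     (fun x => wder a b i u x + c * wder a b i v x).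
Proof.
move=> ab Hu Hv.
have W i (im : (i <= m)%N) : weak_derivative a b i (fun x => u x + c * v x)
    (fun x => wder a b i u x + c * wder a b i v x).
  have [wu Lu] := inHn_wder Hu im; have [wv Lv] := inHn_wder Hv im.
  by apply: weak_derivative_lin => //; apply: L2oo_intgoo => //; apply: inHn_L2oo; eassumption.
have H : inHn m a b (fun x => u x + c * v x).
  move=> i im; exists (fun x => wder a b i u x + c * wder a b i v x); first exact: W.
  have [_ Lu] := inHn_wder Hu im; have [_ Lv] := inHn_wder Hv im.
  by apply/L2oo_memL2; apply: L2ooD => //; exact: L2ooZ.
split=> // i im; apply: weak_derivative_unique (W i im).
by have [] := inHn_wder H im.
Qed.

Lemma proj_err_ae a b p f g : L2oo a b f -> L2oo a b g -> aeoo a b f g ->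
  proj_err a b p f = proj_err a b p g.
Proof.
move=> Lf Lg fg.
have E i : leg_coef a b f i = leg_coef a b g i.
  rewrite /leg_coef; congr (_ / _); apply: aeoo_intoo.
  - by apply: intgoo_meas; apply: L2ooM => //; exact/L2oo_ccont/ccont_poly.
  - by apply: intgoo_meas; apply: L2ooM => //; exact/L2oo_ccont/ccont_poly.
  - exact: (aeoo_comp2 (fun _ y z => y * z) fg (aeoo_refl _ _ _)).
rewrite proj_err.unlock.
have -> : proj a b p f = proj a b p g.
  by rewrite /proj; apply: eq_bigr => i _; rewrite E.
have Lp h : L2oo a b h -> L2oo a b (fun x => h x - (proj a b p g).[x]).
  by move=> Lh; apply: L2ooB => //; exact/L2oo_ccont/ccont_poly.
apply: aeoo_intoo_sqr; [by case: (Lp f Lf)|by case: (Lp g Lg)|].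
exact: (aeoo_comp2 (fun _ y z => y - z) fg (aeoo_refl _ _ _)).
Qed.

Variables (N : nat) (t : nat -> R).
Hypothesis tS : forall n, (n < N)%N -> t n < t n.+1.

Lemma partition_le i j : (i <= j)%N -> (j <= N)%N -> t i <= t j.
Proof.
elim: j => [|j IH]; first by rewrite leqn0 => /eqP ->.
rewrite leq_eqVlt => /predU1P[-> //|ij jN].
by apply: le_trans (ltW (tS jN)); apply: IH => //; exact: ltnW.
Qed.

Lemma partition_itv (n : 'I_N) : [/\ t 0%N <= t n, t n < t n.+1 & t n.+1 <= t N].
Proof. by split; [exact/partition_le/ltnW|exact: tS|exact: partition_le]. Qed.

Lemma intoo_partition f : intgoo (t 0%N) (t N) f ->
  intoo (t 0%N) (t N) f = \sum_(n < N) intoo (t n) (t n.+1) f.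
Proof.
move=> If; suff H k : (k <= N)%N ->
    intoo (t 0%N) (t k) f = \sum_(n < k) intoo (t n) (t n.+1) f by exact: H.
elim: k => [_|k IH kN]; first by rewrite intoo_itvxx big_ord0.
rewrite big_ord_recr/= -IH ?(ltnW kN)//; apply: intoo_split.
- exact/partition_le/ltnW.
- exact/ltW/tS.
- by apply: intgooS If => //; exact: partition_le.
Qed.

(** The optimal z is B / A; both numbers are first enlarged by e / 2 so that the quotient is
    positive. *)
Lemma le_add_young (A B E : R) : 0 <= A -> 0 <= B -> 0 <= E ->
  (forall z, 0 < z -> E ^+ 2 <= (1 + z) * A ^+ 2 + (1 + z^-1) * B ^+ 2) ->
  E <= A + B.
Proof.
move=> A0 B0 E0 H; apply/ler_addgt0Pr => e e0.
pose A' := A + e / 2; pose B' := B + e / 2.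
have A'0 : 0 < A' by rewrite /A'; lra.
have B'0 : 0 < B' by rewrite /B'; lra.
have z0 : 0 < B' / A' by rewrite divr_gt0.
have AA : A ^+ 2 <= A' ^+ 2 by apply: lerXn2r; rewrite ?nnegrE ?(ltW A'0)// /A'; lra.
have BB : B ^+ 2 <= B' ^+ 2 by apply: lerXn2r; rewrite ?nnegrE ?(ltW B'0)// /B'; lra.
have : E ^+ 2 <= (A' + B') ^+ 2.
  apply: (le_trans (H _ z0)).
  rewrite (_ : (A' + B') ^+ 2 = (1 + B' / A') * A' ^+ 2 + (1 + (B' / A')^-1) * B' ^+ 2).
    apply: lerD; apply: ler_wpM2l => //; apply: addr_ge0 => //; first exact: ltW.
    by rewrite invr_ge0 ltW.
  by field; rewrite !gt_eqF.
rewrite ler_sqr ?nnegrE//; first by rewrite /A' /B'; lra.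
by apply: addr_ge0; exact: ltW.
Qed.

(** The l2 combination of the local errors. Interpolation is applied to this quantity, so that the
    norm of u over the whole interval appears at once instead of a sum of local fractional norms. *)
Definition piecewise_err p f : R :=
  Num.sqrt (\sum_(n < N) proj_err (t n) (t n.+1) p f).

Lemma piecewise_err_ge0 p f : 0 <= piecewise_err p f.
Proof. exact: sqrtr_ge0. Qed.

Lemma sqr_piecewise_err p f :
  piecewise_err p f ^+ 2 = \sum_(n < N) proj_err (t n) (t n.+1) p f.
Proof. by rewrite sqr_sqrtr// sumr_ge0// => n _; exact: proj_err_ge0. Qed.

Lemma piecewise_err_ae p f g : L2oo (t 0%N) (t N) f -> L2oo (t 0%N) (t N) g ->
  aeoo (t 0%N) (t N) f g -> piecewise_err p f = piecewise_err p g.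
Proof.
move=> Lf Lg fg; rewrite /piecewise_err.
rewrite (eq_bigr (fun n : 'I_N => proj_err (t n) (t n.+1) p g))// => n _.
have [n0 _ nN] := partition_itv n.
by apply: proj_err_ae; [exact: L2ooS Lf|exact: L2ooS Lg|exact: aeooS fg].
Qed.

(* Expanding the square, the cross terms are bounded by the weighted
   Cauchy-Schwarz inequality 2 f g <= z f^2 + g^2 / z. *)
Lemma piecewise_err_triangle p f g : L2oo (t 0%N) (t N) f ->
  L2oo (t 0%N) (t N) g ->
  piecewise_err p (fun x => f x + g x) <= piecewise_err p f + piecewise_err p g.
Proof.
move=> Lf Lg; set A := piecewise_err p f; set B := piecewise_err p g.
have A0 : 0 <= A by exact: piecewise_err_ge0.
have B0 : 0 <= B by exact: piecewise_err_ge0.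
have AE : A ^+ 2 = _ := sqr_piecewise_err p f.
have BE : B ^+ 2 = _ := sqr_piecewise_err p g.
suff H z : 0 < z -> \sum_(n < N) proj_err (t n) (t n.+1) p (fun x => f x + g x) <=
    (1 + z) * A ^+ 2 + (1 + z^-1) * B ^+ 2.
  apply: le_add_young => //; first exact: piecewise_err_ge0.
  by move=> z z0; rewrite sqr_piecewise_err; exact: H.
move=> z0; rewrite AE BE !mulr_sumr -big_split/=; apply: ler_sum => n _.
have [n0 nn nN] := partition_itv n.
have Lfn : L2oo (t n) (t n.+1) f by exact: L2ooS Lf.
have Lgn : L2oo (t n) (t n.+1) g by exact: L2ooS Lg.
pose P := proj (t n) (t n.+1) p f; pose Q := proj (t n) (t n.+1) p g.
have LP (h : R -> R) (q : {poly R}) : L2oo (t n) (t n.+1) h -> L2oo (t n) (t n.+1) (fun x => h x - q.[x]).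
  by move=> Lh; apply: L2ooB => //; exact/L2oo_ccont/ccont_poly.
have sPQ : (size (P + Q)%R <= p.+1)%N.
  by rewrite (leq_trans (size_polyD _ _))// geq_max !size_proj.
apply: (le_trans (proj_err_le nn (L2ooD Lfn Lgn) sPQ)).
have [_ IP] := LP f P Lfn; have [_ IQ] := LP g Q Lgn.
rewrite !proj_err.unlock -!intooZ// -intooD; [|exact: intgooZ|exact: intgooZ].
apply: le_intoo => [||x xn].
- by have [] := LP _ (P + Q) (L2ooD Lfn Lgn).
- by apply: intgooD; exact: intgooZ.
rewrite hornerD -/P -/Q; set y1 := f x - P.[x]; set y2 := g x - Q.[x].
rewrite (_ : f x + g x - _ = y1 + y2); last by rewrite /y1 /y2; ring.
have : 0 <= z^-1 * (z * y1 - y2) ^+ 2 by rewrite mulr_ge0 ?sqr_ge0// invr_ge0 ltW.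
rewrite (_ : z^-1 * _ = z * y1 ^+ 2 - 2 * y1 * y2 + z^-1 * y2 ^+ 2).
  lra.
by field; rewrite gt_eqF.
Qed.

Lemma piecewise_err_bound p s (M : R) D : (s <= p.+1)%N ->
  (forall j, (j < s)%N -> prim (t 0%N) (t N) (D j) (D j.+1)) ->
  (forall j, (j <= s)%N -> L2oo (t 0%N) (t N) (D j)) ->
  (forall n, (n < N)%N -> ((t n.+1 - t n) / 2) ^+ (2 * s) <=
     M ^+ 2 * leg_eigprod p.+1 s) ->
  piecewise_err p (D 0%N) ^+ 2 <=
  M ^+ 2 * intoo (t 0%N) (t N) (fun x => D s x ^+ 2).
Proof.
move=> sp pD LD HM; rewrite sqr_piecewise_err.
have [_ Is] := LD s (leqnn s).
rewrite intoo_partition// mulr_sumr; apply: ler_sum => n _.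
have [n0 nn nN] := partition_itv n.
have eig0 := @leg_eigprod_gt0 R _ _ sp.
rewrite -(ler_pM2l eig0).
apply: (le_trans (proj_err_bound nn sp _ _)).
- by move=> j js; exact: primS (pD j js).
- by move=> j js; exact: L2ooS (LD j js).
rewrite mulrA [_ * M ^+ 2]mulrC ler_wpM2r ?intoo_sqr_ge0//; exact: HM.
Qed.

(** The order s is not tied to m, because the degree caps it through s <= p + 1; surplus smoothness
    is discarded by keeping a single term of the norm. M carries the worst case over the
    subintervals. *)
Lemma piecewise_err_Hn p s m (M : R) v : 0 < M -> t 0%N < t N -> (s <= p.+1)%N ->
  (s + 2 <= m)%N ->
  (forall n, (n < N)%N -> ((t n.+1 - t n) / 2) ^+ (2 * s) <=
     M ^+ 2 * leg_eigprod p.+1 s) ->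
  ((piecewise_err p (wder (t 0%N) (t N) 2 v))%:E <=
    M%:E * Hn_norm m (t 0%N) (t N) v)%E.
Proof.
move=> M0 t0N sp sm HM.
(* Outside H^m the norm is +oo, and M > 0 keeps the right side at +oo. *)
have [Hv|Hv] := pselect (inHn m (t 0%N) (t N) v); last first.
  by rewrite /Hn_norm asboolF// gt0_muley ?lee_fin ?leey.
have [D [uD pD LD wD]] := inHn_chain t0N Hv.
rewrite (Hn_norm_sqrt Hv LD wD) -EFinM lee_fin.
have m2 : (2 <= m)%N by rewrite (leq_trans _ sm)// leq_addl.
rewrite (piecewise_err_ae p _ (LD 2 m2) (wD 2 m2)); last by have [] := inHn_wder Hv m2.
set S := \sum_(i < _) _.
have S0 : 0 <= S by apply: sumr_ge0 => i _; exact: intoo_sqr_ge0.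
rewrite -ler_sqr ?nnegrE ?piecewise_err_ge0//; last first.
  by apply: mulr_ge0; [exact: ltW|exact: sqrtr_ge0].
rewrite exprMn (sqr_sqrtr S0) /S.
apply: (le_trans (@piecewise_err_bound p s M (fun j => D j.+2) sp _ _ HM)).
- by move=> j js; apply: pD; rewrite (leq_trans _ sm)// addn2 !ltnS.
- by move=> j js; apply: LD; rewrite (leq_trans _ sm)// addn2.
rewrite ler_wpM2l ?sqr_ge0//.
have s2m : (s.+2 < m.+1)%N by rewrite ltnS -addn2.
rewrite (bigD1 (Ordinal s2m))//= lerDl; apply: sumr_ge0 => i _; exact: intoo_sqr_ge0.
Qed.

(** F is a second weak derivative of u, hence almost everywhere the sum of those of v and w; the
    triangle inequality concludes. *)
Lemma piecewise_err_wderD p m u u' F v w : t 0%N < t N -> (2 <= m)%N ->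
  prim (t 0%N) (t N) u u' -> prim (t 0%N) (t N) u' F -> L2oo (t 0%N) (t N) F ->
  inHn m (t 0%N) (t N) v -> inHn m.+1 (t 0%N) (t N) w ->
  (forall x, t 0%N < x < t N -> u x = v x + w x) ->
  piecewise_err p F <= piecewise_err p (wder (t 0%N) (t N) 2 v) +
    piecewise_err p (wder (t 0%N) (t N) 2 w).
Proof.
move=> t0N m2 pu pu' LF Hv Hw uvw.
have Hw' : inHn m (t 0%N) (t N) w by move=> j jm; apply: Hw; exact: leqW.
have [HS HSw] := inHn_lin 1 (ltW t0N) Hv Hw'.
have Hu : weak_derivative (t 0%N) (t N) 2 u F.
  pose D j := nth F [:: u; u'] j.
  apply: (@prim_weak_derivative _ _ _ 2 D).
  - exact/intgoo_ccont/(prim_ccont pu).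
  - exact: L2oo_intgoo.
  - by case=> [|[|[]]].
have [wS LS] := inHn_wder HS m2.
have Lv : L2oo (t 0%N) (t N) (wder (t 0%N) (t N) 2 v) by have [] := inHn_wder Hv m2.
have Lw : L2oo (t 0%N) (t N) (wder (t 0%N) (t N) 2 w) by have [] := inHn_wder Hw' m2.
rewrite (piecewise_err_ae p (g := fun x => wder (t 0%N) (t N) 2 v x + wder (t 0%N) (t N) 2 w x) LF).
- exact: piecewise_err_triangle.
- exact: L2ooD.
apply: (@aeoo_trans _ _ _ _ (wder (t 0%N) (t N) 2 (fun x => v x + 1 * w x))).
  apply: weak_derivative_unique Hu _.
  by apply: eq_weak_derivative wS => // x /uvw ->; rewrite mul1r.
apply: aeoo_trans (HSw 2 m2) _; apply: aeooW => x _; rewrite mul1r//.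
Qed.

(* (s0, M0) and (s1, M1) are the orders and constants of the estimates in H^m
   and H^{m+1}; when theta = 0 only the former is used. *)
Lemma piecewise_err_Hnorm p (sg : R) s0 s1 (M0 M1 : R) u u' F
  (m := Num.truncn sg) (theta := sg - m%:R) : 0 <= sg ->
  t 0%N < t N -> (2 <= m)%N ->
  prim (t 0%N) (t N) u u' -> prim (t 0%N) (t N) u' F -> L2oo (t 0%N) (t N) F ->
  0 < M0 -> 0 < M1 ->
  (s0 <= p.+1)%N -> (s0 + 2 <= m)%N ->
  (forall n, (n < N)%N -> ((t n.+1 - t n) / 2) ^+ (2 * s0) <=
     M0 ^+ 2 * leg_eigprod p.+1 s0) ->
  (theta != 0 -> [/\ (s1 <= p.+1)%N, (s1 + 2 <= m.+1)%N &
    forall n, (n < N)%N -> ((t n.+1 - t n) / 2) ^+ (2 * s1) <=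
     M1 ^+ 2 * leg_eigprod p.+1 s1]) ->
  ((piecewise_err p F ^+ 2)%:E <=
   (8 * M0 ^+ 2 * (M1 / M0) `^ (2 * theta))%:E *
     Hnorm sg (t 0%N) (t N) u ^+ 2)%E.
Proof.
move=> sg0 t0N m2 pu pu' LF M00 M10 s0p s0m HM0 HM1.
have EF0 := piecewise_err_ge0 p F.
have [th0|th0] := eqVneq theta 0.
  have -> : Hnorm sg (t 0%N) (t N) u = Hn_norm m (t 0%N) (t N) u.
    by rewrite /Hnorm -/m -/theta th0 eqxx.
  rewrite th0 mulr0 powRr0 mulr1.
  have H := @piecewise_err_Hn p s0 m M0 u M00 t0N s0p s0m HM0.
  have [Hu|Hu] := pselect (inHn m (t 0%N) (t N) u); last first.
    rewrite /Hn_norm asboolF// expe2 mulyy gt0_muley ?leey//.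
    by rewrite lte_fin mulr_gt0// exprn_gt0.
  have E : piecewise_err p F = piecewise_err p (wder (t 0%N) (t N) 2 u).
    have [wu Lu] := inHn_wder Hu m2.
    apply: piecewise_err_ae => //; apply: weak_derivative_unique wu.
    pose D j := nth F [:: u; u'] j.
    apply: (@prim_weak_derivative _ _ _ 2 D).
    - exact/intgoo_ccont/(prim_ccont pu).
    - exact: L2oo_intgoo.
    - by case=> [|[|[]]].
  have [D [_ pD LD wD]] := inHn_chain t0N Hu.
  move: H; rewrite -E (Hn_norm_sqrt Hu LD wD) -EFin_expe -!EFinM !lee_fin => H.
  set S := Num.sqrt _ in H *.
  have S0 : 0 <= S by exact: sqrtr_ge0.
  clearbody S; move: H; rewrite -ler_sqr ?nnegrE//; last first.
    by apply: mulr_ge0 => //; exact: ltW.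
  rewrite exprMn => /le_trans; apply.
  rewrite ler_wpM2r ?sqr_ge0// ler_peMl ?sqr_ge0//; lra.
have -> : Hnorm sg (t 0%N) (t N) u = K_norm m theta (t 0%N) (t N) u.
  by rewrite /Hnorm -/m -/theta (negbTE th0).
have [s1p s1m HM] := HM1 th0.
have /andP[m_le lt_m] := truncn_itv sg0.
apply: K_norm_ge => //.
  by rewrite lt_def th0/= /theta subr_ge0 m_le/= ltrBlDl natr1.
move=> v w uvw.
have [Hv|Hv] := pselect (inHn m (t 0%N) (t N) v); last first.
  rewrite [Hn_norm m _ _ v]/Hn_norm asboolF// gt0_muley ?lte_fin// addye ?leey//.
  by rewrite gt_eqF// (lt_le_trans _ (mule_ge0 _ (Hn_norm_ge0 _ _ _ _))) ?lee_fin ?(ltW M10) ?ltNy0.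
have [Hw|Hw] := pselect (inHn m.+1 (t 0%N) (t N) w); last first.
  rewrite [Hn_norm m.+1 _ _ w]/Hn_norm asboolF// gt0_muley ?lte_fin// addey ?leey//.
  by rewrite gt_eqF// (lt_le_trans _ (mule_ge0 _ (Hn_norm_ge0 _ _ _ _))) ?lee_fin ?(ltW M00) ?ltNy0.
have := piecewise_err_wderD p t0N m2 pu pu' LF Hv Hw uvw.
rewrite -lee_fin EFinD => /le_trans; apply; apply: leeD.
- exact: (@piecewise_err_Hn p s0).
- exact: (@piecewise_err_Hn p s1).
Qed.

End PiecewiseApproximation.

(** * The Gamma function *)

Section GammaFunction.
Context {R : realType}.
Implicit Types (t x y z : R) (f g : R -> R).
Local Notation mu := (@lebesgue_measure R).
Local Notation D := (`]0, +oo[%classic : set R).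
Local Notation igr f := (mu.-integrable D (EFin \o f)).

Lemma halfline_integrableZ (c : R) f : igr f ->
  igr (fun t => c * f t).
Proof.
move=> If; rewrite (_ : EFin \o _ = (fun x => c%:E * (EFin \o f) x))%E; last exact/funext.
exact: integrableZl.
Qed.

Lemma halfline_integrableD f g : igr f ->
  igr g -> igr (fun t => f t + g t).
Proof.
move=> If Ig; rewrite (_ : EFin \o _ = (EFin \o f) \+ (EFin \o g))%E; last exact/funext.
exact: integrableD.
Qed.

Lemma halfline_integrableB f g : igr f ->
  igr g -> igr (fun t => f t - g t).
Proof.
move=> If Ig; rewrite (_ : EFin \o _ = (EFin \o f) \- (EFin \o g))%E; last exact/funext.
exact: integrableB.
Qed.

(** With n > y, t^y is at most 1 + t^n, and half of the exponent absorbs this polynomial. *)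
Lemma powR_expR_bounded y : 0 <= y -> exists2 C : R, 0 < C &
  forall t, 0 <= t -> t `^ y * expR (- t) <= C * expR (- 2^-1 * t).
Proof.
move=> y0; pose n := (Num.truncn y).+1.
have [C C0 HC] := @horner_expR_bounded R (1 + 'X^n) 2^-1 ltac:(lra).
exists (C + 1) => [|t]; first by lra.
rewrite le_eqVlt => /predU1P[<-|t0].
  rewrite mulr0 oppr0 expR0 !mulr1; apply: le_trans (_ : 1 <= _); last by lra.
  have [->|yn0] := eqVneq y 0; first by rewrite powRr0.
  by rewrite powR0//.
have -> : expR (- t) = expR (- (2^-1 * t)) * expR (- 2^-1 * t).
  by rewrite -expRD; congr expR; lra.
rewrite mulrA ler_wpM2r ?expR_ge0//.
have := HC t t0; rewrite hornerD hornerXn hornerC.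
have P : 0 <= 1 + t ^+ n by rewrite addr_ge0// exprn_ge0// ltW.
rewrite ger0_norm// => H; apply: (@le_trans _ _ C); last by lra.
apply: le_trans H; rewrite ler_wpM2r ?expR_ge0//.
have [t1|t1] := leP t 1.
  rewrite (@le_trans _ _ 1) ?lerDl ?exprn_ge0 ?(ltW t0)//.
  have := @ge0_ler_powR R y y0 t 1; rewrite !nnegrE powR1; apply => //; exact: ltW.
rewrite (@le_trans _ _ (t ^+ n)) ?lerDr// -powR_mulrn ?(ltW t0)//.
apply: ler_powR; first exact: ltW.
by have /andP[_ /ltW] := truncn_itv y0.
Qed.

Lemma continuous_expRM (c : R) : continuous (fun t : R => expR (c * t)).
Proof.
move=> t; apply: continuous_comp; last exact: continuous_expR.
exact: mulrl_continuous.
Qed.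

Lemma is_derive_expRM (c t : R) :
  is_derive t 1 (fun t => expR (c * t)) (c * expR (c * t)).
Proof.
have d1 : is_derive t (1 : R) (fun t => c * t) (c *: 1) by exact: is_deriveZ.
have d2 : is_derive t (1 : R) (fun t => expR (c * t)) (expR (c * t) * (c *: 1)).
  exact: (@is_derive1_comp _ expR (fun t => c * t)).
by apply: is_derive_eq; rewrite /GRing.scale/= mulr1 mulrC.
Qed.

Lemma cvg_expRNM (c : R) : 0 < c -> expR (- c * t) @[t --> +oo] --> (0 : R).
Proof.
move=> c0; rewrite (_ : (fun x => expR (- c * x)) =
    (fun z => expR (- z)) \o (fun z => c * z)); last first.
  by apply: eq_fun => x; rewrite mulNr.
apply: (@cvg_comp _ _ _ _ _ _ (pinfty_nbhs R)); last exact: cvgr_expR.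
exact: gt0_cvgMry.
Qed.

Lemma powR_cvg_right y : 0 <= y -> t `^ y @[t --> 0^'+] --> (0 : R) `^ y.
Proof.
rewrite le_eqVlt => /predU1P[<-|y0].
  rewrite powRr0; apply: cvg_near_cst; near=> t; exact: powRr0.
by rewrite powR0 ?gt_eqF//; exact: powR_cvg0.
Unshelve. all: by end_near. Qed.

Lemma integral_halfline (f F : R -> R) (l : R) :
  (forall t, 0 <= t -> 0 <= f t) -> f t @[t --> 0^'+] --> f 0 ->
  {in `]0, +oo[, continuous f} ->
  F t @[t --> +oo] --> l -> F t @[t --> 0^'+] --> F 0 ->
  (forall t, 0 < t -> is_derive t 1 F (f t)) ->
  igr f /\ \int[mu]_(t in D) f t = l - F 0.
Proof.
move=> f0 f0c fc Fl F0 dF.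
have fw : {within `[0, +oo[, continuous f} by apply/continuous_within_itvcyP.
have mf : measurable_fun D f.
  by apply: open_continuous_measurable_fun => //; exact/in_continuous_mksetP.
have E : (\int[mu]_(t in D) (f t)%:E = l%:E - (F 0)%:E)%E.
  rewrite integral_itv_obnd_cbnd//; last exact/measurable_EFinP.
  apply: ge0_continuous_FTC2y => //.
  - by move=> t /dF[].
  - by move=> t; rewrite in_itv/= andbT => /dF[_ <-]; rewrite derive1E.
split; last by rewrite /Rintegral E.
apply/integrableP; split; first exact/measurable_EFinP.
suff -> : (\int[mu]_(t in D) `|(EFin \o f) t| = \int[mu]_(t in D) (f t)%:E)%E.
  by rewrite E -EFinB ltry.
apply: eq_integral => t; rewrite inE/= in_itv/= andbT => t0.
by rewrite ger0_norm// f0// ltW.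
Qed.

Lemma integral_expRNM (c : R) : 0 < c ->
  igr (fun t => expR (- c * t)) /\
  \int[mu]_(t in D) expR (- c * t) = c^-1.
Proof.
move=> c0.
have [|||||t t0|I ->] := @integral_halfline (fun t => expR (- c * t))
  (fun t => - c^-1 * expR (- c * t)) 0.
- by move=> t _; exact: expR_ge0.
- by apply: cvg_at_right_filter; exact: continuous_expRM.
- by move=> t _; exact: continuous_expRM.
- rewrite -(mulr0 (- c^-1)); apply: cvgM; first exact: cvg_cst.
  exact: cvg_expRNM.
- apply: cvg_at_right_filter; apply: cvgM; first exact: cvg_cst.
  exact: continuous_expRM.
- have d1 := is_derive_expRM (- c) t.
  have d2 : is_derive t (1 : R) (fun t => - c^-1 * expR (- c * t))
      (- c^-1 *: (- c * expR (- c * t))) by exact: is_deriveZ.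
  by apply: is_derive_eq; rewrite /GRing.scale/=; field; rewrite gt_eqF.
by split=> //; rewrite mulr0 expR0 mulr1 sub0r opprK.
Qed.

Definition gamma_fun x (t : R) : R := t `^ (x - 1) * expR (- t).

Lemma is_derive_powR_expR y t : 0 < t ->
  is_derive t 1 (fun t => t `^ y * expR (- t))
   (y * t `^ (y - 1) * expR (- t) - t `^ y * expR (- t)).
Proof.
move=> t0; have d1 := is_derive1_powR y t0; have d2 := is_derive_expRM (-1) t.
rewrite (_ : (fun t => _) = (fun t => t `^ y * expR (-1 * t))); last first.
  by apply/funext => z; rewrite mulN1r.
have d3 : is_derive t (1 : R) (fun t => t `^ y * expR (-1 * t))
    (t `^ y *: (-1 * expR (-1 * t)) + expR (-1 * t) *: (y * t `^ (y - 1))).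
  exact: is_deriveM.
by apply: is_derive_eq; rewrite /GRing.scale/= !mulN1r; ring.
Qed.

Lemma gamma_fun_continuous x : {in `]0, +oo[, continuous (gamma_fun x)}.
Proof.
move=> t; rewrite in_itv/= andbT => t0.
apply: differentiable_continuous; apply/derivable1_diffP.
by have [] := is_derive_powR_expR (x - 1) t0.
Qed.

Lemma gamma_fun_cvg0 x : 1 <= x -> gamma_fun x t @[t --> 0^'+] --> gamma_fun x 0.
Proof.
move=> x1; apply: cvgM; first by apply: powR_cvg_right; lra.
apply: cvg_at_right_filter.
rewrite (_ : (fun t => _) = (fun t : R => expR (-1 * t))); last first.
  by apply/funext => z; rewrite mulN1r.
by rewrite -[- 0]mulN1r; exact: continuous_expRM.
Qed.

Lemma integrable_gamma_fun x : 1 <= x -> igr (gamma_fun x).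
Proof.
move=> x1.
have [C C0 HC] := @powR_expR_bounded (x - 1) ltac:(lra).
have [I _] := @integral_expRNM 2^-1 ltac:(lra).
apply: (le_integrable _ _ _ (integrableZl _ C I)) => //.
  apply/measurable_EFinP; apply: open_continuous_measurable_fun => //.
  exact/in_continuous_mksetP/gamma_fun_continuous.
move=> t/=; rewrite in_itv/= andbT => t0; rewrite lee_fin.
rewrite !ger0_norm ?mulr_ge0 ?expR_ge0 ?powR_ge0 ?(ltW C0)//.
exact/HC/ltW.
Qed.

Lemma GammaE x : Gamma x = \int[mu]_(t in D) gamma_fun x t.
Proof. by []. Qed.

(* The K-term makes the integrand nonnegative, as the half-line version of
   the fundamental theorem requires. *)
Lemma GammaS x : 1 <= x -> Gamma (x + 1) = x * Gamma x.
Proof.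
move=> x1; have [C C0 HC] := @powR_expR_bounded (x - 1) ltac:(lra).
have [C' C'0 HC'] := @powR_expR_bounded x ltac:(lra).
(* K / 2 = x C, so by the choice of C the added term dominates [x * gamma_fun x t]. Its integral K
   cancels in the end against F 0 = -K. *)
pose e t : R := expR (- 2^-1 * t); pose K := 2 * x * C.
have [Ie Ee] := @integral_expRNM 2^-1 ltac:(lra).
pose f t := gamma_fun (x + 1) t - x * gamma_fun x t + K / 2 * e t.
pose F t := - (t `^ x * expR (- t)) - K * e t.
have K0 : 0 < K by rewrite /K !mulr_gt0//; lra.
have dF t : 0 < t -> is_derive t 1 F (f t).
  move=> t0; have d1 := is_derive_powR_expR x t0.
  have d2 := is_derive_expRM (- 2^-1) t.
  have d3 : is_derive t (1 : R) (fun t => K * e t) (K *: (- 2^-1 * e t)).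
    exact: is_deriveZ.
  have d4 : is_derive t (1 : R) F
      (- (x * t `^ (x - 1) * expR (- t) - t `^ x * expR (- t)) - K *: (- 2^-1 * e t)).
    by apply: is_deriveB.
  by apply: is_derive_eq; rewrite /f /gamma_fun addrK /GRing.scale/=; field.
have f0 t : 0 <= t -> 0 <= f t.
  move=> t0; rewrite /f /gamma_fun -/(gamma_fun x t).
  have : x * gamma_fun x t <= K / 2 * e t.
    rewrite (_ : K / 2 * e t = x * (C * e t)); last by rewrite /K; field.
    by apply: ler_wpM2l; [lra|exact: HC].
  have : 0 <= t `^ (x + 1 - 1) * expR (- t) by rewrite mulr_ge0 ?powR_ge0 ?expR_ge0.
  lra.
have e0 : e t @[t --> 0^'+] --> e 0.
  by apply: cvg_at_right_filter; exact: continuous_expRM.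
have ey : e t @[t --> +oo] --> (0 : R) by apply: cvg_expRNM; lra.
have x1' : 1 <= x + 1 by lra.
have [I E] : igr f /\ \int[mu]_(t in D) f t = 0 - F 0.
  apply: integral_halfline => //.
  - apply: cvgD; last by apply: cvgM; [exact: cvg_cst|exact: e0].
    apply: cvgB; first exact: gamma_fun_cvg0.
    by apply: cvgM; [exact: cvg_cst|exact: gamma_fun_cvg0].
  - move=> t tD; apply: cvgD; last first.
      by apply: cvgM; [exact: cvg_cst|exact: continuous_expRM].
    have g1 : gamma_fun (x + 1) z @[z --> t] --> gamma_fun (x + 1) t.
      exact: gamma_fun_continuous.
    have g2 : gamma_fun x z @[z --> t] --> gamma_fun x t.
      exact: gamma_fun_continuous.
    by apply: cvgB; [exact: g1|apply: cvgM; [exact: cvg_cst|exact: g2]].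
  - rewrite (_ : 0 = - 0 - K * 0 :> R); last by rewrite mulr0 subr0 oppr0.
    apply: cvgB; last by apply: cvgM; [exact: cvg_cst|exact: ey].
    apply: cvgN; apply: (@squeeze_cvgr _ _ _ _ (cst 0) (fun t => C' * e t)).
    + near=> t; have t0 : 0 <= t by near: t; exact: nbhs_pinfty_ge.
      by rewrite /= mulr_ge0 ?powR_ge0 ?expR_ge0//= HC'.
    + exact: cvg_cst.
    + by rewrite -(mulr0 C'); apply: cvgM; [exact: cvg_cst|exact: ey].
  - apply: cvgB; last by apply: cvgM; [exact: cvg_cst|exact: e0].
    by apply: cvgN; have := gamma_fun_cvg0 x1'; rewrite /gamma_fun addrK.
have Ig := integrable_gamma_fun x1; have Ig' := integrable_gamma_fun x1'.
have IxG : igr (fun t => x * gamma_fun x t).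
  exact: halfline_integrableZ.
have IKe : igr (fun t => K / 2 * e t).
  exact: halfline_integrableZ.
have IB : igr (fun t => gamma_fun (x + 1) t - x * gamma_fun x t).
  exact: halfline_integrableB.
move: E; rewrite /f RintegralD// RintegralB// !RintegralZl// Ee.
rewrite /F /e powR0 ?gt_eqF//; last by lra.
rewrite mul0r oppr0 mulr0 expR0 -!GammaE => E; lra.
Unshelve. all: by end_near. Qed.

Lemma Gamma1 : Gamma 1 = 1 :> R.
Proof.
have [_] := @integral_expRNM 1 ltr01; rewrite invr1 => E.
rewrite -[RHS]E /Gamma; apply: eq_Rintegral => t _.
by rewrite subrr powRr0 mul1r mulN1r.
Qed.

Lemma Gamma_fact n : Gamma n.+1%:R = n`!%:R :> R.
Proof.
elim: n => [|n IH]; first exact: Gamma1.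
rewrite -natr1 GammaS ?IH; last by rewrite ler1n.
by rewrite factS natrM.
Qed.

(** On ]1, 2[ the integrand is at least exp(-2), since t^(x - 1) >= 1 there. *)
Lemma Gamma_gt0 x : 1 <= x -> 0 < Gamma x.
Proof.
move=> x1; have Ig := integrable_gamma_fun x1.
have : ((expR (- 2))%:E * mu (`]1%R, 2%R[%classic : set R) <=
    \int[mu]_(t in D) (gamma_fun x t)%:E)%E.
  apply: ge0_integral_ge_const => //.
  - by move=> t /=; rewrite !in_itv/= andbT => /andP[/(lt_trans ltr01)].
  - by move=> t _; rewrite lee_fin mulr_ge0 ?powR_ge0 ?expR_ge0.
  - move=> t /=; rewrite in_itv/= => /andP[t1 t2]; rewrite lee_fin /gamma_fun.
    rewrite -[leLHS]mul1r; apply: ler_pM; rewrite ?expR_ge0//.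
      by rewrite -{1}(powRr0 t); apply: ler_powR; [exact: ltW|rewrite subr_ge0].
    by rewrite ler_expR lerN2 ltW.
rewrite lebesgue_measure_oo ifT; last by lra.
rewrite -[X in (_ <= X)%E]fineK; last exact: integrable_fin_num.
rewrite -EFinM lee_fin => /(lt_le_trans _); apply.
by rewrite mulr_gt0 ?expR_gt0//; lra.
Qed.

(** The right side is the tangent at z = 1 of a concave power; the inequality is Young's for z^theta
    and 1. *)
Lemma powR_le_affine (theta z : R) : 0 <= theta < 1 -> 0 <= z ->
  z `^ theta <= 1 - theta + theta * z.
Proof.
move=> /andP[]; rewrite le_eqVlt => /predU1P[<- _ _|th0 th1 z0].
  by rewrite powRr0 mul0r subr0 addr0.
have := @conjugate_powR R (z `^ theta) 1 theta^-1 (1 - theta)^-1.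
rewrite !invrK powR1 -powRrM mulfV ?gt_eqF// powRr1// mulr1 mul1r.
rewrite powR_ge0 ler01 !invr_gt0 => H.
have := H isT isT th0 ltac:(lra) ltac:(lra); lra.
Qed.

(** Under the integral t^theta is at most y^theta (1 - theta + theta t / y), the tangent bound at t
    / y. By Gamma(y + 1) = y Gamma(y) the bracket integrates to exactly Gamma(y). *)
Lemma Gamma_shift_le y (theta : R) : 1 <= y -> 0 <= theta < 1 ->
  Gamma (y + theta) <= y `^ theta * Gamma y.
Proof.
move=> y1 th; have /andP[th0 th1] := th.
have y0 : 0 < y by lra.
have Ig := integrable_gamma_fun y1.
have y1' : 1 <= y + 1 by lra.
have Ig' := integrable_gamma_fun y1'.
have Igt : igr (gamma_fun (y + theta)) by apply: integrable_gamma_fun; lra.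
have I1 : igr (fun t => (1 - theta) * gamma_fun y t).
  exact: halfline_integrableZ.
have I2 : igr (fun t => theta / y * gamma_fun (y + 1) t).
  exact: halfline_integrableZ.
have I3 : igr (fun t => (1 - theta) * gamma_fun y t + theta / y * gamma_fun (y + 1) t).
  exact: halfline_integrableD.
have -> : y `^ theta * Gamma y = y `^ theta *
    \int[mu]_(t in D) ((1 - theta) * gamma_fun y t + theta / y * gamma_fun (y + 1) t).
  rewrite RintegralD// !RintegralZl// -!GammaE GammaS//; congr (_ * _).
  by field; rewrite gt_eqF.
rewrite GammaE -RintegralZl//.
apply: le_Rintegral => //.
  exact: halfline_integrableZ.
move=> t; rewrite /= in_itv/= andbT => t0.
have -> : y `^ theta * ((1 - theta) * gamma_fun y t + theta / y * gamma_fun (y + 1) t) =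
   (y `^ theta * (1 - theta + theta * (t / y))) * gamma_fun y t.
  rewrite /gamma_fun addrK.
  have -> : t `^ y = t * t `^ (y - 1).
    by rewrite -{2}(powRr1 (ltW t0)) -powRD ?gt_eqF ?implybT// addrC subrK.
  by field; rewrite gt_eqF.
have -> : gamma_fun (y + theta) t = t `^ theta * gamma_fun y t.
  rewrite /gamma_fun (_ : y + theta - 1 = theta + (y - 1)); last by ring.
  have tn0 : t != 0 by rewrite gt_eqF.
  by rewrite powRD ?tn0 ?implybT// mulrA.
apply: ler_wpM2r; first by rewrite mulr_ge0 ?powR_ge0 ?expR_ge0.
have -> : t `^ theta = y `^ theta * (t / y) `^ theta.
  rewrite -powRM ?(ltW y0) ?divr_ge0 ?ltW//; congr (_ `^ _).
  by field; rewrite gt_eqF.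
apply: ler_wpM2l; first exact: powR_ge0.
by apply: powR_le_affine => //; rewrite divr_ge0// ltW.
Qed.

End GammaFunction.

(** * Products of Legendre eigenvalues and Gamma quotients *)

Section Coefficients.
Context {R : realType}.
Implicit Types (h k s theta : R) (q r n : nat).

Lemma leg_eigprodS n j :
  leg_eigprod n j.+1 = leg_eigprod n j * leg_eig R n j.
Proof. by rewrite /leg_eigprod big_ord_recr. Qed.

Lemma leg_eigprod_fact n j : (j <= n)%N ->
  leg_eigprod n j = (n + j)`!%:R / (n - j)`!%:R :> R.
Proof.
elim: j => [_|j IH jn].
  by rewrite /leg_eigprod big_ord0 addn0 subn0 divff// pnatr_eq0 -lt0n fact_gt0.
rewrite leg_eigprodS IH ?(ltnW jn)// addnS factS.
have -> : (n - j = (n - j.+1).+1)%N by lia.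
rewrite factS !natrM /leg_eig.
have -> : (n - j.+1).+1%:R = n%:R - j%:R :> R.
  by rewrite -natrB ?(ltnW jn)//; congr _%:R; lia.
have -> : (n + j).+1%:R = n%:R + j%:R + 1 :> R by rewrite -!natr1 natrD.
field; rewrite pnatr_eq0 -lt0n fact_gt0/= -natrB ?(ltnW jn)// pnatr_eq0.
by rewrite subn_eq0 -ltnNge.
Qed.

(** Arithmetic core of the next comparison, with Gd, Gx, Gy and Gyt standing for Gamma at x + theta,
    x, y and y + theta. The factor 2 comes from x^theta <= (2 d)^theta <= 2 d^theta. *)
Lemma shifted_quotient_le (d x y theta Gd Gx Gy Gyt : R) :
  1 <= d -> 1 <= x -> x <= 2 * d -> 1 <= y -> 0 <= theta < 1 ->
  0 < Gd -> 0 < Gx -> 0 < Gy -> 0 < Gyt ->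
  Gd <= x `^ theta * Gx -> Gyt <= y `^ theta * Gy ->
  Gd / Gy * ((d * y) `^ theta)^-1 <= 2 * (Gx / Gyt).
Proof.
move=> d1 x1 xd y1 /andP[th0 th1] Gd0 Gx0 Gy0 Gyt0 Hx Hy.
have d0 : 0 < d by lra.
have y0 : 0 < y by lra.
rewrite powRM ?(ltW d0) ?(ltW y0)//.
set P := d `^ theta; set Q := y `^ theta in Hy *.
have P0 : 0 < P by rewrite /P powR_gt0.
have Q0 : 0 < Q by rewrite /Q powR_gt0.
have xP : x `^ theta <= 2 * P.
  apply: (@le_trans _ _ ((2 * d) `^ theta)).
    by apply: ge0_ler_powR; rewrite ?nnegrE//; lra.
  rewrite powRM ?(ltW d0)// ler_wpM2r ?(ltW P0)//.
  rewrite -[leRHS]powRr1//; apply: ler_powR; lra.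
have H1 : Gd <= 2 * P * Gx.
  by apply: le_trans Hx _; rewrite ler_wpM2r// ltW.
clearbody P Q.
rewrite (_ : Gd / Gy * _ = (Gd / P) * (Q * Gy)^-1); last by field; rewrite !gt_eqF.
rewrite mulrA; apply: ler_pM.
- by rewrite divr_ge0// ltW.
- by rewrite invr_ge0 mulr_ge0// ltW.
- by rewrite ler_pdivrMr//; lra.
- by rewrite lef_pV2 ?posrE ?mulr_gt0.
Qed.

Lemma leg_eigprod_Gamma q r : (0 < q)%N -> (q <= r)%N ->
  leg_eigprod r.-1 q.-1 =
  Gamma (r%:R + q%:R - 1) / Gamma (r%:R - q%:R + 1) :> R.
Proof.
move=> q0 qr; have rq : (q.-1 <= r.-1)%N by lia.
have E1 : r%:R + q%:R - 1 = (r.-1 + q.-1).+1%:R :> R.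
  have -> : (r.-1 + q.-1).+1 = (r + q - 1)%N by lia.
  by rewrite natrB ?natrD// addn_gt0 q0 orbT.
have E2 : r%:R - q%:R + 1 = (r.-1 - q.-1).+1%:R :> R.
  have -> : (r.-1 - q.-1).+1 = (r - q).+1 by lia.
  by rewrite -natr1 natrB.
by rewrite E1 E2 !Gamma_fact leg_eigprod_fact.
Qed.

(** The left side is what interpolation between the orders q and q + 1 produces, the base of the
    power being the quotient of the two eigenvalue products. The Gamma function is shifted by theta
    twice, starting from r - q - theta + 1 and from r + q - 1. *)
Lemma Gamma_quotient_ge q r theta : (0 < q)%N -> (q <= r)%N -> 0 <= theta < 1 ->
  (theta != 0 -> (q < r)%N) ->
  (leg_eigprod r.-1 q.-1)^-1 *
    (((r%:R - q%:R) * (r%:R + q%:R - 1)) `^ theta)^-1 <=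
  2 * (Gamma (r%:R - (q%:R + theta) + 1) / Gamma (r%:R + (q%:R + theta) - 1)) :> R.
Proof.
move=> q0 qr th thq; have /andP[th0 th1] := th.
have r1 : 1 <= r%:R :> R by rewrite ler1n; lia.
have q1 : 1 <= q%:R :> R by rewrite ler1n.
have qr' : q%:R <= r%:R :> R by rewrite ler_nat.
rewrite leg_eigprod_Gamma// invf_div.
have y1 : 1 <= r%:R + q%:R - 1 :> R by lra.
have d1 : 1 <= r%:R - q%:R + 1 :> R by lra.
have [t0|tn0] := eqVneq theta 0.
  rewrite t0 powRr0 invr1 mulr1 addr0.
  have := Gamma_gt0 y1; have := Gamma_gt0 d1.
  move: (Gamma _) (Gamma _) => A B A0 B0.
  by rewrite ler_peMl// ?ler1n// divr_ge0// ltW.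
(* From here theta is nonzero, so q < r; the gap r - q >= 1 is what yields x <= 2 (r - q). *)
have {thq d1}d1 : 1 <= r%:R - q%:R :> R.
  have : q%:R + 1 <= r%:R :> R by rewrite natr1 ler_nat thq.
  lra.
pose x : R := r%:R - (q%:R + theta) + 1; pose y : R := r%:R + q%:R - 1.
have x1 : 1 <= x by rewrite /x; lra.
have xd : x <= 2 * (r%:R - q%:R) by rewrite /x; lra.
have xE : r%:R - q%:R + 1 = x + theta by rewrite /x; ring.
have yE : r%:R + (q%:R + theta) - 1 = y + theta by rewrite /y; ring.
have x1' : 1 <= x + theta by lra.
have y1' : 1 <= y + theta by rewrite /y; lra.
rewrite -/x -/y yE xE.
exact: (shifted_quotient_le d1 x1 xd y1 th (Gamma_gt0 x1') (Gamma_gt0 x1)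
  (Gamma_gt0 y1) (Gamma_gt0 y1') (Gamma_shift_le x1 th) (Gamma_shift_le y1 th)).
Qed.

(** The power of r on the left keeps growing with q although the order is capped at r - 1: once r -
    1 <= q, the degree is bounded by a number depending on q alone, and the constant B absorbs
    it. *)
Lemma leg_eigprod_ge q : exists2 B : R, 0 < B &
  forall r, (0 < r)%N -> r%:R ^+ (2 * q) <= B * leg_eigprod r.-1 (minn r.-1 q).
Proof.
elim: q => [|q [B B0 HB]].
  by exists 1 => // r r0; rewrite muln0 minn0 /leg_eigprod big_ord0 mulr1.
exists (B * q.+2%:R ^+ 2) => [|r r0]; first by rewrite mulr_gt0// exprn_gt0.
have H := HB r r0.
have r0' : 0 <= r%:R :> R by [].
have q20 : 0 <= q.+2%:R :> R by [].
have q2 : 1 <= q.+2%:R :> R by rewrite ler1n.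
have -> : (2 * q.+1 = 2 * q + 2)%N by lia.
rewrite exprD.
have [qr|rq] := ltnP q r.-1.
  have mq : minn r.-1 q = q by apply/minn_idPr; exact: ltnW.
  have mq1 : minn r.-1 q.+1 = q.+1 by apply/minn_idPr.
  rewrite mq in H; rewrite mq1 leg_eigprodS.
  have e0 := @leg_eigprod_gt0 R _ _ (ltnW qr).
  (* With x = r - 1 and x - q >= 1, the product (x - q) (q + 2) is at least x + 1 = r, and the other
     factor x + q + 1 is at least r too. *)
  have E : r%:R ^+ 2 <= q.+2%:R * leg_eig R r.-1 q.
    rewrite /leg_eig.
    have rE : r%:R = r.-1%:R + 1 :> R by rewrite natr1 prednK.
    have : q%:R + 1 <= r.-1%:R :> R by rewrite natr1 ler_nat.
    rewrite rE -!natr1; set x : R := r.-1%:R; set z : R := q%:R => xz.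
    have z0 : 0 <= z by rewrite /z.
    rewrite (_ : (z + 1 + 1) * _ = ((x - z) * (z + 2)) * (x + z + 1)); last by ring.
    rewrite expr2; apply: ler_pM; rewrite ?addr_ge0 ?/x//; first by nra.
    by rewrite -/x; lra.
  have q22 : q.+2%:R <= q.+2%:R ^+ 2 :> R by rewrite expr2 ler_peMl.
  have l0 : 0 <= leg_eig R r.-1 q.
    by rewrite -(pmulr_rge0 _ (_ : 0 < q.+2%:R)) ?ltr0n//; apply: le_trans E; exact: sqr_ge0.
  apply: (@le_trans _ _ ((B * leg_eigprod r.-1 q) * (q.+2%:R * leg_eig R r.-1 q))).
    by apply: ler_pM => //; exact: exprn_ge0.
  rewrite (_ : B * q.+2%:R ^+ 2 * _ =
     (B * leg_eigprod r.-1 q) * (q.+2%:R ^+ 2 * leg_eig R r.-1 q)); last by ring.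
  apply: ler_wpM2l; first by rewrite mulr_ge0// ltW.
  exact: ler_wpM2r.
have mq : minn r.-1 q = r.-1 by apply/minn_idPl.
have mq1 : minn r.-1 q.+1 = r.-1 by apply/minn_idPl; exact: leqW.
rewrite mq in H; rewrite mq1 mulrAC; apply: ler_pM => //.
by apply: lerXn2r; rewrite ?nnegrE// ler_nat; lia.
Qed.

End Coefficients.

(** * Real orders: projection errors on one subinterval and on a partition *)

Section InterpolatedErrors.
Context {R : realType}.
Implicit Types (a b h k s theta x y : R) (u F : R -> R) (q r n : nat).

Lemma powRDr x y1 y2 : 0 < x -> x `^ (y1 + y2) = x `^ y1 * x `^ y2.
Proof. by move=> x0; rewrite powRD// (_ : x != 0) ?implybT// gt_eqF. Qed.

Lemma powR_exprn x n theta : 0 < x ->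
  (x ^+ n) `^ theta = x `^ (n%:R * theta).
Proof. by move=> x0; rewrite -powR_mulrn ?(ltW x0)// -powRrM. Qed.

Lemma sqrtr_powR x theta : 0 <= x -> Num.sqrt x `^ (2 * theta) = x `^ theta.
Proof.
by move=> x0; rewrite -powR12_sqrt// -powRrM mulrA mulVf// mul1r.
Qed.

Lemma truncn_succ s : 0 <= s -> Num.truncn (s + 1) = (Num.truncn s).+1.
Proof.
move=> s0; have /andP[h1 h2] := truncn_itv s0.
by apply: truncn_def; rewrite -!natr1 lerD2r h1/= ltrD2r natr1.
Qed.

(** A partition with a single subinterval. Smoothness s + 1 of u means s - 1 for F, which lies
    between the integer orders q - 1 and q. The constant 16 is 8 from the K-method times 2 from the
    Gamma comparison, so it depends neither on r nor on s. *)
Lemma interval_err a b r s u u' F (h := (b - a) / 2) : a < b -> (3 <= r)%N ->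
  1 <= s -> s <= r%:R -> prim a b u u' -> prim a b u' F -> L2oo a b F ->
  ((proj_err a b (r - 2) F)%:E <=
   (16 * (h `^ (2 * s - 2) * (Gamma (r%:R - s + 1) / Gamma (r%:R + s - 1))))%:E *
   Hnorm (s + 1) a b u ^+ 2)%E.
Proof.
move=> ab r3 s1 sr pu pu' LF.
have h0 : 0 < h by rewrite /h; lra.
have s0 : 0 <= s by lra.
pose q := Num.truncn s; pose theta := s - q%:R.
have /andP[qs sq] : q%:R <= s < q.+1%:R := truncn_itv s0.
have q0 : (0 < q)%N by have := le_lt_trans s1 sq; rewrite (ltr_nat R 1 q.+1).
have qr : (q <= r)%N by have := le_trans qs sr; rewrite ler_nat.
have th : 0 <= theta < 1 by rewrite /theta subr_ge0 qs/= ltrBlDl natr1.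
have sE : s = q%:R + theta by rewrite /theta addrC subrK.
have thq : theta != 0 -> (q < r)%N.
  move=> t0; rewrite -(ltr_nat R); apply: lt_le_trans sr.
  by rewrite lt_def qs andbT -subr_eq0.
have rE : (r - 2).+1 = r.-1 by clear -r3; lia.
pose t i := if i is 0%N then a else b.
have tS n : (n < 1)%N -> t n < t n.+1 by case: n.
pose e0 : R := leg_eigprod r.-1 q.-1.
have e00 : 0 < e0.
  by apply: leg_eigprod_gt0; clear -qr; lia.
pose M0 : R := Num.sqrt (h ^+ (2 * q.-1) / e0).
have M0E : M0 ^+ 2 = h ^+ (2 * q.-1) / e0.
  by rewrite sqr_sqrtr// divr_ge0 ?exprn_ge0// ltW.
have M00 : 0 < M0 by rewrite sqrtr_gt0 divr_gt0// exprn_gt0.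
pose lam : R := (r%:R - q%:R) * (r%:R + q%:R - 1).
have q1 : 1 <= q%:R :> R by rewrite ler1n.
have qr' : q%:R <= r%:R :> R by rewrite ler_nat.
have lam0 : (q < r)%N -> 0 < lam.
  move=> qr1; apply: mulr_gt0; last by lra.
  by rewrite subr_gt0 ltr_nat.
pose X := h ^+ 2 / lam.
(* Y is the ratio M1 / M0. When q = r the eigenvalue [lam] is 0 and theta is 0, so only M0 counts;
   the value 1 keeps M1 positive. *)
pose Y : R := if (q < r)%N then Num.sqrt X else 1.
have X0 : (q < r)%N -> 0 < X by move=> /lam0 ?; rewrite divr_gt0// exprn_gt0.
have Y0 : 0 < Y by rewrite /Y; case: ifPn => // /X0; rewrite sqrtr_gt0.
have YX : Y `^ (2 * theta) = X `^ theta.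
  have [->|/thq qr1] := eqVneq theta 0; first by rewrite mulr0 !powRr0.
  by rewrite /Y qr1 sqrtr_powR// ltW// X0.
have qm : Num.truncn (s + 1) = q.+1 by rewrite truncn_succ.
have thE : s + 1 - q.+1%:R = theta by rewrite /theta -natr1; ring.
have := @piecewise_err_Hnorm R 1 t tS (r - 2) (s + 1) q.-1 q M0 (M0 * Y) u u' F.
cbv zeta; rewrite qm thE rE => H.
have {H} := H (addr_ge0 s0 ler01) ab ltac:(clear -q0; lia) pu pu' LF M00 (mulr_gt0 M00 Y0)
  ltac:(clear -qr; lia) ltac:(clear -q0; lia).
rewrite sqr_piecewise_err big_ord1/= => H.
apply: le_trans (H _ _) _ => {H}.
- case=> // _; rewrite /t/= -/h M0E -/e0 mulfVK ?gt_eqF//.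
- move=> /thq qr1; split; [by clear -qr1; lia|by clear; lia|].
  case=> // _; rewrite /t/= -/h [(M0 * Y) ^+ 2]exprMn M0E /Y qr1 sqr_sqrtr; last by rewrite ltW// X0.
  have -> : leg_eigprod r.-1 q = e0 * lam :> R.
    rewrite -{1}(prednK q0) leg_eigprodS -/e0 /leg_eig /lam; congr (_ * _).
    have -> : r%:R = r.-1%:R + 1 :> R by rewrite natr1 prednK//; clear -r3; lia.
    have -> : q%:R = q.-1%:R + 1 :> R by rewrite natr1 prednK.
    by ring.
  have -> : (2 * q = 2 * q.-1 + 2)%N by clear -q0; lia.
  rewrite exprD /X (_ : h ^+ (2 * q.-1) / e0 * (h ^+ 2 / lam) * (e0 * lam) = h ^+ (2 * q.-1) * h ^+ 2)//.
  by field; rewrite (gt_eqF e00) (gt_eqF (lam0 qr1)).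
apply: lee_wpmul2r; first exact: sqre_ge0.
rewrite lee_fin M0E [M0 * Y]mulrC mulfK ?gt_eqF// YX.
have lam00 : 0 <= lam by rewrite /lam mulr_ge0//; lra.
rewrite /X powRM ?sqr_ge0 ?invr_ge0// powR_exprn//.
have -> : 8 * (h ^+ (2 * q.-1) / e0) * (h `^ (2 * theta) * (lam^-1) `^ theta) =
   8 * (h `^ (2 * s - 2) * (e0^-1 * (lam `^ theta)^-1)).
  have -> : (lam^-1) `^ theta = (lam `^ theta)^-1.
    rewrite -powR_inv1// -powRrM mulN1r powRN//.
  have -> : h `^ (2 * s - 2) = h ^+ (2 * q.-1) * h `^ (2 * theta).
    rewrite -powR_mulrn ?(ltW h0)// -powRDr//; congr (_ `^ _).
    rewrite sE natrM -[in LHS](prednK q0) -natr1; ring.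
  by ring.
have := Gamma_quotient_ge q0 qr th thq; rewrite -/e0 -/lam -sE => HG.
have : h `^ (2 * s - 2) * (e0^-1 / lam `^ theta) <= h `^ (2 * s - 2) *
   (2 * (Gamma (r%:R - s + 1) / Gamma (r%:R + s - 1))).
  by apply: ler_wpM2l HG; exact: powR_ge0.
move: (Gamma _ / _) (h `^ _) (_ / lam `^ _) => A B C; lra.
Qed.

(** A = 1 + B stands in for the square root of B, as A^2 >= B. *)
Lemma step_pow_le x k (A B e : R) (sg q r : nat) : 0 <= x -> x <= k -> 0 < k -> 0 < B ->
  A = 1 + B -> 0 <= e -> (0 < r)%N -> r%:R ^+ (2 * q) <= B * e ->
  (x / 2) ^+ (2 * sg) <= (A * (k ^+ sg / r%:R ^+ q)) ^+ 2 * e.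
Proof.
move=> x0 xk k0 B0 AE e0 r0 H.
have rq0 : 0 < r%:R ^+ (2 * q) :> R by rewrite exprn_gt0// ltr0n.
apply: (@le_trans _ _ (k ^+ (2 * sg))).
  by apply: lerXn2r; rewrite ?nnegrE//; lra.
have -> : (A * (k ^+ sg / r%:R ^+ q)) ^+ 2 * e =
   k ^+ (2 * sg) * (A ^+ 2 * e / r%:R ^+ (2 * q)).
  rewrite !exprMn exprVn -!exprM ![(_ * 2)%N]mulnC; ring.
rewrite ler_peMr ?exprn_ge0 ?(ltW k0)// ler_pdivlMr// mul1r.
by apply: le_trans H _; rewrite ler_wpM2r// AE; nra.
Qed.

(** Here the constant may depend on s, through the orders q - 1 and q. Capping these orders at r - 1
    limits the power of k, while [leg_eigprod_ge] still supplies the full powers of r. *)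
Lemma partition_err s : 1 <= s -> exists2 C : R, 0 < C &
  forall (N : nat) (t : nat -> R) k r u u' F,
  (forall n, (n < N)%N -> t n < t n.+1) ->
  (forall n, (n < N)%N -> t n.+1 - t n <= k) -> 0 < k -> t 0%N < t N ->
  (3 <= r)%N -> prim (t 0%N) (t N) u u' -> prim (t 0%N) (t N) u' F ->
  L2oo (t 0%N) (t N) F ->
  ((piecewise_err N t (r - 2) F ^+ 2)%:E <=
   ((C * (k `^ (Num.min r%:R s - 1) / r%:R `^ (s - 1))) ^+ 2)%:E *
   Hnorm (s + 1) (t 0%N) (t N) u ^+ 2)%E.
Proof.
move=> s1; have s0 : 0 <= s by lra.
pose q := Num.truncn s; pose theta := s - q%:R.
have /andP[qs sq] : q%:R <= s < q.+1%:R := truncn_itv s0.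
have q0 : (0 < q)%N by have := le_lt_trans s1 sq; rewrite (ltr_nat R 1 q.+1).
have /andP[th0 th1] : 0 <= theta < 1 by rewrite /theta subr_ge0 qs/= ltrBlDl natr1.
have sE : s = q%:R + theta by rewrite /theta addrC subrK.
have [B0 B00 HB0] := @leg_eigprod_ge R q.-1.
have [B1 B10 HB1] := @leg_eigprod_ge R q.
pose A0 := 1 + B0; pose A1 := 1 + B1.
have A00 : 0 < A0 by rewrite /A0; lra.
have A10 : 0 < A1 by rewrite /A1; lra.
exists (3 * (A0 * (A1 / A0) `^ theta)).
  by rewrite mulr_gt0// mulr_gt0// powR_gt0// divr_gt0.
move=> N t k r u u' F tS tk k0 t0N r3 pu pu' LF.
have r0 : (0 < r)%N by clear -r3; lia.
have rR : 0 < r%:R :> R by rewrite ltr0n.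
pose s0' := minn r.-1 q.-1; pose s1' := minn r.-1 q.
pose M0 : R := A0 * (k ^+ s0' / r%:R ^+ q.-1).
pose M1 : R := A1 * (k ^+ s1' / r%:R ^+ q).
have M00 : 0 < M0 by rewrite mulr_gt0// divr_gt0// exprn_gt0.
have M10 : 0 < M1 by rewrite mulr_gt0// divr_gt0// exprn_gt0.
have qm : Num.truncn (s + 1) = q.+1 by rewrite truncn_succ.
have thE : s + 1 - q.+1%:R = theta by rewrite /theta -natr1; ring.
have rE : (r - 2).+1 = r.-1 by clear -r3; lia.
have eig0 j : (j <= r.-1)%N -> 0 <= leg_eigprod r.-1 j :> R.
  by move=> jr; exact/ltW/leg_eigprod_gt0.
have := @piecewise_err_Hnorm R N t tS (r - 2) (s + 1) s0' s1' M0 M1 u u' F.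
cbv zeta; rewrite qm thE rE => H.
have {H} := H (addr_ge0 s0 ler01) t0N ltac:(clear -q0; lia) pu pu' LF M00 M10
  (geq_minl _ _) ltac:(rewrite /s0'; clear -q0; lia).
move=> H; apply: le_trans (H _ _) _ => {H}.
- move=> n nN; apply: (@step_pow_le _ k A0 B0) => //.
  + by rewrite subr_ge0 ltW// tS.
  + exact: tk.
  + by apply: eig0; rewrite geq_minl.
  + exact: HB0.
- move=> _; split; [exact: geq_minl|by rewrite /s1'; clear; lia|].
  move=> n nN; apply: (@step_pow_le _ k A1 B1) => //.
  + by rewrite subr_ge0 ltW// tS.
  + exact: tk.
  + by apply: eig0; rewrite geq_minl.
  + exact: HB1.
apply: lee_wpmul2r; first exact: sqre_ge0.
(* The exponent of k is a boolean read as 0 or 1: passing from order q - 1 to q gains a power of k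
   only if the degree allows it. *)
have M1M0 : M1 / M0 = (A1 / A0) * (k ^+ (r.-1 >= q) / r%:R).
  rewrite /M1 /M0; have -> : r%:R ^+ q = r%:R ^+ q.-1 * r%:R :> R.
    by rewrite -exprSr prednK.
  have -> : s1' = (s0' + (r.-1 >= q)%N)%N by rewrite /s1' /s0'; clear -q0; lia.
  rewrite exprD; field.
  by rewrite !expf_neq0 ?gt_eqF.
have -> : (M1 / M0) `^ (2 * theta) = ((M1 / M0) `^ theta) ^+ 2.
  by rewrite [2 * theta]mulrC powRrM powR_mulrn ?powR_ge0.
have kd0 : 0 < k ^+ (r.-1 >= q)%N by rewrite exprn_gt0.
have AA : 0 <= A1 / A0 by rewrite divr_ge0// ltW.
rewrite M1M0 powRM ?divr_ge0 ?(ltW kd0) ?(ltW rR) ?(ltW A10) ?(ltW A00)//.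
have -> : (k ^+ (r.-1 >= q)%N / r%:R) `^ theta =
    k `^ ((r.-1 >= q)%N%:R * theta) / r%:R `^ theta.
  rewrite powRM ?invr_ge0 ?(ltW kd0) ?(ltW rR)// powR_exprn//; congr (_ * _).
  by rewrite -powR_inv1 ?(ltW rR)// -powRrM mulN1r powRN.
(* If q <= r - 1 then s < r and the exponent is (q - 1) + theta; otherwise r <= s and it is r - 1,
   with no fractional part. *)
have -> : k `^ (Num.min r%:R s - 1) = k ^+ s0' * k `^ ((r.-1 >= q)%N%:R * theta).
  rewrite -powR_mulrn ?(ltW k0)// -powRDr//; congr (_ `^ _).
  have [qr|rq] := leqP q r.-1.
    rewrite min_r; last first.
      apply/ltW/(lt_le_trans sq); rewrite ler_nat; clear -qr r3; lia.
    rewrite /s0'; have -> : minn r.-1 q.-1 = q.-1 by clear -qr; lia.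
    by rewrite mul1r sE -{1}(prednK q0) -natr1; ring.
  rewrite min_l; last by apply: le_trans qs; rewrite ler_nat; clear -rq; lia.
  rewrite /s0'; have -> : minn r.-1 q.-1 = r.-1 by clear -rq; lia.
  by rewrite mul0r addr0 -{1}(prednK r0) -natr1 addrK.
have -> : r%:R `^ (s - 1) = r%:R ^+ q.-1 * r%:R `^ theta.
  rewrite -powR_mulrn ?(ltW rR)// -powRDr//; congr (_ `^ _).
  by rewrite sE -{1}(prednK q0) -natr1; ring.
rewrite lee_fin /M0.
set K := k ^+ s0'; set K' := k `^ _; set Q := _ ^+ q.-1; set Q' := _ `^ theta.
set Z := _ `^ theta.
clearbody K K' Q Q' Z.
have -> : 8 * (A0 * (K / Q)) ^+ 2 * (Q' * (K' / Z)) ^+ 2 = 8 * (A0 * (K / Q) * (Q' * (K' / Z))) ^+ 2.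
  by set X := A0 * (K / Q); set Y := Q' * _; clearbody X Y; ring.
have -> : 3 * (A0 * Q') * (K * K' / (Q * Z)) = 3 * (A0 * (K / Q) * (Q' * (K' / Z))).
  by rewrite invfM; ring.
(* It remains to compare 8 with 3^2. *)
rewrite [X in _ <= X]exprMn; apply: ler_wpM2r; first exact: sqr_ge0.
lra.
Qed.

End InterpolatedErrors.

(** * Stability of the scheme *)

Section Setup.
Context {R : realType}.
Implicit Types (a b c d e x y : R) (f g u v w : R -> R).

Lemma ccontP a b f : ccont a b f <-> forall x, a <= x <= b -> forall e, 0 < e ->
  exists2 d, 0 < d & forall y, a <= y <= b -> `|y - x| < d -> `|f x - f y| < e.
Proof.
split=> [/subspace_continuousP H x xab e e0|H].
  have xab' : (`[a, b]%classic : set R) x by rewrite /= in_itv.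
  have /cvgrPdist_lt/(_ e e0) := H x xab'.
  rewrite /within /= => -[d /= d0 Hd]; exists d => // y yab yd.
  by apply: Hd; rewrite /= ?in_itv//= distrC.
apply/subspace_continuousP => x; rewrite /= in_itv/= => xab.
apply/cvgrPdist_lt => e e0; have [d d0 Hd] := H x xab e e0.
exists d => //= y yd; rewrite in_itv/= => yab.
by apply: Hd => //; rewrite distrC.
Qed.

Lemma ccont_lipschitz_comp (f : R -> R -> R -> R) (L : R) a b v w : 0 < L ->
  (forall x y : R, ccont a b (fun t => f t x y)) ->
  (forall t x1 y1 x2 y2 : R, a <= t <= b ->
     `|f t x1 y1 - f t x2 y2| <= L * (`|x1 - x2| + `|y1 - y2|)) ->
  ccont a b v -> ccont a b w -> ccont a b (fun t => f t (v t) (w t)).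
Proof.
move=> L0 fc fl /ccontP vc /ccontP wc; apply/ccontP => x xab e e0.
have e3 : 0 < e / (3 * L) by rewrite divr_gt0// mulr_gt0.
have e3' : 0 < e / 3 by rewrite divr_gt0.
have [d1 d10 H1] := vc x xab _ e3; have [d2 d20 H2] := wc x xab _ e3.
have /ccontP fc' := fc (v x) (w x); have [d3 d30 H3] := fc' x xab _ e3'.
exists (Num.min d1 (Num.min d2 d3)); first by rewrite !lt_min d10 d20.
move=> y yab; rewrite !lt_min => /and3P[y1 y2 y3].
rewrite (_ : f x _ _ - _ = (f x (v x) (w x) - f y (v x) (w x)) +
   (f y (v x) (w x) - f y (v y) (w y))); last by ring.
apply: (le_lt_trans (ler_normD _ _)).
have := fl y (v x) (w x) (v y) (w y) yab => Hl.
have {Hl} : `|f y (v x) (w x) - f y (v y) (w y)| < 2 * (e / 3).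
  apply: (le_lt_trans Hl); rewrite mulrC -ltr_pdivlMr//.
  have := H1 y yab y1; have := H2 y yab y2.
  have -> : 2 * (e / 3) / L = e / (3 * L) + e / (3 * L) by field; rewrite gt_eqF.
  lra.
by have := H3 y yab y3; lra.
Qed.

Lemma near_interior c d x e : c < d -> c <= x <= d -> 0 < e ->
  exists2 y, c < y < d & y != x /\ `|y - x| < e.
Proof.
move=> cd /andP[cx xd] e0.
have [{}xd|xd'] := ltP x d.
  pose m := Num.min e (d - x).
  have m0 : 0 < m by rewrite lt_min e0 subr_gt0.
  have me : m <= e by rewrite ge_min lexx.
  have md : m <= d - x by rewrite ge_min lexx orbT.
  clearbody m; exists (x + m / 2); first by lra.
  split; first by rewrite gt_eqF; lra.
  by rewrite addrC addKr gtr0_norm; lra.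
pose m := Num.min e (d - c).
have m0 : 0 < m by rewrite lt_min e0 subr_gt0.
have me : m <= e by rewrite ge_min lexx.
have md : m <= d - c by rewrite ge_min lexx orbT.
clearbody m; exists (x - m / 2); first by lra.
split; first by rewrite lt_eqF; lra.
by rewrite addrC addKr normrN gtr0_norm; lra.
Qed.

Lemma ccont_eq c d f g : c < d -> ccont c d f -> ccont c d g ->
  (forall x, c < x < d -> f x = g x) -> forall x, c <= x <= d -> f x = g x.
Proof.
move=> cd fc gc fg x xcd; have /ccontP H := ccontB fc gc.
apply/eqP; rewrite -subr_eq0; apply/negP => /negP; rewrite -normr_gt0 => h0.
have [dl dl0 Hd] := H x xcd _ h0.
have [y ycd [_ yx]] := near_interior cd xcd dl0.
have /andP[cy yd] := ycd.
have := Hd y; rewrite !ltW// => /(_ isT yx).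
by rewrite [f y]fg// subrr subr0 ltxx.
Qed.

(** The endpoints are the point: there v' is known as a derivative relative to [a, b], and the
    difference quotients taken inside ]c, d[ already determine it. Factoring q - q(x) through the
    root x turns these quotients into values of a polynomial g with g(x) = q'(x). *)
Lemma derivative_on_poly a b c d v v' (q : {poly R}) :
  has_derivative_on `[a, b] v v' -> a <= c -> c < d -> d <= b ->
  (forall x, c < x < d -> v x = q.[x]) ->
  forall x, c <= x <= d -> v x = q.[x] /\ v' x = q^`().[x].
Proof.
move=> dv ac cd db vq.
have vcl : forall x, c <= x <= d -> v x = q.[x].
  apply: ccont_eq => //; last exact: ccont_poly.
  exact: (ccontS ac db (has_derivative_on_ccont dv)).
move=> x xcd; split; first exact: vcl.
have : root (q - q.[x]%:P) x by rewrite /root !hornerE subrr.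
move=> /factor_theorem[g qg].
have gE y : q.[y] - q.[x] = g.[y] * (y - x).
  by have := congr1 (horner^~ y) qg; rewrite !hornerE.
have -> : q^`().[x] = g.[x].
  have := congr1 (fun p : {poly R} => p^`().[x]) qg.
  rewrite derivB derivC subr0 => ->.
  by rewrite derivM derivB derivX derivC !hornerE; ring.
apply/eqP; rewrite -subr_eq0; apply/negP => /negP; rewrite -normr_gt0 => h0.
have h2 : 0 < `|v' x - g.[x]| / 2 by rewrite divr_gt0.
have /andP[cx xd] := xcd.
have xab : (`[a, b]%classic : set R) x by rewrite /= in_itv/=; apply/andP; lra.
have [d1 d10 H1] := has_derivative_onP dv xab h2.
have /ccontP/(_ x xcd _ h2)[d2 d20 H2] := @ccont_poly R c d g.
have m0 : 0 < Num.min d1 d2 by rewrite lt_min d10.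
have [y /andP[cy yd] [yx]] := near_interior cd xcd m0.
rewrite lt_min => /andP[y1 y2].
have yab : (`[a, b]%classic : set R) y by rewrite /= in_itv/=; apply/andP; lra.
have ycd : c <= y <= d by rewrite !ltW.
have := H1 y yab yx y1; rewrite vcl// vcl// gE mulfK ?subr_eq0// => K1.
have K2 := H2 y ycd y2.
have := ler_normD (v' x - g.[y]) (g.[y] - g.[x]).
by rewrite subrKA => K3; rewrite distrC in K2; lra.
Qed.

Lemma L2oo_restrict a b c d g : a <= c -> d <= b -> L2oo a b g ->
  L2oo a b (fun x => if c < x < d then g x else 0).
Proof.
move=> ac db [mg Ig].
have m1 : measurable_fun (`]a, b[ : set R) (fun x => if c < x < d then g x else 0).
  rewrite (_ : (fun x => _) = (fun x => g x * \1_(`]c, d[%classic : set R) x)).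
    by apply: measurable_funM => //; exact: measurable_indic.
  apply/funext => x; rewrite indicE mem_oo.
  by case: ifP => _; rewrite ?mulr1 ?mulr0.
split=> //; apply: le_integrable Ig => //.
  by apply/measurable_EFinP; exact: measurable_funX.
move=> x _ /=; rewrite lee_fin !ger0_norm ?sqr_ge0//.
by case: ifP => // _; rewrite expr0n/= sqr_ge0.
Qed.

Lemma L2oo_inHn0 a b g : L2oo a b g -> inHn 0 a b g.
Proof.
move=> Lg j; rewrite leqn0 => /eqP ->; exists g; last exact/L2oo_memL2.
have lg := intgoo_locally_integrable (L2oo_intgoo Lg).
by split=> // phi _; rewrite mul1r.
Qed.

End Setup.

(** * Galerkin equations on one subinterval and the discrete Gronwall inequality *)

Section Galerkin.
Context {R : realType}.
Variables (T : R) (N : nat) (t : nat -> R).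
Hypotheses (t0 : t 0%N = 0) (tN : t N = T)
  (tS : forall n, (n < N)%N -> t n < t n.+1).

Lemma partition_disjoint (m n : 'I_N) (x : R) : t m < x < t m.+1 ->
  t n < x < t n.+1 -> m = n.
Proof.
move=> /andP[m1 m2] /andP[n1 n2]; apply/val_inj/eqP.
rewrite eqn_leq; apply/andP; split; rewrite leqNgt; apply/negP => lt.
  have := @partition_le R N t tS n.+1 m lt (ltnW (ltn_ord m)).
  by move/(lt_le_trans n2)/(lt_trans m1); rewrite ltxx.
have := @partition_le R N t tS m.+1 n lt (ltnW (ltn_ord n)).
by move/(lt_le_trans m2)/(lt_trans n1); rewrite ltxx.
Qed.

(** A polynomial on one subinterval, extended by 0, is an admissible test function, as the test
    space carries no continuity condition at the nodes. *)
Lemma galerkin_local (W G : R -> R) (r : 'I_N -> nat) :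
  (forall phi : R -> R, inS 0 T t (fun n => (r n - 2)%N) phi ->
     \sum_(n < N) \int[lebesgue_measure]_(x in `]t n, t n.+1[) (W x * phi x) =
     \sum_(n < N) \int[lebesgue_measure]_(x in `]t n, t n.+1[) (G x * phi x)) ->
  forall (n : 'I_N) (phi : {poly R}), (size phi <= (r n - 2).+1)%N ->
  pairing (t n) (t n.+1) W phi = pairing (t n) (t n.+1) G phi.
Proof.
move=> H n phi sphi.
have [n0 nn nN] := partition_itv tS n; rewrite t0 in n0; rewrite tN in nN.
pose psi x := if t n < x < t n.+1 then phi.[x] else 0.
have E (w : R -> R) : \sum_(m < N) \int[lebesgue_measure]_(x in `]t m, t m.+1[) (w x * psi x) =
    pairing (t n) (t n.+1) w phi.
  rewrite (bigD1 n)//= [X in _ + X]big1 ?addr0.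
    by apply: eq_intoo => x xn; rewrite /psi xn.
  move=> m mn; rewrite -[RHS](intoo0 (t m) (t m.+1)); apply: eq_intoo => x xm.
  rewrite /psi; case: ifP => [xn|]; last by rewrite mulr0.
  by rewrite (partition_disjoint xm xn) eqxx in mn.
rewrite -!E; apply: H; split.
  apply/L2oo_inHn0/L2oo_restrict => //.
  exact/L2oo_ccont/ccont_poly.
move=> m; have [->|mn] := eqVneq m n.
  by exists phi => // x xn; rewrite /psi xn.
exists 0 => [|x xm]; first by rewrite size_poly0.
rewrite horner0 /psi; case: ifP => // xn.
by rewrite (partition_disjoint xm xn) eqxx in mn.
Qed.

(** Induction over the nodes: 1 + c k_n <= exp(c k_n), and the exponentials multiply up to exp(c
    t_n), whatever the number of subintervals. *)
Lemma gronwall (E : nat -> R) (Y Z : 'I_N -> R) (c B : R) : 0 <= c -> 0 <= B ->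
  E 0%N = 0 -> (forall n, 0 <= Z n) ->
  (forall n : 'I_N, E n.+1 <= Y n) ->
  (forall n : 'I_N, Y n <= (1 + c * (t n.+1 - t n)) * (E n + B * Z n)) ->
  forall n, Y n <= expR (c * T) * B * \sum_(m < N) Z m.
Proof.
move=> c0 B0 E0 Z0 EY YE.
pose S k := \sum_(m < N | (m < k)%N) Z m.
have S0 k : 0 <= S k by apply: sumr_ge0.
have SS (n : 'I_N) : S n.+1 = S n + Z n.
  rewrite /S (bigD1 n)/=; last by rewrite ltnSn.
  rewrite addrC; congr (_ + _); apply: eq_bigl => m.
  by rewrite ltnS [(m < n)%N]ltn_neqAle andbC.
have step (n : 'I_N) : E n <= expR (c * t n) * B * S n ->
    Y n <= expR (c * t n.+1) * B * S n.+1.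
  move=> En; have [n0 nn _] := partition_itv tS n; rewrite t0 in n0.
  have k0 : 0 <= c * (t n.+1 - t n) by rewrite mulr_ge0// subr_ge0 ltW.
  have e1 : 1 <= expR (c * t n) by rewrite -expR0 ler_expR mulr_ge0.
  have BZ : 0 <= B * Z n by rewrite mulr_ge0.
  apply: (le_trans (YE n)).
  apply: (@le_trans _ _ ((1 + c * (t n.+1 - t n)) * (expR (c * t n) * B * S n.+1))).
    apply: ler_wpM2l; first by rewrite addr_ge0.
    rewrite SS mulrDr -[_ * B * Z n]mulrA; apply: lerD => //.
    by rewrite ler_peMl.
  have -> : expR (c * t n.+1) = expR (c * (t n.+1 - t n)) * expR (c * t n).
    by rewrite -expRD; congr expR; ring.
  rewrite -!mulrA [expR (c * t n) * _]mulrA; apply: ler_wpM2r.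
    by rewrite !mulr_ge0 ?expR_ge0.
  exact: expR_ge1Dx.
have En k : (k <= N)%N -> E k <= expR (c * t k) * B * S k.
  elim: k => [_|k IH kN].
    by rewrite E0 !mulr_ge0 ?expR_ge0.
  exact: le_trans (EY (Ordinal kN)) (step (Ordinal kN) (IH (ltnW kN))).
move=> n; apply: (le_trans (step n (En n (ltnW (ltn_ord n))))).
have [_ _ nN] := partition_itv tS n; rewrite tN in nN.
apply: ler_pM => //.
- by rewrite mulr_ge0// expR_ge0.
- by apply: ler_wpM2r => //; rewrite ler_expR; apply: ler_wpM2l.
rewrite /S [X in _ <= X](bigID (fun m : 'I_N => (m < n.+1)%N))/= lerDl.
by apply: sumr_ge0.
Qed.

End Galerkin.

(** * Summing the local errors over the partition *)

Section Stability.
Context {R : realType}.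

Lemma Hnorm_nat m (a b : R) v : Hnorm m%:R a b v = Hn_norm m a b v.
Proof. by rewrite /Hnorm natrK subrr eqxx. Qed.

Lemma Hn_normB_sqr m (T : R) (u u' F U : R -> R) : 0 < T -> (m <= 2)%N ->
  prim 0 T u u' -> prim 0 T u' F -> L2oo 0 T F -> inHn 2 0 T U ->
  [/\ (forall i, (i <= m)%N ->
        L2oo 0 T (fun x => nth F [:: u; u'; F] i x - wder 0 T i U x)) &
    (Hn_norm m 0 T (u \- U)%R ^+ 2)%E =
    (\sum_(i < m.+1)
     intoo 0 T (fun x => (nth F [:: u; u'; F] i x - wder 0 T i U x) ^+ 2))%:E].
Proof.
move=> T0 m2 pu pu' LF HU; pose D i := nth F [:: u; u'; F] i.
have LD i : (i <= 2)%N -> L2oo 0 T (D i).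
  by case: i => [|[|[|]]]// _; [exact/L2oo_ccont/(prim_ccont pu)|exact/L2oo_ccont/(prim_ccont pu')].
have [Hu wu] : inHn 2 0 T u /\ forall i, (i <= 2)%N -> aeoo 0 T (wder 0 T i u) (D i).
  by apply: prim_inHn => //; case=> [|[|[]]].
have [He we] := inHn_lin (-1) (ltW T0) Hu HU.
have eE : u \- U = (fun x => u x + -1 * U x).
  by apply/funext => x; rewrite mulN1r.
have Hem : inHn m 0 T (u \- U) by rewrite eE => j jm; apply: He; exact: leq_trans jm m2.
have LB i : (i <= m)%N -> L2oo 0 T (fun x => D i x - wder 0 T i U x).
  move=> im; have i2 := leq_trans im m2; apply: L2ooB; first exact: LD.
  by have [] := inHn_wder HU i2.
split=> //; rewrite (Hn_norm_sqrt Hem LB).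
  rewrite -EFin_expe sqr_sqrtr//; apply: sumr_ge0 => i _; exact: intoo_sqr_ge0.
move=> i im; have i2 := leq_trans im m2; rewrite eE.
apply: aeoo_trans (we i i2) _.
apply: (aeoo_trans (aeoo_comp2 (fun _ y z => y + -1 * z) (wu i i2) (aeoo_refl _ _ _))).
by apply: aeooW => x _; rewrite mulN1r.
Qed.

Lemma wder_piece (T c d : R) (U : R -> R) (q : {poly R}) j :
  inHn 2 0 T U -> 0 <= c -> d <= T -> (j <= 2)%N ->
  (forall x, c < x < d -> U x = q.[x]) ->
  aeoo c d (wder 0 T j U) (fun x => q^`(j).[x]).
Proof.
move=> HU c0 dT j2 Uq; have [wU _] := inHn_wder HU j2.
apply: weak_derivative_unique (weak_derivative_restrict c0 dT wU) _.
pose D i x := (q^`(i)).[x].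
apply: (@eq_weak_derivative R c d j (D 0%N) U (D j)) => //.
  by move=> x /Uq ->.
apply: prim_weak_derivative; [exact/intgoo_ccont/ccont_poly|exact/intgoo_ccont/ccont_poly|].
by move=> i _; exact: poly_chain.
Qed.

Section Scheme.
Variables (T L k0 : R) (f : R -> R -> R -> R) (u0 u1 : R) (u : R -> R).
Hypotheses (T0 : 0 < T) (L0 : 0 < L) (k01 : k0 <= 1)
  (k0L : (2 + 4 * L ^+ 2) * k0 <= 2^-1).
Hypothesis f_cont :
  forall a b : R, {within `[0, T], continuous (fun t : R => f t a b : R)}.
Hypothesis f_lip : forall t a1 b1 a2 b2 : R, 0 <= t <= T ->
  `|f t a1 b1 - f t a2 b2| <= L * (`|a1 - a2| + `|b1 - b2|).
Variables (u' : R -> R) (N : nat) (t : nat -> R) (r : 'I_N -> nat) (U U' : R -> R).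
Let F x := f x (u x) (u' x).
Hypotheses (du : has_derivative_on `[0, T] u u')
  (du' : has_derivative_on `[0, T] u' F) (uu0 : u 0 = u0) (uu1 : u' 0 = u1).
Hypotheses (t0 : t 0%N = 0) (tN : t N = T)
  (tS : forall n, (n < N)%N -> t n < t n.+1)
  (tk : forall n, (n < N)%N -> t n.+1 - t n <= k0)
  (r3 : forall n, (3 <= r n)%N).
Hypotheses (HU : inHn 2 0 T U) (dU : has_derivative_on `[0, T] U U')
  (UU0 : U 0 = u0) (UU1 : U' 0 = u1).
Variable q : 'I_N -> {poly R}.
Hypotheses (sq : forall n, (size (q n) <= (r n).+1)%N)
  (Uq : forall (n : 'I_N) x, t n < x < t n.+1 -> U x = (q n).[x]).
Hypothesis gal : forall phi : R -> R, inS 0 T t (fun n => (r n - 2)%N) phi ->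
  \sum_(n < N) \int[lebesgue_measure]_(x in `]t n, t n.+1[)
            (wder 0 T 2 U x * phi x) =
  \sum_(n < N) \int[lebesgue_measure]_(x in `]t n, t n.+1[)
            (f x (U x) (U' x) * phi x).

Let kk (n : 'I_N) := t n.+1 - t n.
Let H (n : 'I_N) := proj_err (t n) (t n.+1) (r n - 2) F.
(** Bounds the squared norms of eta and eta' on the n-th subinterval: the quantity N of
    [local_error]. *)
Let Z (n : 'I_N) := 2 * (kk n / 2) ^+ 2 / (((r n)%:R - 1) * ((r n)%:R - 2)) * H n.
Let cc := 2 + 4 * L ^+ 2.

Lemma solution_ccont : [/\ ccont 0 T u, ccont 0 T u' & ccont 0 T F].
Proof.
have cu := has_derivative_on_ccont du; have cu' := has_derivative_on_ccont du'.
by split=> //; exact: (@ccont_lipschitz_comp _ f L).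
Qed.

Lemma solution_prim : prim 0 T u u' /\ prim 0 T u' F.
Proof.
have [_ cu' cF] := solution_ccont.
by split; apply: has_derivative_on_prim.
Qed.

Lemma partition_itv0 (n : 'I_N) : [/\ 0 <= t n, t n < t n.+1 & t n.+1 <= T].
Proof. by have := partition_itv tS n; rewrite t0 tN. Qed.

Lemma piece_closed (n : 'I_N) x : t n <= x <= t n.+1 ->
  U x = (q n).[x] /\ U' x = (q n)^`().[x].
Proof.
have [n0 nn nT] := partition_itv0 n.
by apply: (derivative_on_poly dU n0 nn nT) => y; exact: Uq.
Qed.

(** [local_error] on the n-th subinterval, with nodal values expressed through U and U', which
    neighbouring subintervals share. This makes the chaining in [gronwall] possible. *)
Lemma interval_stability (n : 'I_N) :
  let e x := u x - U x in let e' x := u' x - U' x in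
  exists Y, [/\ 0 <= Y,
    Y <= (1 + 2 * cc * kk n) *
      (e (t n) ^+ 2 + e' (t n) ^+ 2 + 4 * L ^+ 2 * Z n),
    e (t n.+1) ^+ 2 + e' (t n.+1) ^+ 2 <= Y,
    intoo (t n) (t n.+1) (fun x => (u x - (q n).[x]) ^+ 2) +
    intoo (t n) (t n.+1) (fun x => (u' x - (q n)^`().[x]) ^+ 2) <=
      2 * Z n + 2 * kk n * Y &
    intoo (t n) (t n.+1) (fun x => (F x - (q n)^`()^`().[x]) ^+ 2) <=
      2 * H n + 8 * L ^+ 2 * (Z n + kk n * Y)].
Proof.
move=> e e'; have [n0 nn nT] := partition_itv0 n.
have [cu cu' cF] := solution_ccont; have [pu pu'] := solution_prim.
pose G x := f x (q n).[x] (q n)^`().[x].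
have fcn x y : ccont (t n) (t n.+1) (fun s => f s x y).
  by apply: (ccontS n0 nT); exact: f_cont.
have fln s x1 y1 x2 y2 : t n <= s <= t n.+1 ->
    `|f s x1 y1 - f s x2 y2| <= L * (`|x1 - x2| + `|y1 - y2|).
  move=> /andP[s1 s2]; apply: f_lip.
  by rewrite (le_trans n0 s1) (le_trans s2 nT).
have cG : ccont (t n) (t n.+1) G.
  by apply: (ccont_lipschitz_comp L0 fcn fln); exact: ccont_poly.
have galn (phi : {poly R}) : (size phi <= (r n).-1)%N ->
    pairing (t n) (t n.+1) (fun x => (q n)^`()^`().[x] - G x) phi = 0.
  move=> sphi; have [_ LW] := inHn_wder HU (leqnn 2).
  have LWn := L2ooS n0 nT LW.
  have Lq : L2oo (t n) (t n.+1) (fun x => (q n)^`()^`().[x]) by exact/L2oo_ccont/ccont_poly.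
  have Lphi : L2oo (t n) (t n.+1) (horner phi) by exact/L2oo_ccont/ccont_poly.
  have sphi' : (size phi <= (r n - 2).+1)%N.
    by have := r3 n; move: sphi; clear; lia.
  have := galerkin_local t0 tN tS gal sphi'; rewrite /pairing.
  (* The second weak derivative of U and the second derivative of its polynomial piece agree only
     almost everywhere, which suffices under the integral. *)
  rewrite (@aeoo_intoo _ _ _ _ (fun x => (q n)^`()^`().[x] * phi.[x])); last first.
  - apply: (aeoo_comp2 (fun _ y z => y * z) _ (aeoo_refl _ _ _)).
    exact: (@wder_piece T _ _ U (q n) 2 HU n0 nT isT (@Uq n)).
  - by apply: intgoo_meas; apply: (L2ooM Lq Lphi).
  - by apply: intgoo_meas; apply: (L2ooM LWn Lphi).
  rewrite (@eq_intoo _ (t n) (t n.+1) (fun x => f x (U x) (U' x) * _) (fun x => G x * phi.[x])); last first.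
    move=> x /andP[x1 x2]; have xn : t n <= x <= t n.+1 by rewrite !ltW.
    by rewrite /G; have [-> ->] := piece_closed xn.
  move=> E; rewrite (@eq_intoo _ _ _ _ (fun x => (q n)^`()^`().[x] * phi.[x] - G x * phi.[x])).
    rewrite intooB ?E ?subrr//; first exact: L2ooM.
    by apply: L2ooM => //; exact: L2oo_ccont.
  by move=> x _; rewrite mulrBl.
have lipn x : t n < x < t n.+1 ->
    `|F x - G x| <= L * (`|u x - (q n).[x]| + `|u' x - (q n)^`().[x]|).
  by move=> /andP[x1 x2]; apply: fln; rewrite !ltW.
have kn0 : 0 < kk n by rewrite /kk subr_gt0.
have knk : kk n <= k0 by exact: tk.
have kn1 : kk n <= 1 by exact: le_trans k01.
have ckn : (2 + 4 * L ^+ 2) * kk n <= 2^-1.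
  apply: le_trans k0L; apply: ler_wpM2l => //.
  by rewrite addr_ge0// mulr_ge0// sqr_ge0.
have := @local_error R (t n) (t n.+1) nn L (r n) L0 (r3 n) u u' F G (q n)
  (primS n0 nT pu) (primS n0 nT pu') (ccontS n0 nT cF) cG (sq n) galn lipn kn1 ckn.
have [Ea Ea'] := @piece_closed n (t n) ltac:(by rewrite lexx ltW).
have [Eb Eb'] := @piece_closed n (t n.+1) ltac:(by rewrite lexx ltW).
by rewrite /e /e' Ea Ea' Eb Eb'.
Qed.

Lemma proj_errs_ge0 n : 0 <= H n.
Proof. by apply: proj_err_ge0; have [] := partition_itv0 n. Qed.

Lemma degree_ge n : 3 <= (r n)%:R :> R.
Proof. by rewrite (ler_nat R 3). Qed.

Lemma step_itv n : 0 < kk n <= 1.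
Proof.
rewrite subr_gt0 tS//= (le_trans _ k01)//; exact: tk.
Qed.

(** The 6 is the factor 2 in Z times 3, a bound for r / (r - 2) when r >= 3. The cruder bound by H
    uses steps at most 1 and is enough for the H^2 estimate. *)
Lemma Z_bounds n : [/\ 0 <= Z n, Z n <= H n &
  Z n <= 6 * ((kk n / 2) ^+ 2 / ((r n)%:R * ((r n)%:R - 1)) * H n)].
Proof.
have r1 := degree_ge n; have H0 := proj_errs_ge0 n; have /andP[kn0 kn1] := step_itv n.
rewrite /Z; set k := kk n in kn0 kn1 *; set h := H n in H0 *; set x := (r n)%:R in r1 *.
have d0 : 0 < (x - 1) * (x - 2) by rewrite mulr_gt0//; lra.
have d1 : 0 < x * (x - 1) by rewrite mulr_gt0//; lra.
have k2 : 0 <= (k / 2) ^+ 2 by exact: sqr_ge0.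
split.
- apply: mulr_ge0 => //; apply: divr_ge0; last exact: ltW.
  by apply: mulr_ge0.
- rewrite ler_piMl// ler_pdivrMr// mul1r.
  have -> : (k / 2) ^+ 2 = k ^+ 2 / 4 by field.
  have : k ^+ 2 <= 1 by rewrite expr_le1// ltW.
  have : 2 <= (x - 1) * (x - 2) by nra.
  lra.
- have Hinv : ((x - 1) * (x - 2))^-1 <= 3 * (x * (x - 1))^-1.
    rewrite ler_pdivlMr// mulrC ler_pdivrMr//; nra.
  have := ler_wpM2l (mulr_ge0 k2 H0) Hinv.
  move: ((k / 2) ^+ 2) (_^-1) (_^-1) => A B D; lra.
Qed.

(** The Gronwall constant: every local maximum Y is at most K times the sum of the Z. *)
Let K := expR (2 * cc * T) * (4 * L ^+ 2).
(** Large enough for both estimates of [stability_sums]; the factors 6 are that of [Z_bounds]. *)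
Let C := 4 * K * T * (1 + 2 * L ^+ 2) * 6 + 8 * (1 + L ^+ 2) * 6.

Lemma stability_sums :
  let S1 := \sum_(n < N) (kk n / 2) ^+ 2 / ((r n)%:R * ((r n)%:R - 1)) * H n in
  let S2 := \sum_(n < N) H n in
  \sum_(n < N) (intoo (t n) (t n.+1) (fun x => (u x - (q n).[x]) ^+ 2) +
    intoo (t n) (t n.+1) (fun x => (u' x - (q n)^`().[x]) ^+ 2)) <= C * S1 /\
  \sum_(n < N) (intoo (t n) (t n.+1) (fun x => (u x - (q n).[x]) ^+ 2) +
    intoo (t n) (t n.+1) (fun x => (u' x - (q n)^`().[x]) ^+ 2)) +
  \sum_(n < N) intoo (t n) (t n.+1) (fun x => (F x - (q n)^`()^`().[x]) ^+ 2)
    <= C * S2.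
Proof.
move=> S1 S2.
have [Y HY] := choice interval_stability.
pose E n := (u (t n) - U (t n)) ^+ 2 + (u' (t n) - U' (t n)) ^+ 2.
have cc0 : 0 <= cc by rewrite /cc addr_ge0// mulr_ge0// sqr_ge0.
have L20 : 0 <= L ^+ 2 by exact: sqr_ge0.
have Z0 n : 0 <= Z n by have [] := Z_bounds n.
pose S := \sum_(n < N) Z n.
have YK n : Y n <= K * S.
  apply: (@gronwall R T N t t0 tN tS E Y Z (2 * cc) (4 * L ^+ 2)) => //.
  - by rewrite mulr_ge0.
  - by rewrite mulr_ge0.
  - by rewrite /E t0 uu0 uu1 UU0 UU1 !subrr expr0n/= addr0.
  - by move=> m; have [] := HY m.
  - by move=> m; have [] := HY m.
have S0 : 0 <= S by exact: sumr_ge0.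
have K0 : 0 <= K by rewrite mulr_ge0 ?expR_ge0// mulr_ge0.
have kT : \sum_(n < N) kk n = T.
  rewrite /kk -(big_mkord xpredT (fun n => t n.+1 - t n)) telescope_sumr//.
  by rewrite tN t0 subr0.
(* The steps add up to T, so the uniform bound on the Y yields a sum free of the number of
   subintervals. *)
have kY : \sum_(n < N) kk n * Y n <= T * (K * S).
  rewrite -[X in X * (K * S)]kT mulr_suml; apply: ler_sum => n _.
  by apply: ler_wpM2l => //; have /andP[/ltW] := step_itv n.
have SS1 : S <= 6 * S1.
  by rewrite mulr_sumr; apply: ler_sum => n _; have [] := Z_bounds n.
have SS2 : S <= S2 by apply: ler_sum => n _; have [] := Z_bounds n.
have A1 : \sum_(n < N) (intoo (t n) (t n.+1) (fun x => (u x - (q n).[x]) ^+ 2) +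
    intoo (t n) (t n.+1) (fun x => (u' x - (q n)^`().[x]) ^+ 2)) <=
    2 * S + 2 * (T * (K * S)).
  apply: (@le_trans _ _ (\sum_(n < N) (2 * Z n + 2 * (kk n * Y n)))).
    by apply: ler_sum => n _; rewrite [2 * (kk n * _)]mulrA; have [] := HY n.
  by rewrite big_split/= -!mulr_sumr lerD2l ler_wpM2l.
have A2 : \sum_(n < N) intoo (t n) (t n.+1) (fun x => (F x - (q n)^`()^`().[x]) ^+ 2) <=
    2 * S2 + 8 * L ^+ 2 * (S + T * (K * S)).
  apply: (@le_trans _ _ (\sum_(n < N) (2 * H n + 8 * L ^+ 2 * (Z n + kk n * Y n)))).
    by apply: ler_sum => n _; have [] := HY n.
  rewrite big_split/= -!mulr_sumr lerD2l; apply: ler_wpM2l; first by rewrite mulr_ge0.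
  by rewrite big_split/= lerD2l.
have S10 : 0 <= S1 by lra.
have S20 : 0 <= S2 by lra.
move: A1 A2; set X1 := \sum_(n < N) (_ + _); set X2 := \sum_(n < N) _.
move=> A1 A2.
have P1 : 0 <= T * K by rewrite mulr_ge0// ltW.
have E1 : T * (K * S) = T * K * S by ring.
rewrite E1 in A1 A2.
have CE : C = (24 * (T * K) + 48 * (T * K) * L ^+ 2) + (48 + 48 * L ^+ 2).
  by rewrite /C; ring.
clearbody X1 X2 S S1 S2; move: CE P1 A1 A2; move: (T * K) => P CE P0 A1 A2.
have L2P : 0 <= P * L ^+ 2 by rewrite mulr_ge0.
split.
  have : P * S <= P * (6 * S1) by exact: ler_wpM2l.
  have : 0 <= P * L ^+ 2 * S1 by rewrite mulr_ge0.
  have : 0 <= P * S1 by rewrite mulr_ge0.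
  have : 0 <= L ^+ 2 * S1 by rewrite mulr_ge0.
  rewrite CE => *; lra.
have : P * S <= P * S2 by exact: ler_wpM2l.
have : L ^+ 2 * S <= L ^+ 2 * S2 by exact: ler_wpM2l.
have : P * L ^+ 2 * S <= P * L ^+ 2 * S2 by exact: ler_wpM2l.
have : 0 <= P * L ^+ 2 * S2 by rewrite mulr_ge0.
have : 0 <= P * S2 by rewrite mulr_ge0.
have : 0 <= L ^+ 2 * S2 by rewrite mulr_ge0.
rewrite CE => *; lra.
Qed.

Lemma piece_sqr_errs i : (i <= 2)%N ->
  L2oo 0 T (fun x => nth F [:: u; u'; F] i x - wder 0 T i U x) ->
  intoo 0 T (fun x => (nth F [:: u; u'; F] i x - wder 0 T i U x) ^+ 2) =
  \sum_(n < N) intoo (t n) (t n.+1)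
    (fun x => (nth F [:: u; u'; F] i x - (q n)^`(i).[x]) ^+ 2).
Proof.
move=> i2 [mD ID].
have := @intoo_partition R N t tS (fun x => (nth F [:: u; u'; F] i x - wder 0 T i U x) ^+ 2).
rewrite t0 tN => -> //; apply: eq_bigr => n _.
have [n0 nn nT] := partition_itv0 n; have [cu cu' cF] := solution_ccont.
have mi : measurable_fun (`]t n, t n.+1[ : set R) (nth F [:: u; u'; F] i).
  apply: L2oo_meas; apply: L2oo_ccont; apply: (ccontS n0 nT).
  by move: i i2 {mD ID} => [|[|[|]]].
apply: aeoo_intoo_sqr.
- by apply: measurable_funS mD => //; exact: subset_itvW.
- apply: measurable_funB => //; apply: L2oo_meas; apply: L2oo_ccont.
  exact: ccont_poly.
apply: (aeoo_comp2 (fun _ y z => y - z) (aeoo_refl _ _ _)).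
exact: (wder_piece HU n0 nT i2 (@Uq n)).
Qed.

Lemma stability_Hnorms :
  (Hnorm 1 0 T (u \- U)%R ^+ 2 <=
    (C * \sum_(n < N) (kk n / 2) ^+ 2 / ((r n)%:R * ((r n)%:R - 1)) * H n)%:E)%E /\
  (Hnorm 2 0 T (u \- U)%R ^+ 2 <= (C * \sum_(n < N) H n)%:E)%E.
Proof.
have [pu pu'] := solution_prim; have [_ _ cF] := solution_ccont.
have LF : L2oo 0 T F by exact: L2oo_ccont.
have [S1 S2] := stability_sums; rewrite big_split/= in S1 S2.
have E m (m2 : (m <= 2)%N) := (Hn_normB_sqr T0 m2 pu pu' LF HU).2.
have D i (i2 : (i <= 2)%N) :=
  piece_sqr_errs i2 ((Hn_normB_sqr T0 (leqnn 2) pu pu' LF HU).1 i i2).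
split.
  rewrite (_ : Hnorm 1 0 T _ = Hn_norm 1 0 T (u \- U)); last exact: (Hnorm_nat 1).
  by rewrite E// lee_fin !big_ord_recr big_ord0/= add0r (D 0%N isT) (D 1%N isT).
rewrite (_ : Hnorm 2 0 T _ = Hn_norm 2 0 T (u \- U)); last exact: (Hnorm_nat 2).
rewrite E// lee_fin !big_ord_recr big_ord0/= add0r.
by rewrite (D 0%N isT) (D 1%N isT) (D 2 isT).
Qed.

End Scheme.

Lemma step_le_maxstep N (t : nat -> R) n : (n < N)%N -> step t n <= maxstep N t.
Proof.
move=> nN; exact: (le_bigmax 0 (fun m : 'I_N => step t m) (Ordinal nN)).
Qed.

Lemma stability (T L k0 : R) (f : R -> R -> R -> R) :
  0 < T -> 0 < L -> k0 <= 1 -> (2 + 4 * L ^+ 2) * k0 <= 2^-1 ->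
  (forall a b : R, {within `[0, T], continuous (fun t : R => f t a b : R)}) ->
  (forall t a1 b1 a2 b2 : R, 0 <= t <= T ->
     `|f t a1 b1 - f t a2 b2| <= L * (`|a1 - a2| + `|b1 - b2|)) ->
  exists2 C : R, 0 < C &
  forall (u0 u1 : R) (u : R -> R), exact_solution T f u0 u1 u ->
  exists u' F : R -> R, [/\ prim 0 T u u', prim 0 T u' F, L2oo 0 T F &
  forall (N : nat) (t : nat -> R), is_partition T N t -> maxstep N t <= k0 ->
  forall r : 'I_N -> nat, (forall n, (3 <= r n)%N) ->
  forall U : R -> R, C1CPG_solution T f u0 u1 t r U ->
  (Hnorm 1 0 T (u \- U)%R ^+ 2 <=
    (C * \sum_(n < N) (step t n / 2) ^+ 2 / ((r n)%:R * ((r n)%:R - 1)) *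
       proj_err (t n) (t n.+1) (r n - 2) F)%:E)%E /\
  (Hnorm 2 0 T (u \- U)%R ^+ 2 <=
    (C * \sum_(n < N) proj_err (t n) (t n.+1) (r n - 2) F)%:E)%E].
Proof.
move=> T0 L0 k01 k0L fc fl; pose K := expR (2 * (2 + 4 * L ^+ 2) * T) * (4 * L ^+ 2).
have L2 : 0 < L ^+ 2 by rewrite exprn_gt0.
have K0 : 0 < K by rewrite mulr_gt0 ?expR_gt0// mulr_gt0.
exists (4 * K * T * (1 + 2 * L ^+ 2) * 6 + 8 * (1 + L ^+ 2) * 6).
  have : 0 < K * T * (1 + 2 * L ^+ 2) by apply: mulr_gt0; [exact: mulr_gt0|lra].
  clearbody K; lra.
move=> u0 u1 u [u' [du du' uu0 uu1]].
have [_ _ cF] := solution_ccont L0 fc fl du du'.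
have [pu pu'] := solution_prim L0 fc fl du du'.
exists u', (fun x => f x (u x) (u' x)); split=> //; first exact: L2oo_ccont.
move=> N t [t0 tN tS] tk r r3 U [[HU HP] [U' [dU UU0 UU1 gal]]].
have /choice[q Hq] (n : 'I_N) : exists q : {poly R}, (size q <= (r n).+1)%N /\
    forall x, t n < x < t n.+1 -> U x = q.[x].
  by have [q sq Uq] := HP n; exists q.
have sq n := (Hq n).1; have Uq n := (Hq n).2.
have tk' n (nN : (n < N)%N) := le_trans (step_le_maxstep t nN) tk.
exact: (stability_Hnorms T0 L0 k01 k0L fc fl du du' uu0 uu1 t0 tN tS tk' r3 HU
  dU UU0 UU1 sq Uq gal).
Qed.

End Stability.

(** * From the stability bounds to the two families of estimates *)

Section Assembly.
Context {R : realType}.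

Lemma Hnorm_ge0 (s a b : R) v : (0 <= Hnorm s a b v)%E.
Proof. by rewrite /Hnorm; case: ifP => _; [exact: Hn_norm_ge0|exact: poweR_ge0]. Qed.

Lemma weighted_sum_le N (C0 C1 : R) (a b : 'I_N -> R) (X : 'I_N -> \bar R) :
  0 <= C0 -> 0 <= C1 -> (forall n, 0 <= b n) -> (forall n, (0 <= X n)%E) ->
  (forall n, ((a n)%:E <= (C1 * b n)%:E * X n)%E) ->
  ((C0 * \sum_(n < N) a n)%:E <= (C0 * C1)%:E * \sum_(n < N) (b n)%:E * X n)%E.
Proof.
move=> C00 C10 b0 X0 H; rewrite !EFinM -muleA lee_wpmul2l ?lee_fin//.
rewrite -sumEFin ge0_sume_distrr; last by move=> n _; rewrite mule_ge0 ?lee_fin.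
by apply: lee_sum => n _; rewrite muleA -EFinM.
Qed.

Lemma Gamma_quotient_ge0 (r : nat) (s : R) : (3 <= r)%N -> 1 <= s -> s <= r%:R ->
  0 <= Gamma (r%:R - s + 1) / Gamma (r%:R + s - 1).
Proof.
move=> r3 s1 sr; have r1 : 3 <= r%:R :> R by rewrite (ler_nat R 3).
by apply: divr_ge0; apply/ltW/Gamma_gt0; lra.
Qed.

Lemma sqr_step_le (r : nat) (x k : R) : (3 <= r)%N -> 0 <= x -> x <= k ->
  (x / 2) ^+ 2 / (r%:R * (r%:R - 1)) <= (k / r%:R) ^+ 2.
Proof.
move=> r3 x0 xk; have r1 : 3 <= r%:R :> R by rewrite (ler_nat R 3).
move: (r%:R) r1 => y y3.
have y0 : 0 < y * (y - 1) by rewrite mulr_gt0//; lra.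
have yi : (y * (y - 1))^-1 <= 4 * (y ^+ 2)^-1.
  rewrite ler_pdivlMr ?exprn_gt0//; last by lra.
  rewrite mulrC ler_pdivrMr//; nra.
have xk2 : x ^+ 2 <= k ^+ 2 by apply: lerXn2r; rewrite ?nnegrE//; lra.
rewrite !exprMn [X in _ <= _ * X]exprVn.
have -> : (2^-1 : R) ^+ 2 = 4^-1 by field.
have x2 : 0 <= x ^+ 2 by exact: sqr_ge0.
have H1 := ler_wpM2l x2 yi.
have y2 : 0 <= (y ^+ 2)^-1 by rewrite invr_ge0 sqr_ge0.
have H2 := ler_wpM2r y2 xk2.
move: H1 H2; move: (y ^+ 2)^-1 (y * (y - 1))^-1 => A B H1 H2; lra.
Qed.

(** 1 + C replaces the square root of C, since (1 + C)^2 >= C. *)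
Lemma lee_of_sqr (A C e : R) (N X : \bar R) : 0 <= A -> 0 <= C ->
  (0 <= X)%E -> (N ^+ 2 <= (C * e)%:E)%E -> (e%:E <= (A ^+ 2)%:E * X ^+ 2)%E ->
  (N <= ((1 + C) * A)%:E * X)%E.
Proof.
move=> A0 C0 X0 HN He.
have B0 : 0 <= (1 + C) * A by rewrite mulr_ge0// addr_ge0.
apply: lee_sqrE; first by rewrite mule_ge0 ?lee_fin.
apply: (le_trans HN).
have -> : ((((1 + C) * A)%:E * X) ^+ 2 = (((1 + C) * A) ^+ 2)%:E * X ^+ 2)%E.
  by rewrite expe2 muleACA -EFinM.
apply: (@le_trans _ _ (C%:E * ((A ^+ 2)%:E * X ^+ 2))%E).
  by rewrite EFinM; apply: lee_wpmul2l; rewrite ?lee_fin.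
rewrite muleA -EFinM; apply: lee_wpmul2r; first exact: sqre_ge0.
rewrite lee_fin exprMn; apply: ler_wpM2r; first exact: sqr_ge0.
by have := sqr_ge0 C; rewrite sqrrD expr1n; lra.
Qed.

End Assembly.

Theorem theorem1 (R : realType) (T : R) (f : R -> R -> R -> R) (L : R)
  (T_gt0 : 0 < T) (L_gt0 : 0 < L)
  (f_cont : forall a b : R, {within `[0, T], continuous (fun t : R => f t a b : R)})
  (f_lip : forall t a1 b1 a2 b2 : R, 0 <= t <= T ->
     `|f t a1 b1 - f t a2 b2| <= L * (`|a1 - a2| + `|b1 - b2|)) :
  exists2 k0 : R, 0 < k0 &
  (exists2 C : R, 0 < C &
     forall (u0 u1 : R) (u : R -> R), exact_solution T f u0 u1 u ->
     inH 2 0 T u ->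
     forall (N : nat) (t : nat -> R), is_partition T N t ->
     maxstep N t <= k0 ->
     forall r : 'I_N -> nat, (forall n, (3 <= r n)%N) ->
     forall U : R -> R, C1CPG_solution T f u0 u1 t r U ->
     forall s0 : 'I_N -> R,
     (forall n, 1 <= s0 n /\ inH (s0 n + 1) (t n) (t n.+1) u) ->
     forall s : 'I_N -> R,
     (forall n, 1 <= s n <= Num.min (r n)%:R (s0 n)) ->
     (Hnorm 1 0 T (u \- U)%R ^+ 2 <=
        C%:E * \sum_(n < N)
          ((step t n / 2) `^ (2 * s n)
           * (Gamma ((r n)%:R - s n + 1) / Gamma ((r n)%:R + s n - 1))
           * (1 / ((r n)%:R * ((r n)%:R - 1))))%:E
          * Hnorm (s n + 1) (t n) (t n.+1) u ^+ 2)%E /\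
     (Hnorm 2 0 T (u \- U)%R ^+ 2 <=
        C%:E * \sum_(n < N)
          ((step t n / 2) `^ (2 * s n - 2)
           * (Gamma ((r n)%:R - s n + 1) / Gamma ((r n)%:R + s n - 1)))%:E
          * Hnorm (s n + 1) (t n) (t n.+1) u ^+ 2)%E) /\
  (forall Cq s : R, 1 <= Cq -> 1 <= s ->
   exists2 C : R, 0 < C &
     forall (u0 u1 : R) (u : R -> R), exact_solution T f u0 u1 u ->
     inH (s + 1) 0 T u ->
     forall (N : nat) (t : nat -> R), is_partition T N t ->
     maxstep N t <= k0 ->
     (forall n : 'I_N, 1 <= maxstep N t / step t n <= Cq) ->
     forall r : nat, (3 <= r)%N ->
     forall U : R -> R, C1CPG_solution T f u0 u1 t (fun _ : 'I_N => r) U ->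
     (Hnorm 1 0 T (u \- U)%R <=
        (C * (maxstep N t `^ Num.min r%:R s / r%:R `^ s))%:E
        * Hnorm (s + 1) 0 T u)%E /\
     (Hnorm 2 0 T (u \- U)%R <=
        (C * (maxstep N t `^ (Num.min r%:R s - 1) / r%:R `^ (s - 1)))%:E
        * Hnorm (s + 1) 0 T u)%E).
Proof.
(* The Lipschitz part of the energy constant. With k0 = 1 / (2 cL) the product cL k0 is 1/2, the
   absorption threshold, and k0 <= 1 because cL >= 2. *)
pose cL := 2 + 4 * L ^+ 2.
have cL2 : 2 <= cL by rewrite /cL; have := sqr_ge0 L; lra.
pose k0 := (2 * cL)^-1.
have k00 : 0 < k0 by rewrite invr_gt0; lra.
have k01 : k0 <= 1 by rewrite /k0 invf_le1; lra.
have k0L : cL * k0 <= 2^-1.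
  by rewrite /k0 invfM mulrCA divff ?mulr1// gt_eqF//; lra.
have [C C0 HC] := stability T_gt0 L_gt0 k01 k0L f_cont f_lip.
exists k0 => //; split.
  (* C comes from stability and 16 from [interval_err]; neither depends on the partition, the
     degrees or the orders s n. *)
  exists (C * 16) => [|u0 u1 u Hu _ N t Ht tk r r3 U HU s0 _ s Hs].
    by rewrite mulr_gt0.
  have [u' [F [pu pu' LF HS]]] := HC u0 u1 u Hu.
  have [H1 H2] := HS N t Ht tk r r3 U HU.
  have [t0 tN tS] := Ht.
  have s1 n : 1 <= s n by have /andP[] := Hs n.
  have sr n : s n <= (r n)%:R.
    by have /andP[_] := Hs n; rewrite le_min => /andP[].
  have r1 n : 3 <= (r n)%:R :> R by rewrite (ler_nat R 3).
  have G0 n : 0 <= Gamma ((r n)%:R - s n + 1) / Gamma ((r n)%:R + s n - 1).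
    exact: Gamma_quotient_ge0.
  have k_gt0 n : (n < N)%N -> 0 < step t n / 2.
    by move=> nN; rewrite divr_gt0// subr_gt0 tS.
  have X0 n : (0 <= Hnorm (s n + 1) (t n) (t n.+1) u ^+ 2)%E by exact: sqre_ge0.
  have IE (n : 'I_N) : ((proj_err (t n) (t n.+1) (r n - 2) F)%:E <=
      (16 * ((step t n / 2) `^ (2 * s n - 2) *
       (Gamma ((r n)%:R - s n + 1) / Gamma ((r n)%:R + s n - 1))))%:E *
       Hnorm (s n + 1) (t n) (t n.+1) u ^+ 2)%E.
    have := partition_itv tS n; rewrite t0 tN => -[n0 nn nT].
    apply: (interval_err nn (r3 n) (s1 n) (sr n)).
    - exact: primS pu.
    - exact: primS pu'.
    - exact: L2ooS LF.
  split; [apply: (le_trans H1)|apply: (le_trans H2)].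
    apply: weighted_sum_le => //; first exact: ltW.
      move=> n; apply: mulr_ge0; first by apply: mulr_ge0 => //; exact: powR_ge0.
      by apply: divr_ge0 => //; apply: mulr_ge0; have := r1 n; lra.
    move=> n; have kn := k_gt0 n (ltn_ord n).
    (* For the H^1 norm each local error carries this weight, which raises the exponent of the step
       from 2 s - 2 to 2 s and supplies the factor 1 / (r (r - 1)). *)
    set c := (step t n / 2) ^+ 2 / _.
    have c0 : 0 <= c.
      apply: divr_ge0; first exact: sqr_ge0.
      by apply: mulr_ge0; have := r1 n; lra.
    have cIE := @lee_wpmul2l _ c%:E c0 _ _ (IE n).
    rewrite EFinM; apply: (le_trans cIE); rewrite muleA -EFinM.
    apply: lee_wpmul2r => //; rewrite lee_fin le_eqVlt; apply/orP; left; apply/eqP.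
    have -> : (step t n / 2) `^ (2 * s n) =
        (step t n / 2) ^+ 2 * (step t n / 2) `^ (2 * s n - 2).
      by rewrite -powR_mulrn ?(ltW kn)// -powRDr//; congr (_ `^ _); ring.
    rewrite /c; move: (Gamma _ / _) (_ `^ _) ((step t n / 2) ^+ 2) => A B D.
    by rewrite div1r; ring.
  apply: weighted_sum_le => //; first exact: ltW.
  by move=> n; apply: mulr_ge0 => //; exact: powR_ge0.
move=> Cq s _ s1; have [C1 C10 HE] := @partition_err R s s1.
exists ((1 + C) * C1) => [|u0 u1 u Hu _ N t Ht tk _ r r3 U HU].
  by rewrite mulr_gt0// addr_gt0.
have [u' [F [pu pu' LF HS]]] := HC u0 u1 u Hu.
have [H1 H2] := HS N t Ht tk (fun=> r) (fun=> r3) U HU.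
have [t0 tN tS] := Ht.
have N0 : (0 < N)%N.
  by rewrite lt0n; apply/eqP => N0; move: T_gt0; rewrite -tN N0 t0 ltxx.
set k := maxstep N t.
have kN n : (n < N)%N -> t n.+1 - t n <= k by exact: step_le_maxstep.
have k_gt0 : 0 < k by apply: lt_le_trans (kN 0%N N0); rewrite subr_gt0 tS.
have r1 : 3 <= r%:R :> R by rewrite (ler_nat R 3).
have r0 : 0 < r%:R :> R by lra.
have := HE N t k r u u' F tS kN k_gt0; rewrite t0 tN => /(_ T_gt0 r3 pu pu' LF).
set B := _ / _; set X := Hnorm (s + 1) 0 T u => HEr.
have X0 : (0 <= X)%E by exact: Hnorm_ge0.
have B0 : 0 <= B by apply: divr_ge0; exact: powR_ge0.
rewrite sqr_piecewise_err in HEr.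
have P0 n : 0 <= proj_err (t n) (t n.+1) (r - 2) F.
  exact: proj_err_ge0.
set S := \sum_(n < N) proj_err _ _ _ _ in HEr H2.
have C00 := ltW C0; have C100 := ltW C10.
split; last first.
  by rewrite -mulrA; apply: (lee_of_sqr _ C00 X0 H2 HEr); rewrite mulr_ge0.
(* The H^1 rate is the H^2 rate B times k / r, so both estimates follow from the same bound on the
   piecewise error. *)
have -> : k `^ Num.min r%:R s / r%:R `^ s = k / r%:R * B.
  have E (x y : R) : 0 < x -> x `^ y = x * x `^ (y - 1).
    by move=> x0; rewrite -{2}(powRr1 (ltW x0)) -powRDr// addrC subrK.
  by rewrite (E k)// (E r%:R)// /B invfM; ring.
have kr0 : 0 <= k / r%:R by rewrite divr_ge0// ltW.
rewrite -mulrA [C1 * _]mulrCA.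
apply: (@lee_of_sqr _ _ C ((k / r%:R) ^+ 2 * S) _ X) => //.
- by rewrite mulr_ge0// mulr_ge0.
- apply: (le_trans H1); rewrite lee_fin ler_wpM2l// mulr_sumr; apply: ler_sum => n _.
  apply: ler_wpM2r => //; apply: sqr_step_le => //; last exact: kN.
  by rewrite subr_ge0 ltW// tS.
rewrite EFinM [(k / r%:R * _) ^+ 2]exprMn [in X in (_ <= X)%E]EFinM -muleA.
by apply: lee_wpmul2l => //; rewrite lee_fin sqr_ge0.
Qed.
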